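(* Let $n\ge3$, $\mu_1,\mu_2,\beta>0$, $p=2q+1$ with $\frac{n}{n-2}<p\le\frac{n+2}{n-2}$, and let $(u,v)$ be a positive solution of (S) with $\limsup_{|x|\to0}u(x)=+\infty$ or $\limsup_{|x|\to0}v(x)=+\infty$. Then $u$ and $v$ are radially symmetric about the origin and strictly decreasing in $r=|x|>0$.
   Context: System (S): $-\Delta u=\mu_1u^{2q+1}+\beta u^qv^{q+1}$, $-\Delta v=\mu_2v^{2q+1}+\beta v^qu^{q+1}$ in $\mathbb{R}^n\setminus\{0\}$; a positive solution is a pair $u,v\in C^2(\mathbb{R}^n\setminus\{0\})$, $u,v>0$, solving (S). *)

(* Defs.v *)
From Stdlib Require Import Reals Lra.
Open Scope R_scope.

(* Points of R^n are encoded as x : nat -> R with x i = 0 for i >= n. *)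
Definition pt (n : nat) (x : nat -> R) : Prop := forall i, (n <= i)%nat -> x i = 0.

Fixpoint sqsum (n : nat) (x : nat -> R) : R :=
  match n with
  | O => 0
  | S m => sqsum m x + x m * x m
  end.

Definition enorm (n : nat) (x : nat -> R) : R := sqrt (sqsum n x).

Definition vsub (x y : nat -> R) : nat -> R := fun i => x i - y i.

Definition punct (n : nat) (x : nat -> R) : Prop := pt n x /\ 0 < enorm n x.

Definition shift (x : nat -> R) (i : nat) (t : R) : nat -> R :=
  fun j => if Nat.eqb j i then x j + t else x j.

Definition cont_punct (n : nat) (f : (nat -> R) -> R) : Prop :=
  forall x, punct n x -> forall eps, 0 < eps -> exists delta, 0 < delta /\
    forall y, punct n y -> enorm n (vsub y x) < delta -> Rabs (f y - f x) < eps.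

Definition C2_with_laplacian (n : nat) (u Lu : (nat -> R) -> R) : Prop :=
  exists (D1 : nat -> (nat -> R) -> R) (D2 : nat -> nat -> (nat -> R) -> R),
    (forall x i, punct n x -> (i < n)%nat ->
        derivable_pt_lim (fun t => u (shift x i t)) 0 (D1 i x)) /\
    (forall x i j, punct n x -> (i < n)%nat -> (j < n)%nat ->
        derivable_pt_lim (fun t => D1 j (shift x i t)) 0 (D2 i j x)) /\
    cont_punct n u /\
    (forall i, (i < n)%nat -> cont_punct n (D1 i)) /\
    (forall i j, (i < n)%nat -> (j < n)%nat -> cont_punct n (D2 i j)) /\
    (forall x, punct n x -> Lu x = sum_f_R0 (fun i => D2 i i x) (pred n)).

(* Main.v *)
(* The method of moving spheres. Fix a centre c <> 0 and compare u, v with their Kelvin transforms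
   in spheres of centre c and radius l. The exponent is at most critical and the nonlinearity increases
   in both components, so as long as the Kelvin transforms stay below (u, v) outside the sphere, the
   two gaps are superharmonic there. A singularity at the origin makes them
   nonzero while l < |c|, because then the Kelvin transforms are bounded; comparison with Green's
   function of the exterior domain gives positivity, the decay rate at infinity and the Hopf estimate
   on the sphere, and hence the radius can be increased. So every radius below |c| is reached. Since
   any two points x, y with |x| <= |y| are swapped by inversion in arbitrarily large spheres of this
   kind, u(y) <= u(x), which is symmetry and monotonicity at once.

   All maximum principles rest on second-order Peano expansions along the coordinate axes. *)
Require Import Defs.
From Stdlib Require Import Reals Lra Lia Arith Classical FunctionalExtensionality.
Open Scope R_scope.

(** * Finite sums, Euclidean norm and compactness of balls *)

(** The exterior of a sphere has two open ends, infinity and the origin, and no asymptotics of [u]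
    and [v] are known at either. Both ends are closed by barriers with arbitrarily small factors: a
    constant at infinity, and at the origin the harmonic function |y|^(-k), where k = n - 2
    throughout. The restriction l < |c| leaves the origin outside the sphere, where a superharmonic
    gap may blow up at no cost, while the closed ball that receives the inverse points consists of
    regular points only. The elementary minimum principle needs a strictly negative Laplacian. The
    solution supplies it: [u] is strictly superharmonic, so a small multiple of it is added to the
    function under comparison. At a minimum only expansions along the axes matter, but a Kelvin
    transform restricted to an axis is the solution along a curved path. This is why second-order
    expansions along curves come before the Laplacian of the transform. *)

Fixpoint rsum (n : nat) (f : nat -> R) : R :=
  match n with O => 0 | S m => rsum m f + f m end.

Lemma rsum_ext n f g : (forall i, (i < n)%nat -> f i = g i) -> rsum n f = rsum n g.
Proof.
  induction n as [|n IH]; intros H; simpl; [reflexivity|].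
  rewrite IH by (intros i Hi; apply H; lia). rewrite (H n) by lia. reflexivity.
Qed.

Lemma rsum_plus n f g : rsum n (fun i => f i + g i) = rsum n f + rsum n g.
Proof. induction n; simpl; [ring | rewrite IHn; ring]. Qed.

Lemma rsum_scal n a f : rsum n (fun i => a * f i) = a * rsum n f.
Proof. induction n; simpl; [ring | rewrite IHn; ring]. Qed.

Lemma rsum_const n a : rsum n (fun _ => a) = INR n * a.
Proof. induction n; [simpl; ring | rewrite S_INR; simpl rsum; rewrite IHn; ring]. Qed.

Lemma rsum_zero n f : (forall i, (i < n)%nat -> f i = 0) -> rsum n f = 0.
Proof. intros H. rewrite (rsum_ext _ _ (fun _ => 0) H), rsum_const. ring. Qed.

Lemma rsum_le n f g : (forall i, (i < n)%nat -> f i <= g i) -> rsum n f <= rsum n g.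
Proof.
  induction n as [|n IH]; intros H; simpl; [lra|].
  apply Rplus_le_compat; [apply IH; intros; apply H; lia | apply H; lia].
Qed.

Lemma rsum_nonneg n f : (forall i, (i < n)%nat -> 0 <= f i) -> 0 <= rsum n f.
Proof. intros H. rewrite <- (rsum_zero n (fun _ => 0)) by auto. apply rsum_le, H. Qed.

Lemma rsum_term_le n f i : (forall j, (j < n)%nat -> 0 <= f j) -> (i < n)%nat -> f i <= rsum n f.
Proof.
  induction n as [|n IH]; intros H Hi; [lia|]. simpl.
  destruct (Nat.eq_dec i n) as [->|Hne].
  - assert (0 <= rsum n f) by (apply rsum_nonneg; intros; apply H; lia). lra.
  - assert (f i <= rsum n f) by (apply IH; [intros; apply H|]; lia).
    specialize (H n ltac:(lia)). lra.
Qed.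

Lemma rsum_exchange n m (f : nat -> nat -> R) :
  rsum n (fun i => rsum m (fun j => f i j)) = rsum m (fun j => rsum n (fun i => f i j)).
Proof.
  induction n; simpl; [symmetry; now apply rsum_zero|].
  rewrite IHn, <- rsum_plus. reflexivity.
Qed.

Definition kron (i j : nat) : R := if Nat.eqb i j then 1 else 0.

Lemma rsum_kron n j f : (j < n)%nat -> rsum n (fun i => kron i j * f i) = f j.
Proof.
  induction n as [|n IH]; intros Hj; [lia|]. simpl. unfold kron at 2.
  destruct (Nat.eqb_spec n j) as [->|Hne].
  - rewrite rsum_zero; [ring|]. intros i Hi. unfold kron.
    destruct (Nat.eqb_spec i j); [lia | ring].
  - rewrite IH by lia. ring.
Qed.

Lemma rsum_f_R0 f n : sum_f_R0 f n = rsum (S n) f.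
Proof. induction n; simpl; [ring | rewrite IHn; reflexivity]. Qed.

Definition vadd (x y : nat -> R) : nat -> R := fun i => x i + y i.
Definition smul (a : R) (x : nat -> R) : nat -> R := fun i => a * x i.
Definition dot (n : nat) (x y : nat -> R) : R := rsum n (fun i => x i * y i).
Definition edist (n : nat) (x y : nat -> R) : R := enorm n (vsub x y).

Lemma sqsum_dot n x : sqsum n x = dot n x x.
Proof. unfold dot. induction n; simpl; congruence. Qed.

Lemma sqsum_nonneg n x : 0 <= sqsum n x.
Proof. rewrite sqsum_dot. apply rsum_nonneg. intros. nra. Qed.

Lemma enorm_nonneg n x : 0 <= enorm n x.
Proof. apply sqrt_pos. Qed.

Lemma enorm_sq n x : enorm n x * enorm n x = sqsum n x.
Proof. apply sqrt_sqrt, sqsum_nonneg. Qed.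

Lemma enorm_le n x a : 0 <= a -> sqsum n x <= a * a -> enorm n x <= a.
Proof. intros Ha H. rewrite <- (sqrt_square a Ha). now apply sqrt_le_1_alt. Qed.

(** Induction on the dimension: the norm on [S n] coordinates is the planar norm of the pair
    [(enorm n x, x n)], so only the two-dimensional Cauchy-Schwarz inequality [HPQ] is needed. *)
Lemma enorm_triang n x y : enorm n (vadd x y) <= enorm n x + enorm n y.
Proof.
  induction n as [|n IH].
  - unfold enorm; simpl. rewrite sqrt_0. lra.
  - assert (Hx := enorm_sq (S n) x). assert (Hy := enorm_sq (S n) y).
    simpl sqsum in Hx, Hy. rewrite <- enorm_sq in Hx, Hy.
    assert (H1 := enorm_nonneg (S n) x). assert (H2 := enorm_nonneg (S n) y).
    assert (H3 := enorm_nonneg n x). assert (H4 := enorm_nonneg n y).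
    assert (H5 := enorm_nonneg n (vadd x y)).
    apply enorm_le; [lra|]. simpl. rewrite <- enorm_sq. unfold vadd at 3 4.
    set (P := enorm (S n) x) in *. set (Q := enorm (S n) y) in *.
    set (a := enorm n x) in *. set (b := enorm n y) in *.
    set (e := enorm n (vadd x y)) in *.
    assert (HPQ : a * b + x n * y n <= P * Q).
    { destruct (Rle_dec 0 (a * b + x n * y n)) as [Hp|Hp]; [|nra].
      apply Rsqr_incr_0_var; [|nra]. unfold Rsqr.
      replace (P * Q * (P * Q)) with ((P * P) * (Q * Q)) by ring.
      rewrite Hx, Hy. assert (Hsq := Rle_0_sqr (a * y n - b * x n)). unfold Rsqr in Hsq. lra. }
    assert (e * e <= (a + b) * (a + b)) by nra. nra.
Qed.

Lemma enorm_smul n a x : enorm n (smul a x) = Rabs a * enorm n x.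
Proof.
  unfold enorm. rewrite <- sqrt_Rsqr_abs, <- sqrt_mult_alt by apply Rle_0_sqr.
  f_equal. rewrite !sqsum_dot. unfold dot, smul, Rsqr. rewrite <- rsum_scal.
  apply rsum_ext. intros. ring.
Qed.

Lemma enorm_ext n x y : (forall i, (i < n)%nat -> x i = y i) -> enorm n x = enorm n y.
Proof.
  intros H. unfold enorm. f_equal. rewrite !sqsum_dot. apply rsum_ext.
  intros i Hi. now rewrite H.
Qed.

Lemma coord_le_enorm n x i : (i < n)%nat -> Rabs (x i) <= enorm n x.
Proof.
  intros Hi. rewrite <- sqrt_Rsqr_abs. apply sqrt_le_1_alt. rewrite sqsum_dot.
  apply (rsum_term_le n (fun i => x i * x i)); [intros; nra | exact Hi].
Qed.

Lemma enorm_le_sup n x d : 0 <= d -> (forall i, (i < n)%nat -> Rabs (x i) <= d) ->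
  enorm n x <= INR n * d.
Proof.
  intros Hd. induction n as [|n IH]; intros H.
  - unfold enorm; simpl. rewrite sqrt_0. lra.
  - specialize (IH ltac:(intros; apply H; lia)).
    rewrite S_INR. assert (0 <= INR n) by apply pos_INR.
    apply enorm_le; [nra|]. simpl. rewrite <- enorm_sq.
    assert (Hn := enorm_nonneg n x). specialize (H n ltac:(lia)).
    assert (x n * x n <= d * d).
    { rewrite <- (Rabs_pos_eq (x n * x n)) by nra. rewrite Rabs_mult.
      assert (0 <= Rabs (x n)) by apply Rabs_pos. nra. }
    assert (enorm n x * enorm n x <= (INR n * d) * (INR n * d)) by nra.
    assert (0 <= INR n * d) by nra. nra.
Qed.

Lemma edist_sym n x y : edist n x y = edist n y x.
Proof.
  unfold edist. replace (vsub x y) with (smul (-1) (vsub y x)).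
  - rewrite enorm_smul, Rabs_left by lra. ring.
  - extensionality i. unfold smul, vsub. ring.
Qed.

Lemma edist_triang n x y z : edist n x z <= edist n x y + edist n y z.
Proof.
  unfold edist. replace (vsub x z) with (vadd (vsub x y) (vsub y z)).
  - apply enorm_triang.
  - extensionality i. unfold vadd, vsub. ring.
Qed.

Lemma edist_nonneg n x y : 0 <= edist n x y.
Proof. apply enorm_nonneg. Qed.

Definition origin : nat -> R := fun _ => 0.

Lemma edist_origin n x : edist n x origin = enorm n x.
Proof. apply enorm_ext. intros. unfold vsub, origin. ring. Qed.

Lemma pt_ext n x y : pt n x -> pt n y -> (forall i, (i < n)%nat -> x i = y i) -> x = y.
Proof.
  intros Hx Hy H. extensionality i. destruct (Nat.le_gt_cases n i) as [Hi|Hi].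
  - rewrite Hx, Hy; auto.
  - now apply H.
Qed.

Lemma edist_pos n x y : pt n x -> pt n y -> x <> y -> 0 < edist n x y.
Proof.
  intros Hx Hy Hne. destruct (edist_nonneg n x y) as [H|H]; [exact H|].
  exfalso. apply Hne. apply (pt_ext n); auto. intros i Hi.
  assert (Hc := coord_le_enorm n (vsub x y) i Hi). unfold edist in H. rewrite <- H in Hc.
  unfold vsub in Hc. assert (0 <= Rabs (x i - y i)) by apply Rabs_pos.
  destruct (Req_dec (x i - y i) 0) as [H1|H1]; [lra|].
  apply Rabs_pos_lt in H1. lra.
Qed.

Lemma edist_diff_le n y x a : Rabs (edist n y a - edist n x a) <= edist n y x.
Proof.
  assert (H1 := edist_triang n y x a). assert (H2 := edist_triang n x y a).
  rewrite (edist_sym n x y) in H2. apply Rabs_le. lra.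
Qed.

Lemma pt_vadd n x y : pt n x -> pt n y -> pt n (vadd x y).
Proof. intros Hx Hy i Hi. unfold vadd. rewrite Hx, Hy; auto; ring. Qed.
Lemma pt_vsub n x y : pt n x -> pt n y -> pt n (vsub x y).
Proof. intros Hx Hy i Hi. unfold vsub. rewrite Hx, Hy; auto; ring. Qed.
Lemma pt_smul n a x : pt n x -> pt n (smul a x).
Proof. intros Hx i Hi. unfold smul. rewrite Hx; auto; ring. Qed.
Lemma pt_shift n x i t : pt n x -> (i < n)%nat -> pt n (shift x i t).
Proof. intros Hx Hi j Hj. unfold shift. destruct (Nat.eqb_spec j i); [lia | auto]. Qed.
Lemma pt_origin n : pt n origin.
Proof. intros i _. reflexivity. Qed.

Lemma edist_shift n x i t : (i < n)%nat -> edist n (shift x i t) x <= INR n * Rabs t.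
Proof.
  intros Hi. apply enorm_le_sup; [apply Rabs_pos|]. intros j Hj. unfold vsub, shift.
  destruct (Nat.eqb_spec j i).
  - replace (x j + t - x j) with t by ring. lra.
  - rewrite Rminus_diag, Rabs_R0. apply Rabs_pos.
Qed.

(** Compactness in the one form used everywhere: [d] is a scale, and boundedness, attained minima
    and uniform continuity all arise by choosing what [Q d] says. The proof takes the supremum of
    the endpoints up to which a single scale works. *)
Lemma segment_cover a b (Q : R -> R -> Prop) : a <= b ->
  (forall d d' t, 0 < d' <= d -> Q d t -> Q d' t) ->
  (forall x, a <= x <= b -> exists d, 0 < d /\
     forall y, a <= y <= b -> Rabs (y - x) < d -> Q d y) ->
  exists d, 0 < d /\ forall y, a <= y <= b -> Q d y.
Proof.
  intros Hab Hanti Hloc.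
  set (E := fun t => a <= t <= b /\ exists d, 0 < d /\ forall y, a <= y <= t -> Q d y).
  assert (Ea : E a).
  { split; [lra|]. destruct (Hloc a ltac:(lra)) as (d & Hd & H). exists d. split; auto.
    intros y Hy. apply H; [lra|]. replace (y - a) with 0 by lra. rewrite Rabs_R0. exact Hd. }
  destruct (completeness E) as [s [Hub Hlub]].
  { exists b. intros t [Ht _]. lra. }
  { now exists a. }
  assert (Hs1 : a <= s) by (apply Hub, Ea).
  assert (Hs2 : s <= b) by (apply Hlub; intros t [Ht _]; lra).
  destruct (Hloc s ltac:(lra)) as (d & Hd & H).
  assert (Hex : exists t, E t /\ s - d < t).
  { apply NNPP. intros Hn. assert (s <= s - d); [|lra]. apply Hlub. intros t Ht.
    apply Rnot_lt_le. intros Hlt. apply Hn. now exists t. }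
  destruct Hex as (t & [Ht (d1 & Hd1 & H1)] & Hst).
  assert (Hts : t <= s) by (apply Hub; split; eauto).
  assert (HE : E (Rmin b (s + d / 2))).
  { split.
    - unfold Rmin. destruct Rle_dec; lra.
    - exists (Rmin d d1). assert (0 < Rmin d d1) by (unfold Rmin; destruct Rle_dec; lra).
      split; auto. intros y Hy. assert (Hyb := Rmin_l b (s + d / 2)).
      assert (Hyd := Rmin_r b (s + d / 2)).
      destruct (Rle_dec y t).
      + apply (Hanti d1); [split; auto; apply Rmin_r|]. apply H1. lra.
      + apply (Hanti d); [split; auto; apply Rmin_l|]. apply H; [lra|].
        apply Rabs_def1; lra. }
  assert (Hle := Hub _ HE).
  assert (Hb : Rmin b (s + d / 2) = b) by (unfold Rmin in *; destruct Rle_dec; lra).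
  rewrite Hb in HE. destruct HE as [_ HE]. exact HE.
Qed.

Definition set_coord (x : nat -> R) (m : nat) (t : R) : nat -> R :=
  fun j => if Nat.eqb j m then t else x j.

(** A tube argument: [segment_cover] runs over the last coordinate, and the induction hypothesis
    provides, around each of its values, a slab on which one scale works. *)
Lemma box_cover n M (P : R -> (nat -> R) -> Prop) : 0 <= M ->
  (forall d d' y, 0 < d' <= d -> P d y -> P d' y) ->
  (forall x, pt n x -> (forall i, (i < n)%nat -> Rabs (x i) <= M) -> exists d, 0 < d /\
     forall y, pt n y -> (forall i, (i < n)%nat -> Rabs (y i) <= M) ->
       (forall i, (i < n)%nat -> Rabs (y i - x i) < d) -> P d y) ->
  exists d, 0 < d /\ forall y, pt n y -> (forall i, (i < n)%nat -> Rabs (y i) <= M) -> P d y.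
Proof.
  intros HM. revert P. induction n as [|n IH]; intros P Hanti Hloc.
  { destruct (Hloc origin (pt_origin 0)) as (d & Hd & H); [lia|].
    exists d. split; auto. intros y Hy Hb. apply H; auto; lia. }
  destruct (segment_cover (- M) M (fun d t => forall y, pt n y ->
     (forall i, (i < n)%nat -> Rabs (y i) <= M) -> P d (set_coord y n t)))
    as (d & Hd & H); [lra| | |].
  { intros d d' t Hd H y Hy Hb. apply (Hanti d); auto. }
  { intros t0 Ht0.
    destruct (IH (fun d y => forall t, - M <= t <= M -> Rabs (t - t0) < d ->
       P d (set_coord y n t))) as (d & Hd & H).
    - intros d d' y Hd H t Ht Htt. apply (Hanti d); auto. apply H; auto. lra.
    - intros x Hx Hxb.
      destruct (Hloc (set_coord x n t0)) as (d & Hd & H).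
      + intros i Hi. unfold set_coord. destruct (Nat.eqb_spec i n); [lia | apply Hx; lia].
      + intros i Hi. unfold set_coord. destruct (Nat.eqb_spec i n).
        * apply Rabs_le. lra.
        * apply Hxb. lia.
      + exists d. split; auto. intros y Hy Hyb Hyx t Ht Htt. apply H.
        * intros i Hi. unfold set_coord. destruct (Nat.eqb_spec i n); [lia | apply Hy; lia].
        * intros i Hi. unfold set_coord. destruct (Nat.eqb_spec i n).
          -- apply Rabs_le. lra.
          -- apply Hyb. lia.
        * intros i Hi. unfold set_coord. destruct (Nat.eqb_spec i n); [exact Htt|].
          apply Hyx. lia.
    - exists d. split; auto. }
  exists d. split; auto. intros y Hy Hb.
  replace y with (set_coord (set_coord y n 0) n (y n)).
  - apply H.
    + specialize (Hb n ltac:(lia)). revert Hb. unfold Rabs. destruct Rcase_abs; lra.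
    + intros i Hi. unfold set_coord. destruct (Nat.eqb_spec i n); [reflexivity | apply Hy; lia].
    + intros i Hi. unfold set_coord. destruct (Nat.eqb_spec i n); [lia | apply Hb; lia].
  - extensionality i. unfold set_coord. destruct (Nat.eqb_spec i n); congruence.
Qed.

Lemma ball_cover n M (P : R -> (nat -> R) -> Prop) :
  (forall d d' y, 0 < d' <= d -> P d y -> P d' y) ->
  (forall x, pt n x -> enorm n x <= M -> exists d, 0 < d /\
     forall y, pt n y -> enorm n y <= M -> edist n y x < d -> P d y) ->
  exists d, 0 < d /\ forall y, pt n y -> enorm n y <= M -> P d y.
Proof.
  intros Hanti Hloc.
  destruct (Rlt_dec M 0) as [HM|HM].
  { exists 1. split; [lra|]. intros y _ Hy. assert (Hn := enorm_nonneg n y). lra. }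
  destruct (box_cover n M (fun d y => enorm n y <= M -> P d y)) as (d & Hd & H); [lra| | |].
  { intros d d' y Hd H Hy. apply (Hanti d); auto. }
  { intros x Hx _.
    assert (Hsup : forall d y, 0 < d -> (forall i, (i < n)%nat ->
              Rabs (y i - x i) < d / (INR n + 1)) -> edist n y x < d).
    { intros d y Hd Hy. assert (HN := pos_INR n).
      apply Rle_lt_trans with (INR n * (d / (INR n + 1))).
      - apply enorm_le_sup; [apply Rlt_le, Rdiv_lt_0_compat; lra|].
        intros i Hi. apply Rlt_le, Hy, Hi.
      - replace d with ((INR n + 1) * (d / (INR n + 1))) at 2 by (field; lra).
        assert (0 < d / (INR n + 1)) by (apply Rdiv_lt_0_compat; lra). nra. }
    assert (HN := pos_INR n).
    assert (Hsm : forall d, 0 < d -> 0 < d / (INR n + 1) <= d).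
    { intros d Hd. split; [apply Rdiv_lt_0_compat; lra|].
      replace d with ((INR n + 1) * (d / (INR n + 1))) at 2 by (field; lra).
      assert (0 < d / (INR n + 1)) by (apply Rdiv_lt_0_compat; lra). nra. }
    destruct (Rle_dec (enorm n x) M) as [Hxm|Hxm].
    - destruct (Hloc x Hx Hxm) as (d & Hd & H). exists (d / (INR n + 1)).
      split; [apply Hsm, Hd|]. intros y Hy _ Hyx Hym. apply (Hanti d); [apply Hsm, Hd|].
      apply H; auto.
    (* A point outside the ball gets a neighbourhood that misses the ball, so its condition is
       vacuous. Dividing by [INR n + 1] passes from closeness of coordinates to Euclidean closeness;
       the 1 avoids division by zero. *)
    - exists ((enorm n x - M) / (INR n + 1)). split; [apply Hsm; lra|].
      intros y Hy _ Hyx Hym. exfalso.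
      assert (Hd : edist n y x < enorm n x - M) by (apply Hsup; auto; lra).
      assert (Ht := edist_triang n x y origin). rewrite !edist_origin, edist_sym in Ht. lra. }
  exists d. split; auto. intros y Hy Hym. apply H; auto.
  intros i Hi. apply Rle_trans with (enorm n y); auto. now apply coord_le_enorm.
Qed.

(** * Continuity, second-order jets and the minimum principle *)

Definition cont_at (n : nat) (f : (nat -> R) -> R) (x : nat -> R) : Prop :=
  forall eps, 0 < eps -> exists d, 0 < d /\
    forall y, pt n y -> edist n y x < d -> Rabs (f y - f x) < eps.

Lemma cont_at_const n a x : cont_at n (fun _ => a) x.
Proof. intros e He. exists 1. split; [lra|]. intros. rewrite Rminus_diag, Rabs_R0. exact He. Qed.

Lemma cont_at_comp2 n (G : R -> R -> R) f g x :
  (forall eps, 0 < eps -> exists d, 0 < d /\ forall a b, Rabs (a - f x) < d ->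
     Rabs (b - g x) < d -> Rabs (G a b - G (f x) (g x)) < eps) ->
  cont_at n f x -> cont_at n g x -> cont_at n (fun y => G (f y) (g y)) x.
Proof.
  intros HG Hf Hg e He. destruct (HG e He) as (d & Hd & H).
  destruct (Hf d Hd) as (d1 & Hd1 & H1). destruct (Hg d Hd) as (d2 & Hd2 & H2).
  exists (Rmin d1 d2). split; [now apply Rmin_glb_lt|].
  intros y Hy Hyx. apply H; [apply H1 | apply H2]; auto;
    eapply Rlt_le_trans; eauto; [apply Rmin_l | apply Rmin_r].
Qed.

Lemma cont_at_comp n (G : R -> R) f x :
  continuity_pt G (f x) -> cont_at n f x -> cont_at n (fun y => G (f y)) x.
Proof.
  intros HG Hf. apply (cont_at_comp2 n (fun a _ => G a) f f); auto.
  intros e He. destruct (HG e He) as (d & Hd & H). exists d. split; auto.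
  intros a _ Ha _. destruct (Req_dec a (f x)) as [->|Hne].
  - rewrite Rminus_diag, Rabs_R0. exact He.
  - apply H. split; [split; [exact I | auto] | exact Ha].
Qed.

Lemma cont_at_plus n f g x : cont_at n f x -> cont_at n g x -> cont_at n (fun y => f y + g y) x.
Proof.
  apply (cont_at_comp2 n Rplus). intros e He. exists (e / 2). split; [lra|].
  intros a b Ha Hb. apply Rabs_def2 in Ha, Hb. apply Rabs_def1; lra.
Qed.

Lemma cont_at_scal n a f x : cont_at n f x -> cont_at n (fun y => a * f y) x.
Proof.
  apply (cont_at_comp n (fun t => a * t)).
  apply continuity_pt_mult; [apply continuity_pt_const; now intros ? | apply derivable_continuous_pt, derivable_pt_id].
Qed.

Lemma cont_at_mult n f g x : cont_at n f x -> cont_at n g x -> cont_at n (fun y => f y * g y) x.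
Proof.
  intros Hf Hg.
  assert (Hsq : forall h, cont_at n h x -> cont_at n (fun y => h y * h y) x).
  { intros h Hh. apply (cont_at_comp n (fun t => t * t)); auto.
    apply continuity_pt_mult; apply derivable_continuous_pt, derivable_pt_id. }
  (* Polarization: products reduce to squares, hence to composition with a function of one
     variable. *)
  replace (fun y => f y * g y) with
    (fun y => / 4 * ((f y + g y) * (f y + g y)) + - / 4 * ((f y + -1 * g y) * (f y + -1 * g y))).
  - apply cont_at_plus; apply cont_at_scal; apply Hsq; apply cont_at_plus; auto.
    now apply cont_at_scal.
  - extensionality y. field.
Qed.

Lemma cont_at_rsum n m (f : nat -> (nat -> R) -> R) x :
  (forall i, (i < m)%nat -> cont_at n (f i) x) -> cont_at n (fun y => rsum m (fun i => f i y)) x.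
Proof.
  induction m as [|m IH]; intros H; simpl; [apply cont_at_const|].
  apply cont_at_plus; [apply IH; intros; apply H|apply H]; lia.
Qed.

Lemma cont_at_edist n a x : cont_at n (fun y => edist n y a) x.
Proof.
  intros e He. exists e. split; auto. intros y _ Hy.
  eapply Rle_lt_trans; [apply edist_diff_le | exact Hy].
Qed.

Lemma cont_at_coord n i x : (i < n)%nat -> cont_at n (fun y => y i) x.
Proof.
  intros Hi e He. exists e. split; auto. intros y _ Hy.
  eapply Rle_lt_trans; [apply (coord_le_enorm n (vsub y x) i Hi) | exact Hy].
Qed.

Lemma cont_at_map n (f : (nat -> R) -> R) (V : (nat -> R) -> (nat -> R)) x :
  (forall y, pt n y -> pt n (V y)) -> (forall i, (i < n)%nat -> cont_at n (fun y => V y i) x) ->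
  cont_at n f (V x) -> cont_at n (fun y => f (V y)) x.
Proof.
  intros HV Hc Hf e He. destruct (Hf e He) as (d & Hd & H).
  assert (Hm : cont_at n (fun y => rsum n (fun i => Rabs (V y i - V x i))) x).
  { apply (cont_at_rsum n n (fun i y => Rabs (V y i - V x i))). intros i Hi.
    apply (cont_at_comp n Rabs (fun y => V y i - V x i)); [apply Rcontinuity_abs|].
    apply (cont_at_plus n (fun y => V y i) (fun _ => - V x i)); [auto | apply cont_at_const]. }
  destruct (Hm (d / (INR n + 1))) as (d1 & Hd1 & H1).
  { apply Rdiv_lt_0_compat; [exact Hd | assert (Hn := pos_INR n); lra]. }
  exists d1. split; auto. intros y Hy Hyx. apply H; auto.
  specialize (H1 y Hy Hyx). cbv beta in H1.
  rewrite (rsum_zero n (fun i => Rabs (V x i - V x i))) in H1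
    by (intros; rewrite Rminus_diag; apply Rabs_R0).
  rewrite Rminus_0_r in H1. assert (Hnn := pos_INR n).
  set (s := rsum n (fun i => Rabs (V y i - V x i))) in *.
  assert (Hs : 0 <= s) by (apply rsum_nonneg; intros; apply Rabs_pos).
  rewrite Rabs_pos_eq in H1 by exact Hs.
  apply Rle_lt_trans with (INR n * s).
  - apply enorm_le_sup; auto. intros i Hi.
    apply (rsum_term_le n (fun i => Rabs (V y i - V x i))); auto. intros; apply Rabs_pos.
  - replace d with ((INR n + 1) * (d / (INR n + 1))) by (field; lra).
    assert (0 < d / (INR n + 1)) by (apply Rdiv_lt_0_compat; lra). nra.
Qed.

Lemma cont_at_eventually_gt n f x a : cont_at n f x -> a < f x ->
  exists d, 0 < d /\ forall y, pt n y -> edist n y x < d -> a < f y.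
Proof.
  intros Hf Ha. destruct (Hf (f x - a)) as (d & Hd & H); [lra|]. exists d. split; auto.
  intros y Hy Hyx. specialize (H y Hy Hyx). apply Rabs_def2 in H. lra.
Qed.

Lemma punct_nbhd n x : punct n x -> exists d, 0 < d /\
  forall y, pt n y -> edist n y x < d -> punct n y.
Proof.
  intros [Hx Hp]. exists (enorm n x). split; auto. intros y Hy Hyx. split; auto.
  assert (H := edist_triang n x y origin). rewrite !edist_origin, edist_sym in H. lra.
Qed.

Lemma cont_punct_at n f x : cont_punct n f -> punct n x -> cont_at n f x.
Proof.
  intros Hf Hx e He. destruct (Hf x Hx e He) as (d & Hd & H).
  destruct (punct_nbhd n x Hx) as (d1 & Hd1 & H1).
  exists (Rmin d d1). split; [now apply Rmin_glb_lt|]. intros y Hy Hyx. apply H.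
  - apply H1; auto. eapply Rlt_le_trans; [exact Hyx | apply Rmin_r].
  - eapply Rlt_le_trans; [exact Hyx | apply Rmin_l].
Qed.

(* Second-order Peano expansion at 0: f t = a + b t + c t^2 + o(t^2). *)
Definition jet (f : R -> R) (a b c : R) : Prop :=
  exists g, continuity_pt g 0 /\ g 0 = c /\ forall t, f t = a + b * t + t * t * g t.

Lemma continuity_pt_add f g x :
  continuity_pt f x -> continuity_pt g x -> continuity_pt (fun t => f t + g t) x.
Proof. apply continuity_pt_plus. Qed.
Lemma continuity_pt_mul f g x :
  continuity_pt f x -> continuity_pt g x -> continuity_pt (fun t => f t * g t) x.
Proof. apply continuity_pt_mult. Qed.
Lemma continuity_pt_cst a x : continuity_pt (fun _ => a) x.
Proof. apply continuity_pt_const. intros ? ?. reflexivity. Qed.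
Lemma continuity_pt_ident x : continuity_pt (fun t => t) x.
Proof. apply derivable_continuous_pt, derivable_pt_id. Qed.

Ltac ctac := repeat first
  [ assumption | apply continuity_pt_ident | apply continuity_pt_cst
  | apply continuity_pt_add | apply continuity_pt_mul ].

Lemma jet_ext f f' a b c : (forall t, f t = f' t) -> jet f a b c -> jet f' a b c.
Proof. intros He (g & H & H0 & Hg). exists g. repeat split; auto. intros. now rewrite <- He. Qed.

Lemma jet_eq f a b c a' b' c' : jet f a b c -> a = a' -> b = b' -> c = c' -> jet f a' b' c'.
Proof. now intros H -> -> ->. Qed.

Lemma jet_0 f a b c : jet f a b c -> f 0 = a.
Proof. intros (g & _ & _ & Hg). rewrite Hg. ring. Qed.

Lemma jet_poly a b c : jet (fun t => a + b * t + c * (t * t)) a b c.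
Proof. exists (fun _ => c). repeat split; [ctac | intros; ring]. Qed.

Lemma jet_const a : jet (fun _ => a) a 0 0.
Proof. eapply jet_ext; [|apply jet_poly]. intros; simpl; ring. Qed.

Lemma jet_plus f1 f2 a1 b1 c1 a2 b2 c2 : jet f1 a1 b1 c1 -> jet f2 a2 b2 c2 ->
  jet (fun t => f1 t + f2 t) (a1 + a2) (b1 + b2) (c1 + c2).
Proof.
  intros (g1 & H1 & E1 & F1) (g2 & H2 & E2 & F2). exists (fun t => g1 t + g2 t).
  repeat split; [ctac | congruence | intros t; rewrite F1, F2; ring].
Qed.

Lemma jet_mult f1 f2 a1 b1 c1 a2 b2 c2 : jet f1 a1 b1 c1 -> jet f2 a2 b2 c2 ->
  jet (fun t => f1 t * f2 t) (a1 * a2) (a1 * b2 + b1 * a2) (a1 * c2 + b1 * b2 + c1 * a2).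
Proof.
  intros (g1 & H1 & E1 & F1) (g2 & H2 & E2 & F2).
  exists (fun t => a1 * g2 t + b1 * b2 + g1 t * a2 + t * (b1 * g2 t + g1 t * b2) + t * t * (g1 t * g2 t)).
  repeat split; [ctac | rewrite E1, E2; ring | intros t; rewrite F1, F2; ring].
Qed.

Lemma jet_scal k f a b c : jet f a b c -> jet (fun t => k * f t) (k * a) (k * b) (k * c).
Proof.
  intros H. eapply jet_eq; [apply (jet_mult _ _ _ _ _ _ _ _ (jet_const k) H)| | |]; ring.
Qed.

Lemma jet_rsum m (f : nat -> R -> R) a b c :
  (forall i, (i < m)%nat -> jet (f i) (a i) (b i) (c i)) ->
  jet (fun t => rsum m (fun i => f i t)) (rsum m a) (rsum m b) (rsum m c).
Proof.
  induction m as [|m IH]; intros H; simpl; [apply jet_const|].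
  apply jet_plus; [apply IH; intros; apply H | apply H]; lia.
Qed.

Lemma jet_comp G f g0 g1 g2 a b c : jet (fun s => G (a + s)) g0 g1 g2 -> jet f a b c ->
  jet (fun t => G (f t)) g0 (g1 * b) (g1 * c + g2 * (b * b)).
Proof.
  intros (g & H & E & F) (p & Hp & Ep & Fp).
  set (s := fun t => b * t + t * t * p t).
  exists (fun t => g1 * p t + (b + t * p t) * (b + t * p t) * g (s t)). split; [|split].
  - assert (continuity_pt (fun t => g (s t)) 0); [|ctac].
    apply (continuity_pt_comp s g); [unfold s; ctac|].
    replace (s 0) with 0 by (unfold s; ring). exact H.
  - replace (s 0) with 0 by (unfold s; ring). rewrite Ep, E. ring.
  - intros t. replace (f t) with (a + s t) by (rewrite Fp; unfold s; ring).
    rewrite F. unfold s. ring.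
Qed.

Lemma jet_intro f a b c : f 0 = a ->
  (forall eps, 0 < eps -> exists d, 0 < d /\ forall t, Rabs t < d ->
     Rabs (f t - a - b * t - c * (t * t)) <= eps * (t * t)) -> jet f a b c.
Proof.
  intros H0 H.
  exists (fun t => if Req_dec_T t 0 then c else (f t - a - b * t) / (t * t)).
  split; [|split].
  - intros e He. destruct (H (e / 2)) as (d & Hd & Hdd); [lra|]. exists d. split; auto.
    intros t [[_ Ht] Htd]. cbn in Htd |- *. unfold Rdist in *. rewrite Rminus_0_r in Htd.
    destruct (Req_dec_T t 0) as [E|E]; [congruence|].
    destruct (Req_dec_T 0 0) as [_|E']; [|lra].
    replace ((f t - a - b * t) / (t * t) - c) with ((f t - a - b * t - c * (t * t)) / (t * t))
      by (field; exact E).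
    assert (Htt : 0 < t * t) by nra.
    unfold Rdiv. rewrite Rabs_mult, Rabs_inv, (Rabs_pos_eq (t * t)) by lra.
    apply Rmult_lt_reg_r with (t * t); auto. rewrite Rmult_assoc, Rinv_l by lra.
    specialize (Hdd t Htd). nra.
  - destruct (Req_dec_T 0 0); [reflexivity | lra].
  - intros t. destruct (Req_dec_T t 0) as [->|E]; [rewrite H0; ring | field; exact E].
Qed.

Lemma increment_le (g g' : R -> R) M t :
  (forall s, Rabs s <= Rabs t -> derivable_pt_lim g s (g' s)) ->
  (forall s, Rabs s <= Rabs t -> Rabs (g' s) <= M) -> Rabs (g t - g 0) <= M * Rabs t.
Proof.
  intros Hd HM. destruct (Rtotal_order t 0) as [Ht|[->|Ht]].
  - assert (Hb : forall s, t <= s <= 0 -> Rabs s <= Rabs t).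
    { intros s Hs. rewrite !Rabs_left1 by lra. lra. }
    destruct (MVT_cor2 g g' t 0 Ht) as (c & Hc & Hc2); [intros; apply Hd, Hb; lra|].
    rewrite <- Rabs_Ropp. replace (- (g t - g 0)) with (g' c * (0 - t)) by lra.
    rewrite Rabs_mult, (Rabs_left t) by lra. rewrite (Rabs_pos_eq (0 - t)) by lra.
    assert (Rabs (g' c) <= M) by (apply HM, Hb; lra). nra.
  - rewrite Rminus_diag, Rabs_R0. lra.
  - assert (Hb : forall s, 0 <= s <= t -> Rabs s <= Rabs t).
    { intros s Hs. rewrite !Rabs_pos_eq by lra. lra. }
    destruct (MVT_cor2 g g' 0 t Ht) as (c & Hc & Hc2); [intros; apply Hd, Hb; lra|].
    rewrite Hc, Rabs_mult, (Rabs_pos_eq t), (Rabs_pos_eq (t - 0)) by lra.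
    assert (Rabs (g' c) <= M) by (apply HM, Hb; lra). nra.
Qed.

Lemma derivable_pt_lim_poly a b c t :
  derivable_pt_lim (fun s => a + b * s + c * (s * s)) t (b + 2 * c * t).
Proof.
  replace (b + 2 * c * t) with (0 + b * 1 + c * (1 * t + t * 1)) by ring.
  apply (derivable_pt_lim_plus (fun s => a + b * s) (fun s => c * (s * s))).
  - apply (derivable_pt_lim_plus (fun _ => a) (fun s => b * s)).
    + apply derivable_pt_lim_const.
    + apply (derivable_pt_lim_scal (fun s => s)), derivable_pt_lim_id.
  - apply (derivable_pt_lim_scal (fun s => s * s)).
    apply (derivable_pt_lim_mult (fun s => s) (fun s => s)); apply derivable_pt_lim_id.
Qed.

(** The increment bound is applied to [f] minus its quadratic polynomial, whose derivative is o(s)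
    because [f'] is differentiable at the single point 0. *)
Lemma jet_taylor f f' c r : 0 < r ->
  (forall t, Rabs t < r -> derivable_pt_lim f t (f' t)) ->
  derivable_pt_lim f' 0 c -> jet f (f 0) (f' 0) (c / 2).
Proof.
  intros Hr Hf Hf'. apply jet_intro; [reflexivity|]. intros e He.
  destruct (Hf' e He) as (d & H). exists (Rmin d r).
  split; [apply Rmin_glb_lt; [apply cond_pos | exact Hr]|]. intros t Ht.
  set (g := fun s => f s - (f 0 + f' 0 * s + c / 2 * (s * s))).
  set (g' := fun s => f' s - (f' 0 + 2 * (c / 2) * s)).
  assert (Hinc : Rabs (g t - g 0) <= (e * Rabs t) * Rabs t).
  { apply (increment_le g g').
    - intros s Hs. apply (derivable_pt_lim_minus f).
      + apply Hf. eapply Rle_lt_trans; [exact Hs|]. eapply Rlt_le_trans; [exact Ht | apply Rmin_r].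
      + apply derivable_pt_lim_poly.
    - intros s Hs. assert (Hle : Rabs (g' s) <= e * Rabs s).
      { destruct (Req_dec s 0) as [->|Hs0].
        - unfold g'. rewrite Rabs_R0, Rmult_0_r, Rmult_0_r, Rplus_0_r, Rminus_diag, Rabs_R0. lra.
        - assert (Hsd : Rabs s < d).
          { eapply Rle_lt_trans; [exact Hs|]. eapply Rlt_le_trans; [exact Ht | apply Rmin_l]. }
          specialize (H s Hs0 Hsd). rewrite Rplus_0_l in H.
          replace (g' s) with (((f' s - f' 0) / s - c) * s) by (unfold g'; field; exact Hs0).
          rewrite Rabs_mult. apply Rmult_le_compat_r; [apply Rabs_pos | lra]. }
      assert (0 <= Rabs s) by apply Rabs_pos. nra. }
  replace (g t - g 0) with (f t - f 0 - f' 0 * t - c / 2 * (t * t)) in Hinc by (unfold g; ring).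
  rewrite Rmult_assoc, <- Rabs_mult, (Rabs_pos_eq (t * t)) in Hinc by nra. exact Hinc.
Qed.

(* L is the sum over the axes of the pure second derivatives of h at y, in the sense of jets. *)
Definition lapjet (n : nat) (h : (nat -> R) -> R) (y : nat -> R) (L : R) : Prop :=
  exists b c, (forall i, (i < n)%nat -> jet (fun t => h (shift y i t)) (h y) (b i) (c i)) /\
    L = 2 * rsum n c.

Lemma lapjet_const n a y : lapjet n (fun _ => a) y 0.
Proof.
  exists (fun _ => 0), (fun _ => 0). split; [intros; apply jet_const|].
  rewrite rsum_const. ring.
Qed.

Lemma lapjet_plus n f g y K L : lapjet n f y K -> lapjet n g y L ->
  lapjet n (fun x => f x + g x) y (K + L).
Proof.
  intros (b & c & H & ->) (b' & c' & H' & ->).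
  exists (fun i => b i + b' i), (fun i => c i + c' i). split.
  - intros i Hi. apply jet_plus; auto.
  - rewrite rsum_plus. ring.
Qed.

Lemma lapjet_scal n k f y L : lapjet n f y L -> lapjet n (fun x => k * f x) y (k * L).
Proof.
  intros (b & c & H & ->). exists (fun i => k * b i), (fun i => k * c i). split.
  - intros i Hi. apply jet_scal; auto.
  - rewrite rsum_scal. ring.
Qed.

(** Adding the expansions at [t] and [- t] cancels the first-order term, so each second-order
    coefficient is non-negative at a minimum along its axis. *)
Lemma lapjet_min_nonneg n h y L d : lapjet n h y L -> 0 < d ->
  (forall i t, (i < n)%nat -> Rabs t < d -> h y <= h (shift y i t)) -> 0 <= L.
Proof.
  intros (b & c & H & ->) Hd Hmin.
  assert (0 <= rsum n c); [|lra]. apply rsum_nonneg. intros i Hi.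
  destruct (H i Hi) as (g & Hg & <- & Hf). apply Rnot_lt_le. intros Hneg.
  destruct (Hg (- g 0)) as (d' & Hd' & Hc); [lra|].
  set (t := Rmin d d' / 2).
  assert (Ht : 0 < t < d /\ t < d').
  { assert (Hl := Rmin_l d d'). assert (Hr := Rmin_r d d').
    assert (0 < Rmin d d') by now apply Rmin_glb_lt. unfold t. lra. }
  assert (Hneg' : forall s, s <> 0 -> Rabs s = t -> g s < 0).
  { intros s Hs Hst. specialize (Hc s).
    assert (Rabs (g s - g 0) < - g 0).
    { apply Hc. split; [split; [exact I | auto]|]. cbn. unfold Rdist.
      rewrite Rminus_0_r, Hst. lra. }
    apply Rabs_def2 in H0. lra. }
  assert (H1 := Hneg' t ltac:(lra) ltac:(apply Rabs_pos_eq; lra)).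
  assert (H2 := Hneg' (- t) ltac:(lra) ltac:(rewrite Rabs_Ropp; apply Rabs_pos_eq; lra)).
  assert (M1 := Hmin i t Hi ltac:(rewrite Rabs_pos_eq; lra)).
  assert (M2 := Hmin i (- t) Hi ltac:(rewrite Rabs_Ropp, Rabs_pos_eq; lra)).
  rewrite Hf in M1, M2. assert (Htt : 0 < t * t) by (apply Rmult_lt_0_compat; lra).
  assert (t * t * (g t + g (- t)) < 0); [|lra].
  assert (0 < t * t * - (g t + g (- t))) by (apply Rmult_lt_0_compat; lra). lra.
Qed.

(** [K] is compact, its closedness being expressed by a positive distance from each outside point,
    so [h] attains its minimum. The last hypothesis treats interior and boundary at once: a point of
    negative value must be interior to [K] and carry a negative Laplacian, which is impossible at a
    minimum. *)
Lemma min_principle n (K : (nat -> R) -> Prop) M (h : (nat -> R) -> R) :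
  (forall y, K y -> pt n y /\ enorm n y <= M) ->
  (forall x, pt n x -> ~ K x -> exists d, 0 < d /\ forall y, K y -> d <= edist n y x) ->
  (forall x, K x -> cont_at n h x) ->
  (forall x, K x -> h x < 0 -> (exists L, L < 0 /\ lapjet n h x L) /\
     exists d, 0 < d /\ forall y, pt n y -> edist n y x < d -> K y) ->
  forall x, K x -> 0 <= h x.
Proof.
  intros Hb Hcl Hc Hint x Hx. apply Rnot_lt_le. intros Hneg.
  assert (Hmin : exists z, K z /\ forall y, K y -> h z <= h y).
  { assert (Hbd : exists m, forall y, K y -> m <= h y).
    { destruct (ball_cover n M (fun d y => K y -> - / d <= h y)) as (d & Hd & H).
      - intros d d' y Hd H Hy. specialize (H Hy).
        assert (/ d <= / d') by (apply Rinv_le_contravar; lra). lra.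
      - intros z Hz _. destruct (classic (K z)) as [Kz|Kz].
        + destruct (Hc z Kz 1) as (d & Hd & H); [lra|].
          set (A := Rabs (h z) + 1). assert (HA : 0 < A) by (assert (H1 := Rabs_pos (h z)); unfold A; lra).
          exists (Rmin d (/ A)). assert (Hm : 0 < Rmin d (/ A)).
          { apply Rmin_glb_lt; auto. now apply Rinv_0_lt_compat. }
          split; auto. intros y Hy _ Hyz Ky.
          assert (A <= / Rmin d (/ A)).
          { rewrite <- (Rinv_inv A) at 1. apply Rinv_le_contravar; auto. apply Rmin_r. }
          assert (Hh : Rabs (h y - h z) < 1) by (apply H; auto; eapply Rlt_le_trans; [exact Hyz | apply Rmin_l]).
          apply Rabs_def2 in Hh. assert (H1 := Rle_abs (- h z)). rewrite Rabs_Ropp in H1.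
          unfold A in *. lra.
        + destruct (Hcl z Hz Kz) as (d & Hd & H). exists d. split; auto.
          intros y _ _ Hyz Ky. specialize (H y Ky). lra.
      - exists (- / d). intros y Ky. destruct (Hb y Ky). auto. }
    destruct Hbd as [m Hm].
    destruct (completeness (fun s => exists y, K y /\ s = - h y)) as [s [Hub Hlub]].
    { exists (- m). intros s (y & Ky & ->). specialize (Hm y Ky). lra. }
    { exists (- h x). eauto. }
    (* If the infimum [- s] were not attained, compactness would lift [h] above [- s + d] on all of
       [K] for one [d > 0], against the choice of [s]. *)
    apply NNPP. intros Hno.
    destruct (ball_cover n M (fun d y => K y -> - s + d <= h y)) as (d & Hd & H).
    - intros d d' y Hd H Hy. specialize (H Hy). lra.
    - intros z Hz _. destruct (classic (K z)) as [Kz|Kz].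
      + assert (Hlt : - s < h z).
        { apply Rnot_le_lt. intros Hle. apply Hno. exists z. split; auto. intros y Ky.
          assert (- h y <= s) by (apply Hub; eauto). lra. }
        destruct (Hc z Kz ((h z + s) / 2)) as (d & Hd & H); [lra|].
        exists (Rmin d ((h z + s) / 2)). split; [apply Rmin_glb_lt; lra|].
        intros y Hy _ Hyz Ky.
        assert (Hh : Rabs (h y - h z) < (h z + s) / 2)
          by (apply H; auto; eapply Rlt_le_trans; [exact Hyz | apply Rmin_l]).
        apply Rabs_def2 in Hh. assert (Hr := Rmin_r d ((h z + s) / 2)). lra.
      + destruct (Hcl z Hz Kz) as (d & Hd & H). exists d. split; auto.
        intros y _ _ Hyz Ky. specialize (H y Ky). lra.
    - assert (s <= s - d); [|lra]. apply Hlub. intros t (y & Ky & ->).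
      destruct (Hb y Ky) as [Hy Hym]. specialize (H y Hy Hym Ky). lra. }
  destruct Hmin as (z & Kz & Hz).
  assert (Hz0 : h z < 0) by (specialize (Hz x Hx); lra).
  destruct (Hint z Kz Hz0) as [(L & HL & HLz) (d & Hd & Hnb)].
  assert (Hn := pos_INR n).
  assert (0 <= L); [|lra].
  apply (lapjet_min_nonneg n h z L (d / (INR n + 1)) HLz); [apply Rdiv_lt_0_compat; lra|].
  intros i t Hi Ht. apply Hz, Hnb.
  - apply pt_shift; auto. now apply Hb.
  - eapply Rle_lt_trans; [now apply edist_shift|].
    replace d with ((INR n + 1) * (d / (INR n + 1))) by (field; lra).
    assert (0 < d / (INR n + 1)) by (apply Rdiv_lt_0_compat; lra).
    assert (0 <= Rabs t) by apply Rabs_pos. nra.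
Qed.

(** * Second-order Taylor expansion along curves *)

Lemma finite_delta n (P : nat -> R -> Prop) :
  (forall i d d', 0 < d' <= d -> P i d -> P i d') ->
  (forall i, (i < n)%nat -> exists d, 0 < d /\ P i d) ->
  exists d, 0 < d /\ forall i, (i < n)%nat -> P i d.
Proof.
  intros Ha. induction n as [|n IH]; intros H.
  - exists 1. split; [lra | lia].
  - destruct IH as (d & Hd & H1); [intros; apply H; lia|].
    destruct (H n ltac:(lia)) as (d' & Hd' & H2).
    assert (0 < Rmin d d') by now apply Rmin_glb_lt.
    exists (Rmin d d'). split; auto. intros i Hi. destruct (Nat.eq_dec i n) as [->|Hne].
    + apply (Ha n d'); auto. split; auto. apply Rmin_r.
    + apply (Ha i d); [split; auto; apply Rmin_l|]. apply H1. lia.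
Qed.

(** The corners of the staircase from x to x + h that changes one coordinate at a time. *)
Definition tr (x h : nat -> R) (m : nat) : nat -> R :=
  fun j => if Nat.ltb j m then x j + h j else x j.

Lemma tr_0 x h : tr x h 0 = x.
Proof. reflexivity. Qed.

Lemma tr_S x h m : tr x h (S m) = shift (tr x h m) m (h m).
Proof.
  extensionality j. unfold tr, shift.
  destruct (Nat.eqb_spec j m), (Nat.ltb_spec j (S m)), (Nat.ltb_spec j m); try lia; subst; auto.
Qed.

Lemma shift_tr x h m s : shift (tr x h m) m s = tr x (set_coord h m s) (S m).
Proof.
  extensionality j. unfold tr, shift, set_coord.
  destruct (Nat.eqb_spec j m), (Nat.ltb_spec j (S m)), (Nat.ltb_spec j m); try lia; subst; auto.
Qed.

Lemma tr_near n x h m d : pt n x -> (m <= n)%nat -> 0 < d ->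
  (forall i, (i < n)%nat -> Rabs (h i) < d / (INR n + 1)) ->
  pt n (tr x h m) /\ edist n (tr x h m) x < d.
Proof.
  intros Hx Hm Hd Hh. split.
  - intros j Hj. unfold tr. destruct (Nat.ltb_spec j m); [lia | auto].
  - assert (Hn := pos_INR n).
    assert (Hq : 0 < d / (INR n + 1)) by (apply Rdiv_lt_0_compat; lra).
    apply Rle_lt_trans with (INR n * (d / (INR n + 1))).
    + apply enorm_le_sup; [lra|]. intros i Hi. unfold vsub, tr.
      destruct (Nat.ltb_spec i m).
      * replace (x i + h i - x i) with (h i) by ring. apply Rlt_le, Hh, Hi.
      * rewrite Rminus_diag, Rabs_R0. lra.
    + replace d with ((INR n + 1) * (d / (INR n + 1))) at 2 by (field; lra). nra.
Qed.

Lemma shift_shift x i s t : shift (shift x i s) i t = shift x i (s + t).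
Proof. extensionality j. unfold shift. destruct (Nat.eqb j i); auto. ring. Qed.

Lemma shift_0 x i : shift x i 0 = x.
Proof. extensionality j. unfold shift. destruct (Nat.eqb j i); auto. ring. Qed.

Lemma derivable_shift (f : (nat -> R) -> R) x i s l :
  derivable_pt_lim (fun t => f (shift (shift x i s) i t)) 0 l ->
  derivable_pt_lim (fun t => f (shift x i t)) s l.
Proof.
  intros H e He. destruct (H e He) as (d & Hd). exists d. intros h Hh Hhd.
  specialize (Hd h Hh Hhd). rewrite !shift_shift in Hd.
  now rewrite Rplus_0_l, Rplus_0_r in Hd.
Qed.

Definition partials_near (n : nat) (f : (nat -> R) -> R) (d : nat -> (nat -> R) -> R)
  (x : nat -> R) (rho : R) : Prop :=
  forall y i, pt n y -> (i < n)%nat -> edist n y x < rho ->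
    derivable_pt_lim (fun t => f (shift y i t)) 0 (d i y).

Lemma set_coord_small n (h : nat -> R) m s d : (m < n)%nat ->
  (forall i, (i < n)%nat -> Rabs (h i) < d) -> Rabs s <= Rabs (h m) ->
  forall i, (i < n)%nat -> Rabs (set_coord h m s i) < d.
Proof.
  intros Hm Hh Hs i Hi. unfold set_coord. destruct (Nat.eqb_spec i m); auto.
  eapply Rle_lt_trans; eauto.
Qed.

(** The increment telescopes along the staircase, and each stair is a one-variable increment whose
    derivative is close to its value at [x]. The bound is kept at every corner [m] because [taylor2]
    uses the intermediate ones. *)
Lemma taylor1 n f d x rho : pt n x -> 0 < rho -> partials_near n f d x rho ->
  (forall i, (i < n)%nat -> cont_at n (d i) x) ->
  forall eps, 0 < eps -> exists dl, 0 < dl /\ forall h, (forall i, (i < n)%nat -> Rabs (h i) < dl) ->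
    forall m, (m <= n)%nat ->
    Rabs (f (tr x h m) - f x - rsum m (fun j => d j x * h j)) <= eps * rsum m (fun j => Rabs (h j)).
Proof.
  intros Hx Hr Hf Hd e He.
  destruct (finite_delta n (fun i r => forall y, pt n y -> edist n y x < r -> Rabs (d i y - d i x) < e))
    as (r & Hr0 & Hrr).
  { intros i a b Hab H y Hy Hyx. apply H; auto. lra. }
  { intros i Hi. apply (Hd i Hi e He). }
  set (q := Rmin r rho). assert (Hq : 0 < q) by now apply Rmin_glb_lt.
  assert (Hn := pos_INR n).
  exists (q / (INR n + 1)). split; [apply Rdiv_lt_0_compat; lra|]. intros h Hh m.
  induction m as [|m IH]; intros Hm.
  { simpl. rewrite tr_0, Rminus_diag, Rminus_0_r, Rabs_R0. lra. }
  specialize (IH ltac:(lia)). simpl rsum.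
  set (g := fun s => f (shift (tr x h m) m s) - (0 + d m x * s + 0 * (s * s))).
  assert (Hnear : forall s, Rabs s <= Rabs (h m) ->
     pt n (shift (tr x h m) m s) /\ edist n (shift (tr x h m) m s) x < q).
  { intros s Hs. rewrite shift_tr. apply tr_near; auto.
    now apply set_coord_small. }
  assert (Hinc : Rabs (g (h m) - g 0) <= e * Rabs (h m)).
  { apply (increment_le g (fun s => d m (shift (tr x h m) m s) - (d m x + 2 * 0 * s))).
    - intros s Hs. destruct (Hnear s Hs) as [Hp Hdd].
      apply (derivable_pt_lim_minus (fun s => f (shift (tr x h m) m s))); [|apply derivable_pt_lim_poly].
      apply derivable_shift, Hf; auto. eapply Rlt_le_trans; [exact Hdd | apply Rmin_r].
    - intros s Hs. destruct (Hnear s Hs) as [Hp Hdd]. rewrite Rmult_0_r, Rmult_0_l, Rplus_0_r.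
      apply Rlt_le, Hrr; auto. eapply Rlt_le_trans; [exact Hdd | apply Rmin_l]. }
  unfold g in Hinc. rewrite shift_0, <- tr_S in Hinc.
  replace (f (tr x h (S m)) - f x - (rsum m (fun j => d j x * h j) + d m x * h m)) with
    ((f (tr x h m) - f x - rsum m (fun j => d j x * h j)) +
     (f (tr x h (S m)) - (0 + d m x * h m + 0 * (h m * h m)) -
        (f (tr x h m) - (0 + d m x * 0 + 0 * (0 * 0))))) by ring.
  eapply Rle_trans; [apply Rabs_triang|]. lra.
Qed.

(* Only the part j < k of the mixed derivatives enters, so no symmetry of the Hessian is needed. *)
Definition hessian_form (m : nat) (D : nat -> nat -> R) (h : nat -> R) : R :=
  rsum m (fun k => / 2 * D k k * (h k * h k) + rsum k (fun j => D j k * h j) * h k).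

(** Along stair [m] the derivative is [D1 m], which [taylor1] expands in the coordinates moved so
    far. These give the terms [j < m] of [hessian_form], and the stair itself gives the diagonal
    one. *)
Lemma taylor2 n u D1 D2 x rho : pt n x -> 0 < rho -> partials_near n u D1 x rho ->
  (forall j, (j < n)%nat -> partials_near n (D1 j) (fun i => D2 i j) x rho) ->
  (forall i j, (i < n)%nat -> (j < n)%nat -> cont_at n (D2 i j) x) ->
  forall eps, 0 < eps -> exists dl, 0 < dl /\ forall h, (forall i, (i < n)%nat -> Rabs (h i) < dl) ->
    forall m, (m <= n)%nat ->
    Rabs (u (tr x h m) - u x - (rsum m (fun k => D1 k x * h k) +
            hessian_form m (fun i j => D2 i j x) h))
      <= eps * (rsum m (fun j => Rabs (h j)) * rsum m (fun j => Rabs (h j))).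
Proof.
  intros Hx Hr Hu HD Hc e He.
  destruct (finite_delta n (fun m dl => forall h, (forall i, (i < n)%nat -> Rabs (h i) < dl) ->
    forall k, (k <= n)%nat -> Rabs (D1 m (tr x h k) - D1 m x - rsum k (fun j => D2 j m x * h j))
      <= e * rsum k (fun j => Rabs (h j)))) as (dl & Hdl & Ht).
  { intros i a b Hab H h Hh k Hk. apply H; auto. intros j Hj. specialize (Hh j Hj). lra. }
  { intros m Hm. apply (taylor1 n (D1 m) (fun i => D2 i m) x rho); auto. }
  assert (Hn := pos_INR n).
  set (q := Rmin dl (rho / (INR n + 1))).
  assert (Hq : 0 < q) by (apply Rmin_glb_lt; auto; apply Rdiv_lt_0_compat; lra).
  exists q. split; auto. intros h Hh m.
  induction m as [|m IH]; intros Hm.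
  { unfold hessian_form. simpl. rewrite tr_0. rewrite Rplus_0_r, Rminus_diag, Rminus_0_r, Rabs_R0. lra. }
  specialize (IH ltac:(lia)). unfold hessian_form in *. simpl rsum.
  set (N := rsum m (fun j => Rabs (h j))) in *.
  assert (HN : 0 <= N) by (apply rsum_nonneg; intros; apply Rabs_pos).
  set (H1 := rsum m (fun j => D2 j m x * h j)).
  set (b := D1 m x + H1). set (c := / 2 * D2 m m x).
  set (g := fun s => u (shift (tr x h m) m s) - (0 + b * s + c * (s * s))).
  assert (Hinc : Rabs (g (h m) - g 0) <= e * (N + Rabs (h m)) * Rabs (h m)).
  { apply (increment_le g (fun s => D1 m (shift (tr x h m) m s) - (b + 2 * c * s))).
    - intros s Hs.
      apply (derivable_pt_lim_minus (fun s => u (shift (tr x h m) m s))); [|apply derivable_pt_lim_poly].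
      apply derivable_shift. rewrite shift_tr.
      destruct (tr_near n x (set_coord h m s) (S m) rho) as [Hp Hpr]; auto.
      apply set_coord_small; auto. intros i Hi.
      eapply Rlt_le_trans; [apply Hh, Hi | apply Rmin_r].
    - intros s Hs. assert (Hsm : forall i, (i < n)%nat -> Rabs (set_coord h m s i) < dl).
      { apply set_coord_small; auto. intros i Hi.
        eapply Rlt_le_trans; [apply Hh, Hi | apply Rmin_l]. }
      assert (Hb := Ht m Hm _ Hsm (S m) Hm). rewrite <- shift_tr in Hb. simpl rsum in Hb.
      rewrite (rsum_ext m (fun j => D2 j m x * set_coord h m s j) (fun j => D2 j m x * h j)) in Hb
        by (intros i Hi; unfold set_coord; destruct (Nat.eqb_spec i m); [lia | reflexivity]).
      rewrite (rsum_ext m (fun j => Rabs (set_coord h m s j)) (fun j => Rabs (h j))) in Hb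
        by (intros i Hi; unfold set_coord; destruct (Nat.eqb_spec i m); [lia | reflexivity]).
      assert (E : set_coord h m s m = s) by (unfold set_coord; now rewrite Nat.eqb_refl).
      rewrite E in Hb. fold H1 N in Hb.
      replace (D1 m (shift (tr x h m) m s) - (b + 2 * c * s)) with
        (D1 m (shift (tr x h m) m s) - D1 m x - (H1 + D2 m m x * s)) by (unfold b, c; field).
      eapply Rle_trans; [exact Hb|]. apply Rmult_le_compat_l; lra. }
  unfold g in Hinc. rewrite shift_0, <- tr_S in Hinc.
  match type of IH with Rabs ?A <= _ => set (Z := A) in * end.
  match type of Hinc with Rabs ?A <= _ => set (Y := A) in * end.
  match goal with |- Rabs ?A <= _ => replace A with (Z + Y) by (unfold Z, Y, b, c, H1; ring) end.
  eapply Rle_trans; [apply Rabs_triang|].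
  assert (0 <= Rabs (h m)) by apply Rabs_pos.
  assert (0 <= e * (N * Rabs (h m))) by (apply Rmult_le_pos; [lra | nra]). nra.
Qed.

Lemma jet_elim f a b c : jet f a b c -> f 0 = a /\
  forall eps, 0 < eps -> exists d, 0 < d /\ forall t, Rabs t < d ->
     Rabs (f t - a - b * t - c * (t * t)) <= eps * (t * t).
Proof.
  intros H. split; [eapply jet_0; eauto|]. destruct H as (g & Hg & <- & Hf). intros e He.
  destruct (Hg e He) as (d & Hd & H). exists d. split; auto. intros t Ht.
  replace (f t - a - b * t - g 0 * (t * t)) with ((g t - g 0) * (t * t)) by (rewrite Hf; ring).
  rewrite Rabs_mult, (Rabs_pos_eq (t * t)) by nra. apply Rmult_le_compat_r; [nra|].
  destruct (Req_dec t 0) as [->|Hne]; [rewrite Rminus_diag, Rabs_R0; lra|].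
  apply Rlt_le, H. split; [split; [exact I | auto]|]. cbn. unfold Rdist. now rewrite Rminus_0_r.
Qed.

Lemma jet_ext_near f f' a b c r : 0 < r -> (forall t, Rabs t < r -> f t = f' t) ->
  jet f a b c -> jet f' a b c.
Proof.
  intros Hr He H. destruct (jet_elim _ _ _ _ H) as [H0 H1]. apply jet_intro.
  - rewrite <- He; auto. rewrite Rabs_R0. exact Hr.
  - intros e Hep. destruct (H1 e Hep) as (d & Hd & Hdd). exists (Rmin d r).
    split; [now apply Rmin_glb_lt|]. intros t Ht. rewrite <- He.
    + apply Hdd. eapply Rlt_le_trans; [exact Ht | apply Rmin_l].
    + eapply Rlt_le_trans; [exact Ht | apply Rmin_r].
Qed.

Lemma jet_linear_bound f A B : jet f 0 A B ->
  exists d, 0 < d /\ forall t, Rabs t < d -> Rabs (f t) <= (Rabs A + 1) * Rabs t.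
Proof.
  intros (g & Hg & Eg & Hf).
  assert (Hc : continuity_pt (fun t => t * g t) 0) by ctac.
  destruct (Hc 1) as (d & Hd & H); [lra|]. exists d. split; auto. intros t Ht.
  assert (Hb : Rabs (t * g t) <= 1).
  { destruct (Req_dec t 0) as [->|Hne]; [rewrite Rmult_0_l, Rabs_R0; lra|].
    specialize (H t). cbn in H. unfold Rdist in H. rewrite Rmult_0_l, !Rminus_0_r in H.
    apply Rlt_le, H. split; auto. split; [exact I | auto]. }
  replace (f t) with ((A + t * g t) * t) by (rewrite Hf; ring).
  rewrite Rabs_mult. apply Rmult_le_compat_r; [apply Rabs_pos|].
  eapply Rle_trans; [apply Rabs_triang|]. lra.
Qed.

(** Second-order chain rule: the Taylor polynomial [p] of [u] composed with the jets of the curve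
    has the stated coefficients, and the remainder is o(|h|^2), hence o(t^2), since the curve starts
    at 0. *)
Lemma jet_curve n u D1 D2 x rho h A B : pt n x -> 0 < rho -> partials_near n u D1 x rho ->
  (forall j, (j < n)%nat -> partials_near n (D1 j) (fun i => D2 i j) x rho) ->
  (forall i j, (i < n)%nat -> (j < n)%nat -> cont_at n (D2 i j) x) ->
  (forall j, (j < n)%nat -> jet (h j) 0 (A j) (B j)) ->
  jet (fun t => u (tr x (fun j => h j t) n)) (u x) (rsum n (fun k => D1 k x * A k))
    (rsum n (fun k => D1 k x * B k) + hessian_form n (fun i j => D2 i j x) A).
Proof.
  intros Hx Hr Hu HD Hc Hh.
  set (p := fun t => u x + (rsum n (fun k => D1 k x * h k t) +
              hessian_form n (fun i j => D2 i j x) (fun j => h j t))).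
  assert (Hp : jet p (u x) (rsum n (fun k => D1 k x * A k))
    (rsum n (fun k => D1 k x * B k) + hessian_form n (fun i j => D2 i j x) A)).
  { eapply jet_eq.
    - apply jet_plus; [apply jet_const|]. apply jet_plus.
      + apply (jet_rsum n (fun k t => D1 k x * h k t) (fun k => D1 k x * 0)
          (fun k => D1 k x * A k) (fun k => D1 k x * B k)).
        intros k Hk. apply jet_scal, Hh, Hk.
      + apply (jet_rsum n (fun k t => / 2 * D2 k k x * (h k t * h k t) +
            rsum k (fun j => D2 j k x * h j t) * h k t) (fun _ => 0) (fun _ => 0)
            (fun k => / 2 * D2 k k x * (A k * A k) + rsum k (fun j => D2 j k x * A j) * A k)).
        intros k Hk. eapply jet_eq; [apply jet_plus| | |].
        * apply jet_scal, (jet_mult _ _ _ _ _ _ _ _ (Hh k Hk) (Hh k Hk)).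
        * apply (jet_mult (fun t => rsum k (fun j => D2 j k x * h j t)) (h k)
             (rsum k (fun j => D2 j k x * 0)) (rsum k (fun j => D2 j k x * A j))
             (rsum k (fun j => D2 j k x * B j)) 0 (A k) (B k)); [|exact (Hh k Hk)].
          apply (jet_rsum k (fun j t => D2 j k x * h j t) (fun j => D2 j k x * 0)
             (fun j => D2 j k x * A j) (fun j => D2 j k x * B j)).
          intros j Hj. apply jet_scal, Hh. lia.
        * ring.
        * rewrite (rsum_zero k (fun j => D2 j k x * 0)) by (intros; ring). ring.
        * rewrite (rsum_zero k (fun j => D2 j k x * 0)) by (intros; ring). ring.
    - rewrite (rsum_zero n (fun k => D1 k x * 0)), (rsum_zero n (fun _ => 0)) by (intros; ring). ring.
    - rewrite (rsum_zero n (fun _ => 0)) by (intros; ring). ring.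
    - unfold hessian_form. ring. }
  assert (Hrem : jet (fun t => u (tr x (fun j => h j t) n) - p t) 0 0 0).
  (* With [C] below, the sum of the |h j t| is at most C |t| near 0, so the Taylor error acquires a
     factor C^2. The accuracy requested from [taylor2] is therefore divided by [C * C + 1]. *)
  { assert (H0 : forall j, (j < n)%nat -> h j 0 = 0) by (intros j Hj; eapply jet_0, Hh, Hj).
    set (C := rsum n (fun j => Rabs (A j) + 1)).
    assert (HC : 0 <= C) by (apply rsum_nonneg; intros; assert (Q := Rabs_pos (A i)); lra).
    assert (Hbnd : exists d, 0 < d /\ forall j, (j < n)%nat -> forall t, Rabs t < d ->
       Rabs (h j t) <= (Rabs (A j) + 1) * Rabs t).
    { apply (finite_delta n (fun j d => forall t, Rabs t < d -> Rabs (h j t) <= (Rabs (A j) + 1) * Rabs t)).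
      - intros j a b Hab H t Ht. apply H. lra.
      - intros j Hj. eapply jet_linear_bound, Hh, Hj. }
    destruct Hbnd as (d & Hd & Hbnd).
    assert (Hsmall : forall e, 0 < e -> exists dl, 0 < dl /\ forall t, Rabs t < dl ->
       Rabs (u (tr x (fun j => h j t) n) - p t) <= e * (t * t)).
    { intros e He.
      assert (HC2 : 0 < C * C + 1) by nra.
      destruct (taylor2 n u D1 D2 x rho Hx Hr Hu HD Hc (e / (C * C + 1))) as (dl & Hdl & HT);
        [now apply Rdiv_lt_0_compat|].
      set (q := Rmin d (dl / (C + 1))).
      assert (Hq : 0 < q) by (apply Rmin_glb_lt; auto; apply Rdiv_lt_0_compat; lra).
      exists q. split; auto. intros t Ht.
      assert (Ht1 : Rabs t < d) by (eapply Rlt_le_trans; [exact Ht | apply Rmin_l]).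
      assert (Ht2 : Rabs t < dl / (C + 1)) by (eapply Rlt_le_trans; [exact Ht | apply Rmin_r]).
      assert (Hta := Rabs_pos t).
      assert (Hsum : rsum n (fun j => Rabs (h j t)) <= C * Rabs t).
      { unfold C. rewrite Rmult_comm, <- rsum_scal. apply rsum_le. intros j Hj.
        rewrite Rmult_comm. apply Hbnd; auto. }
      assert (Hsum0 : 0 <= rsum n (fun j => Rabs (h j t))) by (apply rsum_nonneg; intros; apply Rabs_pos).
      assert (HCt : C * Rabs t < dl).
      { apply Rmult_lt_compat_r with (r := C + 1) in Ht2; [|lra].
        unfold Rdiv in Ht2. rewrite Rmult_assoc, Rinv_l in Ht2 by lra. nra. }
      assert (Hh1 : forall i, (i < n)%nat -> Rabs (h i t) < dl).
      { intros i Hi. eapply Rle_lt_trans; [|exact HCt]. eapply Rle_trans; [|exact Hsum].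
        apply (rsum_term_le n (fun j => Rabs (h j t))); auto. intros; apply Rabs_pos. }
      specialize (HT (fun j => h j t) Hh1 n (le_n n)). cbv beta in HT.
      replace (u (tr x (fun j => h j t) n) - p t) with
        (u (tr x (fun j => h j t) n) - u x - (rsum n (fun k => D1 k x * h k t) +
              hessian_form n (fun i j => D2 i j x) (fun j => h j t))) by (unfold p; ring).
      eapply Rle_trans; [exact HT|].
      set (s := rsum n (fun j => Rabs (h j t))) in *.
      assert (Hss : s * s <= C * C * (t * t)).
      { replace (t * t) with (Rabs t * Rabs t) by (rewrite <- Rabs_mult; apply Rabs_pos_eq; nra). nra. }
      assert (He' : 0 < e / (C * C + 1)) by now apply Rdiv_lt_0_compat.
      replace e with (e / (C * C + 1) * (C * C + 1)) at 2 by (field; lra).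
      rewrite Rmult_assoc. apply Rmult_le_compat_l; [lra|]. nra. }
    apply jet_intro.
    - destruct (Hsmall 1) as (dl & Hdl & H); [lra|]. specialize (H 0).
      rewrite Rabs_R0 in H. specialize (H Hdl). rewrite Rmult_0_r, Rmult_0_r in H.
      revert H. unfold Rabs. destruct Rcase_abs; lra.
    - intros e He. destruct (Hsmall e He) as (dl & Hdl & H). exists dl. split; auto.
      intros t Ht. rewrite !Rmult_0_l, !Rminus_0_r. auto. }
  eapply jet_ext; [|eapply jet_eq; [apply (jet_plus _ _ _ _ _ _ _ _ Hp Hrem)| | |]].
  - intros t. simpl. ring.
  - ring.
  - ring.
  - ring.
Qed.

(** * The Laplacian of the Kelvin transform *)

(* E k (|x|^2) = |x|^(-k), the fundamental solution in dimension n = k + 2. *)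
Definition E (k : nat) (s : R) : R := (/ sqrt s) ^ k.

Lemma E_Rpower k s : 0 < s -> E k s = Rpower s (- (INR k / 2)).
Proof.
  intros Hs. unfold E. rewrite <- Rpower_sqrt, <- Rpower_Ropp by exact Hs.
  rewrite <- Rpower_pow by apply exp_pos. rewrite Rpower_mult. f_equal. lra.
Qed.

Lemma Rpower_pred s p : 0 < s -> Rpower s (p - 1) = Rpower s p / s.
Proof.
  intros Hs. unfold Rminus. rewrite Rpower_plus, Rpower_Ropp, Rpower_1 by exact Hs. reflexivity.
Qed.

Lemma derivable_Rpower_translate s p t : 0 < s + t ->
  derivable_pt_lim (fun t => Rpower (s + t) p) t (p * Rpower (s + t) (p - 1)).
Proof.
  intros H. replace (p * Rpower (s + t) (p - 1)) with (p * Rpower (s + t) (p - 1) * (0 + 1)) by ring.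
  apply (derivable_pt_lim_comp (fun t => s + t) (fun x => Rpower x p)).
  - apply (derivable_pt_lim_plus (fun _ => s) (fun t => t));
      [apply derivable_pt_lim_const | apply derivable_pt_lim_id].
  - now apply derivable_pt_lim_power.
Qed.

Lemma jet_Rpower s p : 0 < s -> jet (fun t => Rpower (s + t) p) (Rpower s p)
  (p * Rpower s p / s) (p * (p - 1) / 2 * Rpower s p / (s * s)).
Proof.
  intros Hs.
  eapply jet_eq; [apply (jet_taylor (fun t => Rpower (s + t) p)
    (fun t => p * Rpower (s + t) (p - 1)) (p * ((p - 1) * Rpower (s + 0) (p - 1 - 1))) s Hs)| | |].
  - intros t Ht. apply Rabs_def2 in Ht. apply derivable_Rpower_translate. lra.
  - apply (derivable_pt_lim_scal (fun t => Rpower (s + t) (p - 1))).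
    apply derivable_Rpower_translate. lra.
  - now rewrite Rplus_0_r.
  - rewrite Rplus_0_r, Rpower_pred by exact Hs. field. lra.
  - rewrite Rplus_0_r, !Rpower_pred by exact Hs. field. lra.
Qed.

Lemma jet_E k s : 0 < s -> jet (fun t => E k (s + t)) (E k s)
  (- (INR k / 2) * E k s / s) (INR k * (INR k + 2) / 8 * E k s / (s * s)).
Proof.
  intros Hs. apply (jet_ext_near (fun t => Rpower (s + t) (- (INR k / 2))) _ _ _ _ s Hs).
  { intros t Ht. apply Rabs_def2 in Ht. symmetry. apply E_Rpower. lra. }
  eapply jet_eq; [now apply jet_Rpower| | |]; rewrite E_Rpower by exact Hs; auto.
  field. lra.
Qed.

Lemma E_2 s : 0 < s -> E 2 s = / s.
Proof.
  intros Hs. unfold E. rewrite pow_inv. f_equal. simpl. rewrite Rmult_1_r.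
  apply sqrt_sqrt. lra.
Qed.

Lemma jet_inv s : 0 < s -> jet (fun t => / (s + t)) (/ s) (- / (s * s)) (/ (s * s * s)).
Proof.
  intros Hs. apply (jet_ext_near (fun t => E 2 (s + t)) _ _ _ _ s Hs).
  { intros t Ht. apply Rabs_def2 in Ht. apply E_2. lra. }
  eapply jet_eq; [now apply jet_E| | |]; rewrite E_2 by exact Hs; simpl; try field; lra.
Qed.

Lemma kron_sym i j : kron i j = kron j i.
Proof. unfold kron. rewrite Nat.eqb_sym. reflexivity. Qed.

Lemma kron_sq i j : kron i j * kron i j = kron i j.
Proof. unfold kron. destruct Nat.eqb; ring. Qed.

Lemma shift_kron y i t j : shift y i t j = y j + kron j i * t.
Proof. unfold shift, kron. destruct (Nat.eqb j i); ring. Qed.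

Lemma sqsum_vsub_shift n y a i t : (i < n)%nat ->
  sqsum n (vsub (shift y i t) a) = sqsum n (vsub y a) + 2 * (y i - a i) * t + 1 * (t * t).
Proof.
  intros Hi. rewrite !sqsum_dot. unfold dot.
  rewrite (rsum_ext n _ (fun j => vsub y a j * vsub y a j +
     kron j i * (2 * (y j - a j) * t + 1 * (t * t)))).
  - rewrite rsum_plus, (rsum_kron n i (fun j => 2 * (y j - a j) * t + 1 * (t * t)) Hi). ring.
  - intros j _. unfold vsub. rewrite shift_kron. assert (H := kron_sq j i).
    replace ((y j + kron j i * t - a j) * (y j + kron j i * t - a j)) with
      ((y j - a j) * (y j - a j) + 2 * (y j - a j) * t * kron j i + kron j i * kron j i * (t * t)) by ring.
    rewrite H. ring.
Qed.

Lemma jet_sqsum n y a i : (i < n)%nat ->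
  jet (fun t => sqsum n (vsub (shift y i t) a)) (sqsum n (vsub y a)) (2 * (y i - a i)) 1.
Proof.
  intros Hi. eapply jet_ext; [|apply jet_poly]. intros t. symmetry. now apply sqsum_vsub_shift.
Qed.

Lemma jet_E_sqsum n k y a i : (i < n)%nat -> 0 < sqsum n (vsub y a) ->
  let s := sqsum n (vsub y a) in let z := y i - a i in
  jet (fun t => E k (sqsum n (vsub (shift y i t) a))) (E k s) (- INR k * E k s * z / s)
    (- (INR k / 2) * E k s / s + INR k * (INR k + 2) / 2 * E k s * (z * z) / (s * s)).
Proof.
  intros Hi Hs s z.
  eapply jet_eq; [apply (jet_comp (E k) _ _ _ _ _ _ _ (jet_E k s Hs) (jet_sqsum n y a i Hi))| | |];
    fold s z; [reflexivity| |]; field; apply Rgt_not_eq, Hs.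
Qed.

Lemma sqsum_rsum n y a : rsum n (fun i => (y i - a i) * (y i - a i)) = sqsum n (vsub y a).
Proof. rewrite sqsum_dot. reflexivity. Qed.

(** Summing the second-order coefficients over the axes gives [E k s] times (k / 2) (k + 2 - n) / s,
    which vanishes in dimension n = k + 2. *)
Lemma lapjet_E n k y a : INR n = INR k + 2 -> 0 < sqsum n (vsub y a) ->
  lapjet n (fun y => E k (sqsum n (vsub y a))) y 0.
Proof.
  intros Hnk Hs. set (s := sqsum n (vsub y a)).
  exists (fun i => - INR k * E k s * (y i - a i) / s),
    (fun i => - (INR k / 2) * E k s / s +
       INR k * (INR k + 2) / 2 * E k s * ((y i - a i) * (y i - a i)) / (s * s)).
  split; [intros i Hi; now apply jet_E_sqsum|].
  rewrite (rsum_ext n _ (fun i => - (INR k / 2) * E k s / s +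
     INR k * (INR k + 2) / 2 * E k s / (s * s) * ((y i - a i) * (y i - a i))))
    by (intros i Hi; field; apply Rgt_not_eq, Hs).
  rewrite rsum_plus, rsum_const, rsum_scal, sqsum_rsum. fold s. rewrite Hnk.
  field. apply Rgt_not_eq, Hs.
Qed.

(* Inversion in the sphere of centre c and radius l; kel is the corresponding Kelvin transform. *)
Definition kpt (n : nat) (c : nat -> R) (l : R) (y : nat -> R) : nat -> R :=
  fun j => c j + l * l * / sqsum n (vsub y c) * (y j - c j).

Definition kel (n k : nat) (c : nat -> R) (l : R) (u : (nat -> R) -> R) (y : nat -> R) : R :=
  l ^ k * E k (sqsum n (vsub y c)) * u (kpt n c l y).

Lemma pt_kpt n c l y : pt n c -> pt n y -> pt n (kpt n c l y).
Proof. intros Hc Hy j Hj. unfold kpt. rewrite Hc, Hy by auto. ring. Qed.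

(** The regularity part of [C2_with_laplacian], with the derivatives as parameters so that they can
    be named. *)
Definition C2data (n : nat) (u : (nat -> R) -> R) (D1 : nat -> (nat -> R) -> R)
  (D2 : nat -> nat -> (nat -> R) -> R) : Prop :=
  (forall x i, punct n x -> (i < n)%nat ->
      derivable_pt_lim (fun t => u (shift x i t)) 0 (D1 i x)) /\
  (forall x i j, punct n x -> (i < n)%nat -> (j < n)%nat ->
      derivable_pt_lim (fun t => D1 j (shift x i t)) 0 (D2 i j x)) /\
  cont_punct n u /\
  (forall i, (i < n)%nat -> cont_punct n (D1 i)) /\
  (forall i j, (i < n)%nat -> (j < n)%nat -> cont_punct n (D2 i j)).

Lemma C2data_jet_curve n u D1 D2 x h A B : C2data n u D1 D2 -> punct n x ->
  (forall j, (j < n)%nat -> jet (h j) 0 (A j) (B j)) ->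
  jet (fun t => u (tr x (fun j => h j t) n)) (u x) (rsum n (fun k => D1 k x * A k))
    (rsum n (fun k => D1 k x * B k) + hessian_form n (fun i j => D2 i j x) A).
Proof.
  intros (H1 & H2 & _ & _ & Hc) Hx Hh. destruct (punct_nbhd n x Hx) as (d & Hd & Hp).
  apply (jet_curve n u D1 D2 x d); auto.
  - apply Hx.
  - intros y i Hy Hi Hyx. apply H1; auto.
  - intros j Hj y i Hy Hi Hyx. apply H2; auto.
  - intros i j Hi Hj. apply cont_punct_at; auto.
Qed.

Lemma lapjet_C2 n u D1 D2 x : C2data n u D1 D2 -> punct n x ->
  lapjet n u x (rsum n (fun i => D2 i i x)).
Proof.
  intros (H1 & H2 & _ & _ & Hc) Hx. destruct (punct_nbhd n x Hx) as (d & Hd & Hp).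
  exists (fun i => D1 i x), (fun i => D2 i i x / 2). split.
  - intros i Hi. assert (Hn := pos_INR n).
    eapply jet_eq; [apply (jet_taylor (fun t => u (shift x i t)) (fun t => D1 i (shift x i t))
       (D2 i i x) (d / (INR n + 1)))| | |].
    + apply Rdiv_lt_0_compat; lra.
    + intros t Ht. apply derivable_shift, H1; auto. apply Hp; [apply pt_shift; auto; apply Hx|].
      eapply Rle_lt_trans; [now apply edist_shift|].
      replace d with ((INR n + 1) * (d / (INR n + 1))) by (field; lra).
      assert (0 < d / (INR n + 1)) by (apply Rdiv_lt_0_compat; lra).
      assert (0 <= Rabs t) by apply Rabs_pos. nra.
    + now apply H2.
    + now rewrite shift_0.
    + now rewrite shift_0.
    + reflexivity.
  - rewrite (rsum_ext n (fun i => D2 i i x / 2) (fun i => / 2 * D2 i i x)) by (intros; field).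
    rewrite rsum_scal. field.
Qed.

(** Conformality of the inversion: its Jacobian is l / s times the reflection I - 2 z z^T / s. Here
    [l] stands for the squared radius, so the lemma is applied with [l * l]. *)
Lemma inversion_jacobian_orthogonal n l s z j k : (j < n)%nat -> (k < n)%nat -> s <> 0 ->
  rsum n (fun i => z i * z i) = s ->
  rsum n (fun i => (l * (kron i j / s - 2 * z i * z j / (s * s))) *
                   (l * (kron i k / s - 2 * z i * z k / (s * s)))) = l * l / (s * s) * kron j k.
Proof.
  intros Hj Hk Hs Hz.
  rewrite (rsum_ext n _ (fun i => kron i j * (l * l / (s * s) * kron i k) +
     (kron i k * (- 2 * l * l / (s * s * s) * z j * z i) +
     (kron i j * (- 2 * l * l / (s * s * s) * z k * z i) +
      4 * l * l / (s * s * s * s) * z j * z k * (z i * z i))))) by (intros; field; exact Hs).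
  rewrite !rsum_plus, rsum_scal, Hz.
  rewrite (rsum_kron n j (fun i => l * l / (s * s) * kron i k) Hj).
  rewrite (rsum_kron n k (fun i => - 2 * l * l / (s * s * s) * z j * z i) Hk).
  rewrite (rsum_kron n j (fun i => - 2 * l * l / (s * s * s) * z k * z i) Hj).
  field. exact Hs.
Qed.

(** Conformal covariance of the Laplacian, from three facts. The Jacobian is a multiple of an
    orthogonal matrix ([HA]), so the mixed second derivatives drop out and the Laplacian remains;
    the weight is harmonic ([HP2]), so the terms in [u x] vanish; and the gradient terms of the
    weight and of the inversion cancel ([HB]). The last two rely on n = k + 2. *)
Lemma lapjet_kel n k u D1 D2 c l y : INR n = INR k + 2 -> C2data n u D1 D2 ->
  pt n c -> pt n y -> 0 < sqsum n (vsub y c) -> punct n (kpt n c l y) ->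
  lapjet n (kel n k c l u) y
    (l ^ k * E k (sqsum n (vsub y c)) * ((l * l) * (l * l) /
       (sqsum n (vsub y c) * sqsum n (vsub y c))) * rsum n (fun i => D2 i i (kpt n c l y))).
Proof.
  intros Hnk HC Hc Hy Hs Hp.
  set (s := sqsum n (vsub y c)) in *. set (x := kpt n c l y) in *.
  set (z := fun j => y j - c j).
  set (A := fun i j => (l * l) * (kron i j / s - 2 * z i * z j / (s * s))).
  set (B := fun i j => (l * l) * (- 2 * z i * kron i j / (s * s) +
       z j * (4 * (z i * z i) / (s * s * s) - / (s * s)))).
  assert (Hsn : s <> 0) by lra.
  assert (Hz : rsum n (fun i => z i * z i) = s) by (apply sqsum_rsum).
  set (P := l ^ k * E k s).
  (* [P], [P1], [P2] are the jet of the weight along axis [i]; [A], [B] that of the displacement of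
     the inverse point; [U1], [U2] that of [u] at the inverse point. *)
  set (P1 := fun i => l ^ k * (- INR k * E k s * z i / s)).
  set (P2 := fun i => l ^ k * (- (INR k / 2) * E k s / s + INR k * (INR k + 2) / 2 * E k s * (z i * z i) / (s * s))).
  set (U1 := fun i => rsum n (fun m => D1 m x * A i m)).
  set (U2 := fun i => rsum n (fun m => D1 m x * B i m) + hessian_form n (fun i j => D2 i j x) (A i)).
  exists (fun i => P * U1 i + P1 i * u x), (fun i => P * U2 i + P1 i * U1 i + P2 i * u x). split.
  - intros i Hi.
    assert (Hinv : jet (fun t => / sqsum n (vsub (shift y i t) c)) (/ s) (- 2 * z i / (s * s))
              (- / (s * s) + 4 * (z i * z i) / (s * s * s))).
    { eapply jet_eq; [apply (jet_comp Rinv _ _ _ _ _ _ _ (jet_inv s Hs) (jet_sqsum n y c i Hi))| | |];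
        fold (z i); [reflexivity| |]; field; exact Hsn. }
    (* The curve is the displacement of the inverse point from [x]; subtracting [z j / s] makes it
       start at 0, as [C2data_jet_curve] requires. *)
    assert (Hh : forall j, (j < n)%nat -> jet (fun t => l * l * (/ sqsum n (vsub (shift y i t) c) *
         (z j + kron j i * t + 0 * (t * t)) + - (z j / s))) 0 (A i j) (B i j)).
    { intros j Hj. eapply jet_eq.
      - apply jet_scal, jet_plus; [|apply jet_const].
        apply jet_mult; [exact Hinv | apply jet_poly].
      - field. exact Hsn.
      - unfold A. rewrite (kron_sym j i). field. exact Hsn.
      - unfold B. rewrite (kron_sym j i). field. exact Hsn. }
    assert (HU := C2data_jet_curve n u D1 D2 x _ _ _ HC Hp Hh).
    assert (HP := jet_scal (l ^ k) _ _ _ _ (jet_E_sqsum n k y c i Hi Hs)).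
    eapply jet_ext; [|eapply jet_eq; [apply (jet_mult _ _ _ _ _ _ _ _ HP HU)| | |]].
    + intros t. unfold kel. f_equal. f_equal. extensionality j. unfold tr.
      destruct (Nat.ltb_spec j n) as [Hj|Hj].
      * unfold x, kpt. fold s. rewrite shift_kron. unfold z, Rdiv. ring.
      * rewrite (pt_kpt n c l (shift y i t) Hc (pt_shift n y i t Hy Hi) j Hj). apply Hp, Hj.
    + reflexivity.
    + reflexivity.
    + reflexivity.
  - assert (HA : forall j m, (j < n)%nat -> (m < n)%nat ->
      rsum n (fun i => A i j * A i m) = (l * l) * (l * l) / (s * s) * kron j m).
    { intros j m Hj Hm. now apply inversion_jacobian_orthogonal. }
    assert (HP2 : rsum n P2 = 0).
    { unfold P2. rewrite rsum_scal.
      rewrite (rsum_ext n _ (fun i => - (INR k / 2) * E k s / s +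
        INR k * (INR k + 2) / 2 * E k s / (s * s) * (z i * z i))) by (intros; field; exact Hsn).
      rewrite rsum_plus, rsum_const, rsum_scal, Hz, Hnk. field. exact Hsn. }
    assert (HB : forall m, (m < n)%nat -> P * rsum n (fun i => B i m) +
              rsum n (fun i => P1 i * A i m) = 0).
    { intros m Hm. unfold B, P1, A, P.
      rewrite (rsum_ext n _ (fun i => kron i m * (l * l * (-2 * z i / (s * s))) +
        (l * l * z m * 4 / (s * s * s) * (z i * z i) + - (l * l * z m / (s * s)))))
        by (intros; field; exact Hsn).
      rewrite (rsum_ext n (fun i => l ^ k * (- INR k * E k s * z i / s) * _)
        (fun i => kron i m * (l ^ k * (- INR k * E k s * z i / s) * (l * l) / s) +
           l ^ k * INR k * E k s * (l * l) * 2 * z m / (s * s * s) * (z i * z i)))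
        by (intros; field; exact Hsn).
      rewrite !rsum_plus, !rsum_scal, rsum_const, Hz, Hnk.
      rewrite (rsum_kron n m (fun i => l * l * (-2 * z i / (s * s))) Hm).
      rewrite (rsum_kron n m (fun i => l ^ k * (- INR k * E k s * z i / s) * (l * l) / s) Hm).
      field. exact Hsn. }
    assert (HU1 : rsum n (fun i => P1 i * U1 i) = rsum n (fun m => D1 m x * rsum n (fun i => P1 i * A i m))).
    { rewrite (rsum_ext n _ (fun i => rsum n (fun m => D1 m x * (P1 i * A i m)))).
      - rewrite rsum_exchange. apply rsum_ext. intros. apply rsum_scal.
      - intros i _. unfold U1. rewrite <- rsum_scal. apply rsum_ext. intros. ring. }
    assert (HU2 : rsum n U2 = rsum n (fun m => D1 m x * rsum n (fun i => B i m)) +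
       / 2 * ((l * l) * (l * l) / (s * s)) * rsum n (fun i => D2 i i x)).
    { unfold U2. rewrite rsum_plus, rsum_exchange. f_equal.
      - apply rsum_ext. intros. apply rsum_scal.
      - unfold hessian_form. rewrite rsum_exchange, <- rsum_scal. apply rsum_ext. intros m Hm.
        rewrite rsum_plus, rsum_scal, HA by assumption.
        rewrite (rsum_ext n _ (fun i => rsum m (fun j => D2 j m x * (A i j * A i m)))).
        + rewrite rsum_exchange, (rsum_zero m).
          * unfold kron. rewrite Nat.eqb_refl. field. exact Hsn.
          * intros j Hj. rewrite rsum_scal, HA by lia. unfold kron.
            destruct (Nat.eqb_spec j m); [lia | ring].
        + intros i _. rewrite Rmult_comm, <- rsum_scal. apply rsum_ext. intros. ring. }
    rewrite !rsum_plus, rsum_scal, HU2, HU1.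
    rewrite (rsum_ext n (fun i => P2 i * u x) (fun i => u x * P2 i)) by (intros; ring).
    rewrite rsum_scal, HP2.
    assert (HS : P * rsum n (fun m => D1 m x * rsum n (fun i => B i m)) +
      rsum n (fun m => D1 m x * rsum n (fun i => P1 i * A i m)) = 0).
    { rewrite <- rsum_scal, <- rsum_plus. apply rsum_zero. intros m Hm.
      transitivity (D1 m x * (P * rsum n (fun i => B i m) + rsum n (fun i => P1 i * A i m))); [ring|].
      rewrite HB by exact Hm. ring. }
    fold P. lra.
Qed.

(** * Comparison in a punctured exterior domain *)

Lemma sqsum_edist n y a : sqsum n (vsub y a) = edist n y a * edist n y a.
Proof. symmetry. apply enorm_sq. Qed.

Lemma lapjet_fundamental n k y a : INR n = INR k + 2 -> 0 < edist n y a ->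
  lapjet n (fun y => (/ edist n y a) ^ k) y 0.
Proof.
  intros Hnk Hd. apply (lapjet_E n k y a Hnk). rewrite sqsum_edist. nra.
Qed.

Lemma cont_at_fundamental n k a x : 0 < edist n x a ->
  cont_at n (fun y => (/ edist n y a) ^ k) x.
Proof.
  intros Hd. apply (cont_at_comp n (fun r => (/ r) ^ k) (fun y => edist n y a)); [|apply cont_at_edist].
  induction k as [|k IH]; simpl; [apply continuity_pt_cst|].
  apply continuity_pt_mul; [|exact IH].
  apply (continuity_pt_inv (fun r => r)); [apply continuity_pt_ident | lra].
Qed.

Lemma inv_pow_le k a b : 0 < a -> a <= b -> (/ b) ^ k <= (/ a) ^ k.
Proof.
  intros Ha Hab. apply pow_incr. split; [apply Rlt_le, Rinv_0_lt_compat; lra|].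
  apply Rinv_le_contravar; lra.
Qed.

Lemma inv_pow_pos k a : 0 < a -> 0 < (/ a) ^ k.
Proof. intros. now apply pow_lt, Rinv_0_lt_compat. Qed.

Lemma pow_le_self k x : (1 <= k)%nat -> 0 <= x <= 1 -> x ^ k <= x.
Proof.
  intros Hk Hx. destruct k as [|k]; [lia|]. simpl.
  assert (x ^ k <= 1) by (rewrite <- (pow1 k); now apply pow_incr). nra.
Qed.

Lemma self_le_pow k x : (1 <= k)%nat -> 1 <= x -> x <= x ^ k.
Proof.
  intros Hk Hx. destruct k as [|k]; [lia|]. simpl.
  assert (1 <= x ^ k) by now apply pow_R1_Rle. nra.
Qed.

(** The point [a] is the pole of the test function, with a ball of radius [dl] cut out around it.
    The origin is excluded as well, but no neighbourhood of it is. *)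
Definition comparison_domain (n : nat) (c a : nat -> R) (l dl : R) (y : nat -> R) : Prop :=
  punct n y /\ l <= edist n y c /\ dl <= edist n y a.

Section Comparison.

Variables (n k : nat) (c a : nat -> R) (l dl m : R) (w psi phi : (nat -> R) -> R).
Hypotheses (Hnk : INR n = INR k + 2) (Hk : (1 <= k)%nat)
   (Hdl : 0 < dl) (Hm : 0 < m).

Let D := comparison_domain n c a l dl.

Hypotheses (psi_pos : forall y, D y -> 0 < psi y) (psi_cont : forall y, D y -> cont_at n psi y)
  (psi_lap : forall y, D y -> exists L, L < 0 /\ lapjet n psi y L)
  (w_nonneg : forall y, D y -> 0 <= w y) (w_cont : forall y, D y -> cont_at n w y)
  (w_lap : forall y, D y -> l < edist n y c -> dl < edist n y a ->
     exists L, L <= 0 /\ lapjet n w y L)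
  (w_inner : forall y, D y -> edist n y a = dl -> m <= w y)
  (phi_cont : forall y, D y -> cont_at n phi y)
  (phi_lap : forall y, D y -> l < edist n y c -> dl < edist n y a -> lapjet n phi y 0)
  (phi_le : forall y, D y -> phi y <= (/ edist n y a) ^ k)
  (phi_sphere : forall y, D y -> edist n y c = l -> phi y <= 0).

(* The constant 1 handles infinity, the fundamental solution handles the puncture at the
   origin, and psi makes the Laplacian of the difference strictly negative. *)
Lemma comparison_approx eps y0 : 0 < eps -> D y0 ->
  0 <= w y0 + (eps * (1 + psi y0 + (/ edist n y0 origin) ^ k) + - (m * dl ^ k) * phi y0).
Proof.
  intros He Hy0. set (kap := m * dl ^ k).
  assert (Hkap : 0 < kap) by (apply Rmult_lt_0_compat; auto; now apply pow_lt).
  assert (Hy0p : 0 < enorm n y0) by apply Hy0.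
  (* At distance [d0] from the origin the barrier eps |y|^(-k) is at least [m], which bounds
     [kap * phi]. The bound 1 gives |y|^(-k) >= 1 / |y|, and [enorm n y0] keeps [y0] in the
     region. *)
  set (d0 := Rmin (enorm n y0) (Rmin 1 (eps / m))).
  assert (Hem : 0 < eps / m) by now apply Rdiv_lt_0_compat.
  assert (Hd0 : 0 < d0) by (repeat apply Rmin_glb_lt; lra).
  assert (Hd0y : d0 <= enorm n y0) by apply Rmin_l.
  assert (Hd01 : d0 <= 1) by (eapply Rle_trans; [apply Rmin_r | apply Rmin_l]).
  assert (Hd0e : d0 <= eps / m) by (eapply Rle_trans; [apply Rmin_r | apply Rmin_r]).
  (* On the outer sphere |y - a| is at least 1 + kap / eps, so [kap * phi] is at most [eps] and the
     constant barrier absorbs it. *)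
  set (Rb := enorm n y0 + enorm n a + 1 + kap / eps).
  assert (Hke : 0 < kap / eps) by now apply Rdiv_lt_0_compat.
  assert (Hna := enorm_nonneg n a).
  set (K := fun y => pt n y /\ d0 <= enorm n y /\ enorm n y <= Rb /\ l <= edist n y c /\ dl <= edist n y a).
  assert (HKD : forall y, K y -> D y).
  { intros y (Hp & H1 & H2 & H3 & H4). repeat split; auto. lra. }
  assert (Hlip : forall x y b, edist n y b - edist n x b <= edist n y x).
  { intros x y b. eapply Rle_trans; [apply Rle_abs | apply edist_diff_le]. }
  assert (Hlip0 : forall x y, enorm n y - enorm n x <= edist n y x).
  { intros x y. rewrite <- !(edist_origin n). apply Hlip. }
  set (h := fun y => w y + (eps * (1 + psi y + (/ edist n y origin) ^ k) + - kap * phi y)).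
  assert (Hinner : dl ^ k * (/ dl) ^ k = 1).
  { rewrite <- Rpow_mult_distr, Rinv_r by lra. apply pow1. }
  (* On each of the four boundary pieces [h] is non-negative. At the ball around [a] this is why the
     coefficient is [m * dl ^ k]: there the multiple of [phi] is at most [m], and [w] is at least
     [m]. *)
  assert (Hbound : forall y, K y -> h y < 0 ->
     d0 < enorm n y /\ enorm n y < Rb /\ l < edist n y c /\ dl < edist n y a).
  { intros y Ky Hh. assert (Dy := HKD y Ky). destruct Ky as (Hp & H1 & H2 & H3 & H4).
    assert (W := w_nonneg y Dy). assert (Q := psi_pos y Dy). assert (F := phi_le y Dy).
    assert (T : 0 < (/ edist n y origin) ^ k).
    { apply inv_pow_pos. rewrite edist_origin. lra. }
    assert (Fi : kap * phi y <= m).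
    { apply Rle_trans with (kap * (/ dl) ^ k).
      - apply Rmult_le_compat_l; [lra|]. eapply Rle_trans; [exact F|]. now apply inv_pow_le.
      - unfold kap. rewrite Rmult_assoc, Hinner. lra. }
    unfold h in Hh.
    assert (Heq : 0 < eps * psi y) by now apply Rmult_lt_0_compat.
    assert (HeT : 0 < eps * (/ edist n y origin) ^ k) by now apply Rmult_lt_0_compat.
    repeat split.
    - destruct H1 as [H1|H1]; auto. exfalso.
      assert (m <= eps * (/ edist n y origin) ^ k); [|lra].
      rewrite edist_origin, <- H1.
      apply Rle_trans with (eps * / d0).
      + apply Rmult_le_reg_r with d0; auto. rewrite Rmult_assoc, Rinv_l by lra.
        apply Rmult_le_compat_l with (r := m) in Hd0e; [|lra].
        replace (m * (eps / m)) with eps in Hd0e by (field; lra). lra.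
      + apply Rmult_le_compat_l; [lra|]. apply self_le_pow; auto.
        rewrite <- Rinv_1. apply Rinv_le_contravar; lra.
    - destruct H2 as [H2|H2]; auto. exfalso.
      assert (kap * phi y <= eps); [|lra].
      assert (Hya : 1 + kap / eps <= edist n y a).
      { assert (Ht := edist_triang n y a origin). rewrite !edist_origin in Ht. unfold Rb in H2. lra. }
      apply Rle_trans with (kap * / edist n y a).
      + apply Rmult_le_compat_l; [lra|]. eapply Rle_trans; [exact F|]. apply pow_le_self; auto.
        split; [apply Rlt_le, Rinv_0_lt_compat; lra|]. rewrite <- Rinv_1.
        apply Rinv_le_contravar; lra.
      + apply Rmult_le_reg_r with (edist n y a); [lra|]. rewrite Rmult_assoc, Rinv_l by lra.
        apply Rmult_le_compat_l with (r := eps) in Hya; [|lra].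
        replace (eps * (1 + kap / eps)) with (eps + kap) in Hya by (field; lra). lra.
    - destruct H3 as [H3|H3]; auto. exfalso.
      assert (P := phi_sphere y Dy (eq_sym H3)). nra.
    - destruct H4 as [H4|H4]; auto. exfalso.
      assert (P := w_inner y Dy (eq_sym H4)). lra. }
  apply (min_principle n K Rb h).
  - intros y (Hp & _ & H & _). auto.
  - intros x Hx HnK.
    destruct (Rlt_dec (enorm n x) d0).
    { exists (d0 - enorm n x). split; [lra|]. intros y (_ & H & _). specialize (Hlip0 x y). lra. }
    destruct (Rlt_dec Rb (enorm n x)).
    { exists (enorm n x - Rb). split; [lra|]. intros y (_ & _ & H & _). specialize (Hlip0 y x).
      rewrite edist_sym in Hlip0. lra. }
    destruct (Rlt_dec (edist n x c) l).
    { exists (l - edist n x c). split; [lra|]. intros y (_ & _ & _ & H & _). specialize (Hlip x y c). lra. }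
    destruct (Rlt_dec (edist n x a) dl).
    { exists (dl - edist n x a). split; [lra|]. intros y (_ & _ & _ & _ & H). specialize (Hlip x y a). lra. }
    exfalso. apply HnK. repeat split; auto; lra.
  - intros x Kx. assert (Dx := HKD x Kx).
    apply cont_at_plus; auto. apply cont_at_plus; apply cont_at_scal; auto.
    apply cont_at_plus; [apply cont_at_plus; auto; apply cont_at_const|].
    apply cont_at_fundamental. rewrite edist_origin. apply Dx.
  - intros x Kx Hh. destruct (Hbound x Kx Hh) as (B1 & B2 & B3 & B4).
    assert (Dx := HKD x Kx). split.
    + destruct (psi_lap x Dx) as (L1 & HL1 & J1). destruct (w_lap x Dx B3 B4) as (L2 & HL2 & J2).
      exists (L2 + (eps * (0 + L1 + 0) + - kap * 0)). split; [nra|].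
      apply lapjet_plus; auto. apply lapjet_plus; apply lapjet_scal; auto.
      apply lapjet_plus; [apply lapjet_plus; auto; apply lapjet_const|].
      apply lapjet_fundamental; auto. rewrite edist_origin. apply Dx.
    + set (d := Rmin (Rmin (enorm n x - d0) (Rb - enorm n x)) (Rmin (edist n x c - l) (edist n x a - dl))).
      assert (Hd : 0 < d) by (repeat apply Rmin_glb_lt; lra).
      assert (D1 := Rmin_l (Rmin (enorm n x - d0) (Rb - enorm n x)) (Rmin (edist n x c - l) (edist n x a - dl))).
      assert (D2 := Rmin_r (Rmin (enorm n x - d0) (Rb - enorm n x)) (Rmin (edist n x c - l) (edist n x a - dl))).
      fold d in D1, D2.
      assert (D3 := Rmin_l (enorm n x - d0) (Rb - enorm n x)).
      assert (D4 := Rmin_r (enorm n x - d0) (Rb - enorm n x)).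
      assert (D5 := Rmin_l (edist n x c - l) (edist n x a - dl)).
      assert (D6 := Rmin_r (edist n x c - l) (edist n x a - dl)).
      exists d. split; auto. intros y Hy Hyx.
      assert (Q1 := Hlip0 x y). assert (Q2 := Hlip0 y x).
      assert (Q3 := Hlip y x c). assert (Q4 := Hlip y x a).
      rewrite (edist_sym n x y) in Q2, Q3, Q4.
      repeat split; auto; lra.
  - destruct Hy0 as ((Hp & _) & H3 & H4). repeat split; auto. unfold Rb. lra.
Qed.

Lemma comparison y : D y -> m * dl ^ k * phi y <= w y.
Proof.
  intros Dy. apply Rnot_lt_le. intros Hlt.
  set (C := 1 + psi y + (/ edist n y origin) ^ k).
  assert (HC : 0 < C).
  { assert (0 < (/ edist n y origin) ^ k) by (apply inv_pow_pos; rewrite edist_origin; apply Dy).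
    specialize (psi_pos y Dy). unfold C. lra. }
  (* With this [e] the total perturbation at [y] is half of the supposed deficit. *)
  set (e := (m * dl ^ k * phi y - w y) / (2 * C)).
  assert (He : 0 < e) by (apply Rdiv_lt_0_compat; lra).
  assert (H := comparison_approx e y He Dy). fold C in H.
  replace (e * C) with ((m * dl ^ k * phi y - w y) / 2) in H by (unfold e; field; lra). lra.
Qed.

End Comparison.

(** * Lower bounds from Green's function *)

Lemma sqsum_vsub_smul n z t al :
  sqsum n (vsub z (smul t al)) = sqsum n z - 2 * t * dot n z al + t * t * sqsum n al.
Proof.
  rewrite !sqsum_dot. unfold dot.
  rewrite (rsum_ext n _ (fun i => z i * z i + (-2 * t * (z i * al i) + t * t * (al i * al i))))
    by (intros; unfold vsub, smul; ring).
  rewrite !rsum_plus, !rsum_scal. ring.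
Qed.

Lemma pow_sub_lower k p q : (1 <= k)%nat -> 0 < q <= p -> p ^ k * ((p - q) / p) <= p ^ k - q ^ k.
Proof.
  intros Hk H. destruct k as [|k]; [lia|]. simpl.
  assert (q ^ k <= p ^ k) by (apply pow_incr; lra).
  replace (p * p ^ k * ((p - q) / p)) with (p ^ k * p - p ^ k * q) by (field; lra).
  assert (0 < p ^ k) by (apply pow_lt; lra). nra.
Qed.

Lemma edist_kpt n c l a : 0 < edist n a c ->
  edist n (kpt n c l a) c = l * l / edist n a c.
Proof.
  intros Ha. unfold edist at 1.
  replace (vsub (kpt n c l a) c) with (smul (l * l / (edist n a c * edist n a c)) (vsub a c)).
  - rewrite enorm_smul, Rabs_pos_eq.
    + fold (edist n a c). field. lra.
    + apply Rle_mult_inv_pos; nra.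
  - extensionality j. unfold smul, vsub, kpt. fold (vsub a c). rewrite sqsum_edist.
    unfold Rdiv. ring.
Qed.

(* Apollonius: on the sphere |y - c| = l the ratio of the distances from y to a and to its inverse
   point is constant, equal to |a - c| / l. *)
Lemma apollonius n c l a y : 0 < l -> 0 < edist n a c ->
  let A := edist n a c in let r := edist n y c in
  let Y := A / l * edist n y (kpt n c l a) in
  Y * Y - edist n y a * edist n y a = (r * r - l * l) * (A * A - l * l) / (l * l).
Proof.
  intros Hl HA A r Y.
  assert (H1 : edist n y a * edist n y a = r * r - 2 * dot n (vsub y c) (vsub a c) + A * A).
  { unfold r, A. rewrite <- !sqsum_edist.
    replace (vsub y a) with (vsub (vsub y c) (smul 1 (vsub a c)))
      by (extensionality j; unfold vsub, smul; ring).
    rewrite sqsum_vsub_smul. ring. }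
  assert (H2 : edist n y (kpt n c l a) * edist n y (kpt n c l a) =
      r * r - 2 * (l * l / (A * A)) * dot n (vsub y c) (vsub a c) + l * l * (l * l) / (A * A)).
  { unfold r. rewrite <- !sqsum_edist.
    replace (vsub y (kpt n c l a)) with (vsub (vsub y c) (smul (l * l / (A * A)) (vsub a c))).
    - rewrite sqsum_vsub_smul, (sqsum_edist n a c). fold A. field. unfold A. lra.
    - extensionality j. unfold vsub at 1 2 4, smul, kpt. rewrite sqsum_edist. fold A.
      unfold vsub, Rdiv. ring. }
  rewrite H1. unfold Y.
  replace (A / l * edist n y (kpt n c l a) * (A / l * edist n y (kpt n c l a))) with
    (A * A / (l * l) * (edist n y (kpt n c l a) * edist n y (kpt n c l a))) by (field; lra).
  rewrite H2. field. unfold A. lra.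
Qed.

(* The right-hand side is Green's function of the exterior of the ball, with pole a. *)
Lemma green_lower_bound n k c l a : (1 <= k)%nat -> 0 < l -> l < edist n a c ->
  exists c0, 0 < c0 /\ forall y, l <= edist n y c -> 0 < edist n y a ->
    let r := edist n y c in
    c0 * (/ r) ^ k * (1 - l * l / (r * r)) <=
    (/ edist n y a) ^ k - (l / edist n a c) ^ k * (/ edist n y (kpt n c l a)) ^ k.
Proof.
  intros Hk Hl HA. set (A := edist n a c) in *. set (b := kpt n c l a).
  (* In what follows [X] is the distance to the pole and [Y] the rescaled distance to its inverse
     point, which is at most [C0 * r]. *)
  set (C0 := A / l + 1).
  assert (HAl : 0 < A / l) by (apply Rdiv_lt_0_compat; lra).
  assert (HC0 : 0 < C0) by (unfold C0; lra).
  assert (HAl2 : 0 < A * A - l * l) by nra.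
  (* By [apollonius], e (1 - l^2 / r^2) equals (Y^2 - X^2) / (2 C0^2 r^2). This is at most (Y^2 -
     X^2) / (2 Y^2), hence at most (Y - X) / Y, which is the relative gap between 1 / X and 1 /
     Y. *)
  set (e := (A * A - l * l) / (2 * (l * l) * (C0 * C0))).
  assert (Hll : 0 < l * l) by nra. assert (HCC : 0 < C0 * C0) by nra.
  assert (He : 0 < e) by (apply Rdiv_lt_0_compat; nra).
  exists ((/ C0) ^ k * e). split; [apply Rmult_lt_0_compat; auto; now apply inv_pow_pos|].
  intros y Hy Hya r. fold r in Hy.
  assert (Hr : 0 < r) by lra.
  assert (Hbc : edist n b c = l * l / A) by (apply edist_kpt; fold A; lra).
  assert (Hlb : l * l / A < l).
  { apply Rmult_lt_reg_r with A; [lra|]. unfold Rdiv. rewrite Rmult_assoc, Rinv_l by lra. nra. }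
  assert (Hyb : 0 < edist n y b).
  { assert (Ht := edist_triang n y b c). fold r in Ht. lra. }
  assert (Hap := apollonius n c l a y Hl ltac:(fold A; lra)). cbv zeta in Hap. fold A r b in Hap.
  set (X := edist n y a) in *. set (Y := A / l * edist n y b) in *.
  assert (HY : 0 < Y) by (apply Rmult_lt_0_compat; auto).
  assert (Hgap : 0 <= Y * Y - X * X).
  { rewrite Hap. apply Rle_mult_inv_pos; auto. apply Rmult_le_pos; nra. }
  assert (HXY : X <= Y) by nra.
  assert (HYr : Y <= C0 * r).
  { assert (Ht := edist_triang n y c b). rewrite (edist_sym n c b), Hbc in Ht. fold r in Ht.
    unfold Y, C0. apply Rle_trans with (A / l * (r + l * l / A)).
    - apply Rmult_le_compat_l; lra.
    - replace (A / l * (r + l * l / A)) with (A / l * r + l) by (field; lra). lra. }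
  replace ((l / A) ^ k * (/ edist n y b) ^ k) with ((/ Y) ^ k).
  2:{ rewrite <- Rpow_mult_distr. f_equal. unfold Y. field. lra. }
  eapply Rle_trans; [|apply pow_sub_lower; auto].
  2:{ split; [now apply Rinv_0_lt_compat | apply Rinv_le_contravar; auto]. }
  replace ((/ X - / Y) / / X) with ((Y - X) / Y) by (field; lra).
  replace ((/ C0) ^ k * e * (/ r) ^ k) with ((/ C0) ^ k * (/ r) ^ k * e) by ring.
  rewrite <- Rpow_mult_distr, Rmult_assoc.
  assert (Hfr : 0 <= 1 - l * l / (r * r)).
  { assert (l * l / (r * r) <= 1); [|lra]. apply Rmult_le_reg_r with (r * r); [nra|].
    unfold Rdiv. rewrite Rmult_assoc, Rinv_l by nra. nra. }
  apply Rmult_le_compat.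
  - apply Rlt_le, pow_lt. apply Rmult_lt_0_compat; now apply Rinv_0_lt_compat.
  - apply Rmult_le_pos; lra.
  - rewrite <- Rinv_mult. apply inv_pow_le; lra.
  - apply Rle_trans with ((Y * Y - X * X) / (2 * (Y * Y))).
    + rewrite Hap.
      replace ((r * r - l * l) * (A * A - l * l) / (l * l) / (2 * (Y * Y))) with
        ((r * r - l * l) * (A * A - l * l) / (2 * (l * l)) * / (Y * Y)) by (field; lra).
      replace (e * (1 - l * l / (r * r))) with
        ((r * r - l * l) * (A * A - l * l) / (2 * (l * l)) * / ((C0 * r) * (C0 * r)))
        by (unfold e; field; lra).
      apply Rmult_le_compat_l.
      * apply Rle_mult_inv_pos; [apply Rmult_le_pos; nra | nra].
      * apply Rinv_le_contravar; nra.
    + apply Rmult_le_reg_r with (2 * (Y * Y)); [nra|].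
      replace ((Y * Y - X * X) / (2 * (Y * Y)) * (2 * (Y * Y))) with (Y * Y - X * X) by (field; lra).
      replace ((Y - X) / Y * (2 * (Y * Y))) with (2 * Y * (Y - X)) by (field; lra). nra.
Qed.

Definition superharmonic (n : nat) (psi : (nat -> R) -> R) : Prop :=
  forall y, punct n y -> 0 < psi y /\ cont_at n psi y /\ exists L, L < 0 /\ lapjet n psi y L.

(** A quantitative strong maximum principle and Hopf lemma in one. Positivity at [a] persists on a
    small ball, and outside that ball [w] dominates a multiple of Green's function with pole [a].
    The resulting bound decays like r^(-k) and vanishes only to first order on the sphere. *)
Lemma exterior_lower_bound n k c l a w psi : INR n = INR k + 2 -> (1 <= k)%nat ->
  pt n c -> pt n a -> 0 < l -> l < edist n a c -> 0 < w a -> superharmonic n psi ->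
  (forall y, punct n y -> l <= edist n y c -> 0 <= w y) ->
  (forall y, punct n y -> l <= edist n y c -> cont_at n w y) ->
  (forall y, punct n y -> l < edist n y c -> exists L, L <= 0 /\ lapjet n w y L) ->
  cont_at n w a ->
  exists c0, 0 < c0 /\ forall y, punct n y -> l <= edist n y c ->
    c0 * (/ edist n y c) ^ k * (1 - l * l / (edist n y c * edist n y c)) <= w y.
Proof.
  intros Hnk Hk Hc Ha Hl HA Hwa Hpsi Hw0 Hwc Hwl Hca.
  destruct (cont_at_eventually_gt n w a (w a / 2) Hca) as (d & Hd & Hnear); [lra|].
  destruct (green_lower_bound n k c l a Hk Hl HA) as (c1 & Hc1 & Hgreen).
  set (m := w a / 2) in *. assert (Hm : 0 < m) by (unfold m; lra).
  set (dl := d / 2). assert (Hdl : 0 < dl) by (unfold dl; lra).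
  set (kap := m * dl ^ k).
  assert (Hkap : 0 < kap) by (apply Rmult_lt_0_compat; auto; now apply pow_lt).
  assert (Hlk : 0 < l ^ k) by now apply pow_lt.
  set (A := edist n a c) in *. set (b := kpt n c l a).
  assert (Hbc : edist n b c = l * l / A) by (apply edist_kpt; fold A; lra).
  assert (Hlb : l * l / A < l).
  { apply Rmult_lt_reg_r with A; [lra|]. unfold Rdiv. rewrite Rmult_assoc, Rinv_l by lra. nra. }
  assert (Hyb : forall y, l <= edist n y c -> 0 < edist n y b).
  { intros y Hy. assert (Ht := edist_triang n y b c). lra. }
  set (phi := fun y => (/ edist n y a) ^ k + - (l / A) ^ k * (/ edist n y b) ^ k).
  assert (Hcmp : forall y, punct n y -> l <= edist n y c -> dl <= edist n y a -> kap * phi y <= w y).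
  { intros y Py Hy1 Hy2.
    apply (comparison n k c a l dl m w psi phi); auto.
    - intros z (P & _). now apply Hpsi.
    - intros z (P & _). now apply Hpsi.
    - intros z (P & _). now apply Hpsi.
    - intros z (P & Q & _). auto.
    - intros z (P & Q & _). auto.
    - intros z (P & _) Q _. auto.
    - intros z (P & _) Hz. apply Rlt_le, Hnear; [apply P | unfold dl in Hz; lra].
    - intros z (P & Q & S0). apply cont_at_plus; [|apply cont_at_scal]; apply cont_at_fundamental; auto; lra.
    - intros z (P & _) Q S0. replace 0 with (0 + - (l / A) ^ k * 0) by ring.
      apply lapjet_plus; [|apply lapjet_scal]; apply lapjet_fundamental; auto; try lra.
      apply Hyb; lra.
    - intros z (P & Q & S0). unfold phi.
      assert (0 < (l / A) ^ k) by (apply pow_lt, Rdiv_lt_0_compat; lra).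
      assert (0 < (/ edist n z b) ^ k) by (apply inv_pow_pos; auto). nra.
    - intros z (P & Q & S0) Hz. unfold phi.
      assert (Hap := apollonius n c l a z Hl ltac:(fold A; lra)). cbv zeta in Hap. fold A b in Hap.
      rewrite Hz in Hap.
      assert (Hzb := Hyb z Q).
      assert (HY : 0 < A / l * edist n z b).
      { apply Rmult_lt_0_compat; auto. apply Rdiv_lt_0_compat; lra. }
      assert (Heq : A / l * edist n z b = edist n z a).
      { replace ((l * l - l * l) * (A * A - l * l) / (l * l)) with 0 in Hap by (field; lra). nra. }
      rewrite <- Heq.
      replace (/ (A / l * edist n z b)) with (l / A * / edist n z b) by (field; lra).
      rewrite Rpow_mult_distr. lra.
    - now repeat split; try apply Py. }
  (* The first constant serves outside the small ball around [a], by comparison; the second serves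
     inside it, where [w] is at least [m] and (l / r)^k is at most 1. *)
  exists (Rmin (kap * c1) (m * l ^ k)).
  assert (Hmin : 0 < Rmin (kap * c1) (m * l ^ k)).
  { apply Rmin_glb_lt; now apply Rmult_lt_0_compat. }
  split; auto. intros y Py Hy. set (r := edist n y c) in *.
  assert (Hr : 0 < r) by lra.
  assert (Hrr : 0 < l * l / (r * r)) by (apply Rdiv_lt_0_compat; nra).
  assert (Hfr : 0 <= 1 - l * l / (r * r)).
  { assert (l * l / (r * r) <= 1); [|lra]. apply Rmult_le_reg_r with (r * r); [nra|].
    unfold Rdiv. rewrite Rmult_assoc, Rinv_l by nra. nra. }
  assert (Hrk : 0 < (/ r) ^ k) by now apply inv_pow_pos.
  destruct (Rle_dec dl (edist n y a)) as [Hya|Hya].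
  - eapply Rle_trans; [|apply Hcmp; auto]. unfold phi.
    specialize (Hgreen y Hy ltac:(lra)). cbv zeta in Hgreen. fold r b in Hgreen.
    apply Rle_trans with (kap * (c1 * (/ r) ^ k * (1 - l * l / (r * r)))).
    + rewrite !Rmult_assoc, <- (Rmult_assoc kap). apply Rmult_le_compat_r; [|apply Rmin_l].
      apply Rmult_le_pos; lra.
    + apply Rmult_le_compat_l; lra.
  - apply Rle_trans with m; [|apply Rlt_le, Hnear; [apply Py | unfold dl in Hya; lra]].
    apply Rle_trans with (m * l ^ k * (/ l) ^ k * 1).
    + apply Rmult_le_compat; [|lra| |lra].
      * apply Rmult_le_pos; lra.
      * apply Rmult_le_compat; [lra|lra|apply Rmin_r|]. now apply inv_pow_le.
    + rewrite Rmult_1_r, Rmult_assoc, <- Rpow_mult_distr, Rinv_r, pow1 by lra. lra.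
Qed.

(** The analogue for radius 0, with the fundamental solution in place of Green's function. It
    supplies the decay rate from which the spheres start. *)
Lemma superharmonic_lower_bound n k c psi eta : INR n = INR k + 2 -> (1 <= k)%nat ->
  punct n c -> superharmonic n psi -> 0 < eta ->
  exists c0, 0 < c0 /\ forall y, punct n y -> eta <= edist n y c ->
    c0 * (/ edist n y c) ^ k <= psi y.
Proof.
  intros Hnk Hk Hc Hpsi Heta.
  destruct (Hpsi c Hc) as (Hpos & Hcc & _).
  destruct (cont_at_eventually_gt n psi c (psi c / 2) Hcc) as (d & Hd & Hnear); [lra|].
  set (m := psi c / 2) in *. assert (Hm : 0 < m) by (unfold m; lra).
  set (dl := d / 2). assert (Hdl : 0 < dl) by (unfold dl; lra).
  exists (Rmin (m * dl ^ k) (m * eta ^ k)). split.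
  { apply Rmin_glb_lt; apply Rmult_lt_0_compat; auto; now apply pow_lt. }
  intros y Py Hy. assert (Hrk : 0 < (/ edist n y c) ^ k) by (apply inv_pow_pos; lra).
  destruct (Rle_dec dl (edist n y c)) as [Hyd|Hyd].
  - apply Rle_trans with (m * dl ^ k * (/ edist n y c) ^ k).
    { apply Rmult_le_compat_r; [lra | apply Rmin_l]. }
    (* Here [psi] is both the function bounded below and the strict barrier. With [l = 0] and
       [a = c] the condition on the sphere is vacuous, as the ball cut out around [c] has positive
       radius. *)
    apply (comparison n k c c 0 dl m psi psi (fun y => (/ edist n y c) ^ k)); auto.
    + intros z (P & _). now apply Hpsi.
    + intros z (P & _). now apply Hpsi.
    + intros z (P & _). now apply Hpsi.
    + intros z (P & _). apply Rlt_le. now apply Hpsi.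
    + intros z (P & _). now apply Hpsi.
    + intros z (P & _) _ _. destruct (Hpsi z P) as (_ & _ & L & HL & HJ). exists L. split; [lra | auto].
    + intros z (P & _) Hz. apply Rlt_le, Hnear; [apply P | unfold dl in Hz; lra].
    + intros z (_ & _ & Q). apply cont_at_fundamental. lra.
    + intros z _ Q _. now apply lapjet_fundamental.
    + intros z _. lra.
    + intros z (_ & _ & Q) Hz. lra.
    + repeat split; try apply Py; auto. lra.
  - apply Rle_trans with m; [|apply Rlt_le, Hnear; [apply Py | unfold dl in Hyd; lra]].
    apply Rle_trans with (m * eta ^ k * (/ eta) ^ k).
    + apply Rmult_le_compat; [|lra|apply Rmin_r|now apply inv_pow_le].
      apply Rmin_glb; apply Rlt_le, Rmult_lt_0_compat; auto; now apply pow_lt.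
    + rewrite Rmult_assoc, <- Rpow_mult_distr, Rinv_r, pow1 by lra. lra.
Qed.

(** * Moving one sphere *)

Lemma closed_ball_cover n c M (P : R -> (nat -> R) -> Prop) :
  (forall d d' y, 0 < d' <= d -> P d y -> P d' y) ->
  (forall x, pt n x -> edist n x c <= M -> exists d, 0 < d /\
     forall y, pt n y -> edist n y c <= M -> edist n y x < d -> P d y) ->
  exists d, 0 < d /\ forall y, pt n y -> edist n y c <= M -> P d y.
Proof.
  intros Ha H. destruct (ball_cover n (M + enorm n c) (fun d y => edist n y c <= M -> P d y))
    as (d & Hd & Hb).
  - intros d d' y Hd Hp Hy. apply (Ha d); auto.
  - intros x Hx _. destruct (Rle_dec (edist n x c) M) as [Hxc|Hxc].
    + destruct (H x Hx Hxc) as (d & Hd & Hb). exists d. split; auto.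
    + exists (edist n x c - M). split; [lra|]. intros y Hy _ Hyx Hyc.
      assert (Ht := edist_triang n x y c). rewrite (edist_sym n x y) in Ht. lra.
  - exists d. split; auto. intros y Hy Hyc. apply Hb; auto.
    assert (Ht := edist_triang n y c origin). rewrite !edist_origin in Ht. lra.
Qed.

Lemma bounded_on_ball n c M f : (forall x, pt n x -> edist n x c <= M -> cont_at n f x) ->
  exists B, 0 < B /\ forall y, pt n y -> edist n y c <= M -> f y <= B.
Proof.
  intros Hf. destruct (closed_ball_cover n c M (fun d y => f y <= / d)) as (d & Hd & H).
  - intros d d' y Hd H. assert (/ d <= / d') by (apply Rinv_le_contravar; lra). lra.
  - intros x Hx Hxc. destruct (Hf x Hx Hxc 1) as (d & Hd & H); [lra|].
    set (A := Rabs (f x) + 1). assert (HA : 0 < A) by (assert (H1 := Rabs_pos (f x)); unfold A; lra).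
    exists (Rmin d (/ A)). assert (Hm : 0 < Rmin d (/ A)).
    { apply Rmin_glb_lt; auto. now apply Rinv_0_lt_compat. }
    split; auto. intros y Hy _ Hyx.
    assert (A <= / Rmin d (/ A)).
    { rewrite <- (Rinv_inv A) at 1. apply Rinv_le_contravar; auto. apply Rmin_r. }
    assert (Hh : Rabs (f y - f x) < 1) by (apply H; auto; eapply Rlt_le_trans; [exact Hyx | apply Rmin_l]).
    apply Rabs_def2 in Hh. assert (H1 := Rle_abs (f x)). unfold A in *. lra.
  - exists (/ d). split; [now apply Rinv_0_lt_compat | exact H].
Qed.

Lemma uniformly_continuous_on_ball n c M f eps :
  (forall x, pt n x -> edist n x c <= M -> cont_at n f x) -> 0 < eps ->
  exists d, 0 < d /\ forall x y, pt n x -> pt n y -> edist n x c <= M -> edist n y c <= M ->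
    edist n x y < d -> f x - f y <= eps.
Proof.
  intros Hf He. destruct (closed_ball_cover n c M (fun d y => forall x, pt n x -> edist n x c <= M ->
    edist n x y < d -> f x - f y <= eps)) as (d & Hd & H).
  - intros d d' y Hd H x Hx Hxc Hxy. apply H; auto. lra.
  - intros z Hz Hzc. destruct (Hf z Hz Hzc (eps / 2)) as (d & Hd & H); [lra|].
    exists (d / 2). split; [lra|]. intros y Hy Hyc Hyz x Hx Hxc Hxy.
    assert (H1 : Rabs (f x - f z) < eps / 2).
    { apply H; auto. assert (Ht := edist_triang n x y z). lra. }
    assert (H2 : Rabs (f y - f z) < eps / 2) by (apply H; auto; lra).
    apply Rabs_def2 in H1, H2. lra.
  - exists d. split; auto.
Qed.

Lemma edist_lt_punct n c x : pt n x -> edist n x c < enorm n c -> punct n x.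
Proof.
  intros Hx Hd. split; auto. assert (Ht := edist_triang n c x origin).
  rewrite !edist_origin, edist_sym in Ht. lra.
Qed.

Lemma edist_kpt_le n c l y : 0 <= l -> l <= edist n y c -> 0 < edist n y c ->
  edist n (kpt n c l y) c <= l.
Proof.
  intros Hl Hy Hp. rewrite edist_kpt by exact Hp.
  apply Rmult_le_reg_r with (edist n y c); auto. unfold Rdiv.
  rewrite Rmult_assoc, Rinv_l by lra. nra.
Qed.

(** Since [l < enorm n c], the closed ball of the sphere misses the origin. *)
Lemma punct_kpt n c l y : pt n c -> pt n y -> 0 <= l -> l <= edist n y c -> 0 < edist n y c ->
  l < enorm n c -> punct n (kpt n c l y).
Proof.
  intros Hc Hy Hl Hly Hp Hlc. apply (edist_lt_punct n c); [now apply pt_kpt|].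
  eapply Rle_lt_trans; [|exact Hlc]. now apply edist_kpt_le.
Qed.

Lemma kel_eq n k c l u y : kel n k c l u y = l ^ k * (/ edist n y c) ^ k * u (kpt n c l y).
Proof. reflexivity. Qed.

Lemma cont_at_kel n k c l u y : pt n c -> 0 < edist n y c ->
  cont_at n u (kpt n c l y) -> cont_at n (kel n k c l u) y.
Proof.
  intros Hc Hp Hu. apply cont_at_mult.
  - apply cont_at_scal. now apply (cont_at_fundamental n k c y).
  - apply (cont_at_map n u (kpt n c l)); auto.
    + intros z Hz. now apply pt_kpt.
    + intros i Hi. apply cont_at_plus; [apply cont_at_const|]. apply cont_at_mult.
      * apply cont_at_scal. apply (cont_at_comp n Rinv (fun y => sqsum n (vsub y c))).
        -- apply (continuity_pt_inv (fun r => r)); [apply continuity_pt_ident|].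
           rewrite sqsum_edist. nra.
        -- replace (fun y => sqsum n (vsub y c)) with (fun y => edist n y c * edist n y c)
             by (extensionality z; symmetry; apply sqsum_edist).
           apply cont_at_mult; apply cont_at_edist.
      * apply (cont_at_plus n (fun y => y i) (fun _ => - c i)); [now apply cont_at_coord | apply cont_at_const].
Qed.

Lemma edist_kpt_kpt n c l m y : 0 < edist n y c ->
  edist n (kpt n c l y) (kpt n c m y) = Rabs (l * l - m * m) / edist n y c.
Proof.
  intros Hp. unfold edist at 1.
  replace (vsub (kpt n c l y) (kpt n c m y)) with
    (smul ((l * l - m * m) / (edist n y c * edist n y c)) (vsub y c)).
  - rewrite enorm_smul. unfold Rdiv. rewrite Rabs_mult, Rabs_inv.
    rewrite (Rabs_pos_eq (edist n y c * _)) by nra. fold (edist n y c). field. lra.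
  - extensionality j. unfold smul, vsub, kpt. fold (vsub y c). rewrite sqsum_edist.
    unfold Rdiv. ring.
Qed.

Lemma continuity_kel_radius n k c l u y : pt n c -> pt n y -> 0 < edist n y c ->
  cont_at n u (kpt n c l y) -> continuity_pt (fun m => kel n k c m u y) l.
Proof.
  intros Hc Hy Hp Hu. unfold kel. apply continuity_pt_mul.
  - apply continuity_pt_mul; [|apply continuity_pt_cst].
    apply derivable_continuous_pt, derivable_pt_pow.
  - intros e He. destruct (Hu e He) as (d & Hd & H).
    assert (Hsq : continuity_pt (fun m => m * m) l)
      by (apply continuity_pt_mul; apply continuity_pt_ident).
    destruct (Hsq (d * edist n y c)) as (d' & Hd' & H'); [now apply Rmult_lt_0_compat|].
    exists d'. split; auto. intros m Hm. specialize (H' m Hm). cbn in H' |- *. unfold Rdist in *.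
    apply H; [now apply pt_kpt|]. rewrite edist_kpt_kpt by exact Hp.
    apply Rmult_lt_reg_r with (edist n y c); auto. unfold Rdiv. rewrite Rmult_assoc, Rinv_l by lra. lra.
Qed.

Lemma jet_derivable f a b c : jet f a b c -> derivable_pt_lim f 0 b.
Proof.
  intros (g & Hg & _ & Hf) e He.
  assert (Hc : continuity_pt (fun t => t * g t) 0)
    by (apply continuity_pt_mul; [apply continuity_pt_ident | exact Hg]).
  destruct (Hc e He) as (d & Hd & H). exists (mkposreal d Hd). intros t Ht Htd. cbn in Htd.
  rewrite Rplus_0_l, !Hf.
  replace ((a + b * t + t * t * g t - (a + b * 0 + 0 * 0 * g 0)) / t - b) with (t * g t) by (field; exact Ht).
  specialize (H t). cbn in H. unfold Rdist in H. rewrite Rmult_0_l, !Rminus_0_r in H.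
  apply H. split; auto. split; [exact I | auto].
Qed.

Definition ray (c w : nat -> R) (t : R) : nat -> R := fun j => c j + t * w j.

Lemma derivable_ray n u D1 D2 c w t : C2data n u D1 D2 -> pt n w -> punct n (ray c w t) ->
  derivable_pt_lim (fun s => u (ray c w s)) t (rsum n (fun i => D1 i (ray c w t) * w i)).
Proof.
  intros HC Hw Hp.
  assert (Hj : forall j, (j < n)%nat -> jet (fun s => 0 + w j * s + 0 * (s * s)) 0 (w j) 0)
    by (intros; apply jet_poly).
  assert (HJ := jet_derivable _ _ _ _ (C2data_jet_curve n u D1 D2 _ _ _ _ HC Hp Hj)).
  assert (Hpt := proj1 Hp).
  intros e He. destruct (HJ e He) as (d & Hd). exists d. intros h Hh Hhd. specialize (Hd h Hh Hhd).
  assert (Htr : forall s, tr (ray c w t) (fun j => 0 + w j * s + 0 * (s * s)) n = ray c w (t + s)).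
  { intros s. extensionality j. unfold tr. destruct (Nat.ltb_spec j n) as [Hjn|Hjn].
    - unfold ray. ring.
    - unfold ray. rewrite (Hw j Hjn). ring. }
  rewrite !Htr, Rplus_0_l, Rplus_0_r in Hd. exact Hd.
Qed.

(* For a unit vector w, the derivative of t^(k/2) u(c + t w) is t^(k/2 - 1) times this quantity
   at x = c + t w; its positivity lets the sphere move. *)
Definition radial_growth (n k : nat) (c : nat -> R) (u : (nat -> R) -> R)
  (D1 : nat -> (nat -> R) -> R) (x : nat -> R) : R :=
  INR k / 2 * u x + rsum n (fun i => (x i - c i) * D1 i x).

Lemma cont_at_radial_growth n k c u D1 D2 x : C2data n u D1 D2 -> punct n x ->
  cont_at n (radial_growth n k c u D1) x.
Proof.
  intros (_ & _ & Hu & HD & _) Hx. apply cont_at_plus.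
  - apply cont_at_scal. now apply cont_punct_at.
  - apply (cont_at_rsum n n (fun i x => (x i - c i) * D1 i x)). intros i Hi. apply cont_at_mult.
    + apply (cont_at_plus n (fun y => y i) (fun _ => - c i)); [now apply cont_at_coord | apply cont_at_const].
    + apply cont_punct_at; auto.
Qed.

Lemma edist_ray n c w t : 0 <= t -> enorm n w = 1 -> edist n (ray c w t) c = t.
Proof.
  intros Ht Hw. unfold edist. replace (vsub (ray c w t) c) with (smul t w).
  - rewrite enorm_smul, Hw, Rabs_pos_eq; lra.
  - extensionality j. unfold smul, vsub, ray. ring.
Qed.

Lemma pt_ray n c w t : pt n c -> pt n w -> pt n (ray c w t).
Proof. intros Hc Hw j Hj. unfold ray. rewrite Hc, Hw by auto. ring. Qed.

Definition unit_dir (n : nat) (c y : nat -> R) : nat -> R := smul (/ edist n y c) (vsub y c).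

Lemma pt_unit_dir n c y : pt n c -> pt n y -> pt n (unit_dir n c y).
Proof. intros. apply pt_smul, pt_vsub; auto. Qed.

Lemma enorm_unit_dir n c y : 0 < edist n y c -> enorm n (unit_dir n c y) = 1.
Proof.
  intros H. unfold unit_dir. rewrite enorm_smul, Rabs_pos_eq.
  - fold (edist n y c). field. lra.
  - apply Rlt_le, Rinv_0_lt_compat, H.
Qed.

Lemma ray_unit_dir n c y : 0 < edist n y c -> ray c (unit_dir n c y) (edist n y c) = y.
Proof.
  intros H. extensionality j. unfold ray, unit_dir, smul. set (d := edist n y c) in *.
  unfold vsub. field. lra.
Qed.

Lemma kpt_ray n c l y : 0 < edist n y c ->
  kpt n c l y = ray c (unit_dir n c y) (l * l / edist n y c).
Proof.
  intros H. extensionality j. unfold kpt, ray, unit_dir, smul. rewrite sqsum_edist.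
  set (d := edist n y c) in *. unfold vsub. field. lra.
Qed.

(* x and its inverse point lie on one ray from c, so kel <= u there says that t^(k/2) u(c + t w) is
   larger at the outer point; the proof uses the square of that function to avoid half-integer powers. *)
Lemma kel_le_near n k c u D1 D2 r0 r1 m y : (1 <= k)%nat -> C2data n u D1 D2 ->
  (forall x, punct n x -> 0 < u x) -> punct n c -> 0 <= r0 -> r1 < enorm n c ->
  (forall x, pt n x -> r0 <= edist n x c <= r1 -> 0 < radial_growth n k c u D1 x) ->
  0 < m -> pt n y -> m <= edist n y c <= r1 -> r0 <= m * m / edist n y c ->
  kel n k c m u y <= u y.
Proof.
  intros Hk HC Hpos Hc Hr0 Hr1 Hg Hm Hy Hyr Hs.
  set (r := edist n y c) in *. set (s := m * m / r) in *.
  assert (Hr : 0 < r) by lra.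
  assert (Hs0 : 0 < s) by (apply Rdiv_lt_0_compat; nra).
  assert (Hsr : s <= r).
  { apply Rmult_le_reg_r with r; auto. unfold s, Rdiv. rewrite Rmult_assoc, Rinv_l by lra. nra. }
  set (w := unit_dir n c y).
  assert (Hw : pt n w) by (apply pt_unit_dir; auto; apply Hc).
  assert (Hw1 : enorm n w = 1) by (now apply enorm_unit_dir).
  assert (Hxp : forall t, s <= t <= r -> punct n (ray c w t)).
  { intros t Ht. apply (edist_lt_punct n c); [apply pt_ray; auto; apply Hc|]. rewrite edist_ray; lra. }
  set (f := fun t => t ^ k * (u (ray c w t) * u (ray c w t))).
  set (dU := fun t => rsum n (fun i => D1 i (ray c w t) * w i)).
  assert (Hf : forall t, s <= t <= r -> derivable_pt_lim f t
     (INR k * t ^ pred k * (u (ray c w t) * u (ray c w t)) +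
      t ^ k * (dU t * u (ray c w t) + u (ray c w t) * dU t))).
  { intros t Ht. apply (derivable_pt_lim_mult (fun t => t ^ k) (fun t => u (ray c w t) * u (ray c w t))).
    - apply derivable_pt_lim_pow.
    - apply (derivable_pt_lim_mult (fun t => u (ray c w t)) (fun t => u (ray c w t)));
        apply (derivable_ray n u D1 D2); auto. }
  assert (Hle : f s <= f r).
  { destruct Hsr as [Hsr|Hsr]; [|rewrite Hsr; lra].
    destruct (MVT_cor2 f _ s r Hsr Hf) as (t & Heq & Ht).
    assert (Hrg := Hg (ray c w t) (pt_ray n c w t (proj1 Hc) Hw) ltac:(rewrite edist_ray; lra)).
    assert (Hu := Hpos _ (Hxp t ltac:(lra))).
    unfold radial_growth in Hrg.
    rewrite (rsum_ext n _ (fun i => t * (D1 i (ray c w t) * w i))) in Hrg by (intros; unfold ray at 1; ring).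
    rewrite rsum_scal in Hrg. fold (dU t) in Hrg. set (U := u (ray c w t)) in *.
    replace (t ^ k) with (t * t ^ pred k) in Heq by (destruct k; [lia | reflexivity]).
    assert (Htk : 0 < t ^ pred k) by (apply pow_lt; lra).
    replace (INR k * t ^ pred k * (U * U) + t * t ^ pred k * (dU t * U + U * dU t)) with
      (2 * t ^ pred k * U * (INR k / 2 * U + t * dU t)) in Heq by field.
    assert (0 < 2 * t ^ pred k * U * (INR k / 2 * U + t * dU t) * (r - s)).
    { repeat apply Rmult_lt_0_compat; lra. }
    lra. }
  rewrite kel_eq, kpt_ray by exact Hr. fold r w s.
  replace (u y) with (u (ray c w r)) by (unfold w, r; now rewrite ray_unit_dir).
  assert (Hus := Hpos _ (Hxp s ltac:(lra))). assert (Hur := Hpos _ (Hxp r ltac:(lra))).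
  assert (Hrk : 0 < (/ r) ^ k) by now apply inv_pow_pos.
  apply Rsqr_incr_0_var; [|lra]. unfold Rsqr.
  replace (m ^ k * (/ r) ^ k * u (ray c w s) * (m ^ k * (/ r) ^ k * u (ray c w s))) with
    ((/ r) ^ k * f s).
  2:{ unfold f, s, Rdiv. rewrite !Rpow_mult_distr. ring. }
  replace (u (ray c w r) * u (ray c w r)) with ((/ r) ^ k * f r).
  2:{ unfold f. rewrite <- Rmult_assoc, <- Rpow_mult_distr, Rinv_l, pow1 by lra. ring. }
  apply Rmult_le_compat_l; lra.
Qed.

(** Both the gap and the transform scale like r^(-k): the transform is this power times [m ^ k] and
    a value of [u] in a compact ball of regular points. That product depends on [m] uniformly in
    [y], so a small increase of the radius costs at most c0 r^(-k), even near infinity. *)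
Lemma kel_le_far n k c u l rho c0 : (forall x, punct n x -> 0 < u x /\ cont_at n u x) ->
  punct n c -> 0 <= l < rho -> rho < enorm n c -> 0 < c0 ->
  (forall y, punct n y -> rho <= edist n y c -> c0 * (/ edist n y c) ^ k <= u y - kel n k c l u y) ->
  exists l', l < l' /\ forall m y, l <= m <= l' -> punct n y -> rho <= edist n y c ->
    kel n k c m u y <= u y.
Proof.
  intros Hu Hc Hl Hrho Hc0 Hw.
  assert (Hub : forall x, pt n x -> edist n x c <= rho -> punct n x).
  { intros x Hx Hxc. apply (edist_lt_punct n c); auto. lra. }
  destruct (bounded_on_ball n c rho u) as (B & HB & Hbd).
  { intros x Hx Hxc. apply Hu; auto. }
  assert (Hlk : 0 <= l ^ k) by (apply pow_le; lra).
  assert (He1 : 0 < c0 / (2 * (l ^ k + 1))) by (apply Rdiv_lt_0_compat; lra).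
  destruct (uniformly_continuous_on_ball n c rho u (c0 / (2 * (l ^ k + 1)))) as (d & Hd & Huc); auto.
  { intros x Hx Hxc. apply Hu; auto. }
  assert (C1 : continuity_pt (fun m => m ^ k) l) by (apply derivable_continuous_pt, derivable_pt_pow).
  assert (C2 : continuity_pt (fun m => m * m) l)
    by (apply continuity_pt_mul; apply continuity_pt_ident).
  (* Half of [c0] pays for the change of [m ^ k], where [u] is at most [B], and half for the change
     of [u] between the inverse points. These lie at distance |m^2 - l^2| / r, hence the tolerance
     [d * rho] for [m * m]. *)
  destruct (C1 (c0 / (2 * B))) as (d1 & Hd1 & H1); [apply Rdiv_lt_0_compat; lra|].
  destruct (C2 (d * rho)) as (d2 & Hd2 & H2); [apply Rmult_lt_0_compat; lra|].
  set (dd := Rmin (Rmin d1 d2) (rho - l)).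
  assert (Hdd : 0 < dd) by (repeat apply Rmin_glb_lt; lra).
  assert (Hdd1 : dd <= d1) by (eapply Rle_trans; [apply Rmin_l | apply Rmin_l]).
  assert (Hdd2 : dd <= d2) by (eapply Rle_trans; [apply Rmin_l | apply Rmin_r]).
  assert (Hdd3 : dd <= rho - l) by apply Rmin_r.
  exists (l + dd / 2). split; [lra|]. intros m y Hm Py Hy.
  destruct (Req_dec l m) as [<-|Hne].
  { assert (0 < (/ edist n y c) ^ k) by (apply inv_pow_pos; lra).
    specialize (Hw y Py Hy). assert (0 < c0 * (/ edist n y c) ^ k) by now apply Rmult_lt_0_compat. lra. }
  assert (Hml : Rabs (m - l) < dd) by (apply Rabs_def1; lra).
  assert (K1 : Rabs (m ^ k - l ^ k) < c0 / (2 * B)).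
  { apply H1. split; [split; [exact I | exact Hne]|]. cbn. unfold Rdist. lra. }
  assert (K2 : Rabs (m * m - l * l) < d * rho).
  { apply H2. split; [split; [exact I | exact Hne]|]. cbn. unfold Rdist. lra. }
  set (r := edist n y c) in *. assert (Hr : 0 < r) by lra.
  assert (Em : edist n (kpt n c m y) c <= rho).
  { eapply Rle_trans; [apply edist_kpt_le; fold r; lra | lra]. }
  assert (El : edist n (kpt n c l y) c <= rho).
  { eapply Rle_trans; [apply edist_kpt_le; fold r; lra | lra]. }
  assert (Pm : pt n (kpt n c m y)) by (apply pt_kpt; [apply Hc | apply Py]).
  assert (Pl : pt n (kpt n c l y)) by (apply pt_kpt; [apply Hc | apply Py]).
  assert (Ud : u (kpt n c m y) - u (kpt n c l y) <= c0 / (2 * (l ^ k + 1))).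
  { apply Huc; auto. rewrite edist_kpt_kpt by exact Hr. fold r.
    apply Rmult_lt_reg_r with r; auto. unfold Rdiv. rewrite Rmult_assoc, Rinv_l by lra. nra. }
  assert (Um : 0 < u (kpt n c m y) <= B) by (split; auto; apply Hu; auto).
  specialize (Hw y Py Hy). fold r in Hw. rewrite kel_eq in Hw |- *. fold r in Hw |- *.
  assert (Hrk : 0 < (/ r) ^ k) by now apply inv_pow_pos.
  assert (Hkey : m ^ k * u (kpt n c m y) <= l ^ k * u (kpt n c l y) + c0).
  { replace (m ^ k * u (kpt n c m y)) with
      ((m ^ k - l ^ k) * u (kpt n c m y) + l ^ k * (u (kpt n c m y) - u (kpt n c l y)) +
       l ^ k * u (kpt n c l y)) by ring.
    assert (T1 : (m ^ k - l ^ k) * u (kpt n c m y) <= c0 / 2).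
    { apply Rle_trans with (c0 / (2 * B) * B); [|right; field; lra].
      apply Rabs_def2 in K1. assert (0 < c0 / (2 * B)) by (apply Rdiv_lt_0_compat; lra). nra. }
    assert (T2 : l ^ k * (u (kpt n c m y) - u (kpt n c l y)) <= c0 / 2).
    { apply Rle_trans with (l ^ k * (c0 / (2 * (l ^ k + 1)))).
      - apply Rmult_le_compat_l; auto.
      - replace (c0 / 2) with ((l ^ k + 1) * (c0 / (2 * (l ^ k + 1)))) by (field; lra). nra. }
    lra. }
  apply Rmult_le_compat_l with (r := (/ r) ^ k) in Hkey; lra.
Qed.

(** On the sphere the gap is zero and gives no room, so the exterior is split. In a thin shell the
    transform stays below [u] because [radial_growth] is positive there; beyond it the lower bound
    of order r^(-k) leaves room uniformly. *)
Lemma sphere_step n k c u D1 D2 l : (1 <= k)%nat -> C2data n u D1 D2 ->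
  (forall x, punct n x -> 0 < u x) -> punct n c -> 0 <= l < enorm n c ->
  (forall x, pt n x -> edist n x c = l -> 0 < radial_growth n k c u D1 x) ->
  (forall eta, 0 < eta -> exists c0, 0 < c0 /\ forall y, punct n y -> l + eta <= edist n y c ->
     c0 * (/ edist n y c) ^ k <= u y - kel n k c l u y) ->
  exists l', l < l' /\ forall m y, l <= m <= l' -> punct n y -> m <= edist n y c ->
    0 < edist n y c -> kel n k c m u y <= u y.
Proof.
  intros Hk HC Hpos Hc Hl Hgr Hfar.
  assert (Hcont : forall x, punct n x -> cont_at n u x) by (intros; apply cont_punct_at; auto; apply HC).
  (* Positivity of [radial_growth] on the sphere spreads to a shell of uniform thickness; points off
     the sphere get neighbourhoods on which the condition is vacuous. *)
  destruct (closed_ball_cover n c (l + 1) (fun d x => Rabs (edist n x c - l) < d ->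
     0 < radial_growth n k c u D1 x)) as (d & Hd & Hnear).
  { intros d d' y Hd H Hy. apply H. lra. }
  { intros x Hx _. destruct (Req_dec (edist n x c) l) as [Hxl|Hxl].
    - assert (Px : punct n x) by (apply (edist_lt_punct n c); auto; lra).
      destruct (cont_at_eventually_gt n (radial_growth n k c u D1) x 0) as (d & Hd & H).
      + now apply (cont_at_radial_growth n k c u D1 D2).
      + now apply Hgr.
      + exists d. split; auto.
    - exists (Rabs (edist n x c - l) / 2).
      assert (Hp : 0 < Rabs (edist n x c - l)) by (apply Rabs_pos_lt; lra).
      split; [lra|]. intros y Hy _ Hyx Hyl. exfalso.
      assert (Ht := edist_diff_le n y x c).
      assert (Ht2 := Rabs_triang (edist n y c - l) (- (edist n y c - edist n x c))).
      rewrite Rabs_Ropp in Ht2.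
      replace (edist n y c - l + - (edist n y c - edist n x c)) with (edist n x c - l) in Ht2 by ring. lra. }
  set (eta := Rmin (Rmin d (enorm n c - l)) 1 / 2).
  assert (Heta : 0 < eta /\ eta < d /\ eta < enorm n c - l /\ eta < 1).
  { assert (Q1 := Rmin_l (Rmin d (enorm n c - l)) 1). assert (Q2 := Rmin_r (Rmin d (enorm n c - l)) 1).
    assert (Q3 := Rmin_l d (enorm n c - l)). assert (Q4 := Rmin_r d (enorm n c - l)).
    assert (0 < Rmin (Rmin d (enorm n c - l)) 1) by (repeat apply Rmin_glb_lt; lra).
    unfold eta. lra. }
  destruct (Hfar eta) as (c0 & Hc0 & Hw); [lra|].
  destruct (kel_le_far n k c u l (l + eta) c0) as (l1 & Hl1 & H1); auto; try lra.
  exists l1. split; auto. intros m y Hm Py Hmy Hyp.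
  destruct (Rle_dec (l + eta) (edist n y c)) as [Hr|Hr]; [now apply H1|].
  destruct (Req_dec m 0) as [->|Hm0].
  { rewrite kel_eq, pow_i by lia. rewrite Rmult_0_l, Rmult_0_l. apply Rlt_le, Hpos, Py. }
  set (r := edist n y c) in *.
  apply (kel_le_near n k c u D1 D2 (Rmax 0 (l - eta)) (l + eta)); auto.
  - apply Rmax_l.
  - lra.
  - intros x Hx Hxr. assert (Hmx := Rmax_r 0 (l - eta)). apply Hnear; auto; [lra|].
    apply Rabs_def1; lra.
  - lra.
  - apply Py.
  - fold r. lra.
  (* The inverse point stays in the shell: m >= l and r < l + eta give m^2 >= l^2 >= (l - eta) (l +
     eta) >= (l - eta) r when l >= eta; otherwise the bound is trivial. *)
  - fold r. apply Rmax_lub; [apply Rle_mult_inv_pos; nra|].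
    apply Rmult_le_reg_r with r; auto. unfold Rdiv. rewrite Rmult_assoc, Rinv_l by lra. nra.
Qed.

(** * Spheres for the system *)

Definition nonlin (mu beta q a b : R) : R :=
  mu * Rpower a (2 * q + 1) + beta * Rpower a q * Rpower b (q + 1).

Lemma Rpower_gt_0 a b : 0 < Rpower a b.
Proof. apply exp_pos. Qed.

Lemma nonlin_pos mu beta q a b : 0 < mu -> 0 < beta -> 0 < nonlin mu beta q a b.
Proof.
  intros Hm Hb. apply Rplus_lt_0_compat; repeat apply Rmult_lt_0_compat; auto; apply Rpower_gt_0.
Qed.

Lemma nonlin_mono mu beta q a b a' b' : 0 < mu -> 0 < beta -> 0 < q ->
  0 < a <= a' -> 0 < b <= b' -> nonlin mu beta q a b <= nonlin mu beta q a' b'.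
Proof.
  intros Hm Hb Hq Ha Hb'. unfold nonlin.
  assert (Rpower a (2 * q + 1) <= Rpower a' (2 * q + 1)) by (apply Rle_Rpower_l; lra).
  assert (Rpower a q <= Rpower a' q) by (apply Rle_Rpower_l; lra).
  assert (Rpower b (q + 1) <= Rpower b' (q + 1)) by (apply Rle_Rpower_l; lra).
  assert (P1 := Rpower_gt_0 a q). assert (P2 := Rpower_gt_0 b (q + 1)).
  apply Rplus_le_compat; [apply Rmult_le_compat_l; lra|].
  rewrite !Rmult_assoc. apply Rmult_le_compat_l; [lra|]. apply Rmult_le_compat; lra.
Qed.

Lemma nonlin_strict_mono mu beta q a b a' b' : 0 < mu -> 0 < beta -> 0 < q ->
  0 < a <= a' -> 0 < b <= b' -> a < a' \/ b < b' -> nonlin mu beta q a b < nonlin mu beta q a' b'.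
Proof.
  intros Hm Hb Hq Ha Hb' Hor. unfold nonlin.
  assert (Q1 : Rpower a (2 * q + 1) <= Rpower a' (2 * q + 1)) by (apply Rle_Rpower_l; lra).
  assert (Q2 : Rpower a q <= Rpower a' q) by (apply Rle_Rpower_l; lra).
  assert (Q3 : Rpower b (q + 1) <= Rpower b' (q + 1)) by (apply Rle_Rpower_l; lra).
  assert (P1 := Rpower_gt_0 a q). assert (P2 := Rpower_gt_0 b (q + 1)).
  rewrite !Rmult_assoc. destruct Hor as [H|H].
  - apply Rplus_lt_le_compat.
    + apply Rmult_lt_compat_l; auto. apply Rlt_Rpower_l; lra.
    + apply Rmult_le_compat_l; [lra|]. apply Rmult_le_compat; lra.
  - apply Rplus_le_lt_compat; [apply Rmult_le_compat_l; lra|].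
    apply Rmult_lt_compat_l; auto.
    assert (Rpower b (q + 1) < Rpower b' (q + 1)) by (apply Rlt_Rpower_l; lra). nra.
Qed.

Lemma nonlin_scale mu beta q t a b : 0 < t -> 0 < a -> 0 < b ->
  nonlin mu beta q (t * a) (t * b) = Rpower t (2 * q + 1) * nonlin mu beta q a b.
Proof.
  intros Ht Ha Hb. unfold nonlin. rewrite <- !Rpower_mult_distr by assumption.
  replace (Rpower t (2 * q + 1)) with (Rpower t q * Rpower t (q + 1)) at 2
    by (rewrite <- Rpower_plus; f_equal; ring).
  replace (Rpower t (2 * q + 1)) with (Rpower t q * Rpower t (q + 1))
    by (rewrite <- Rpower_plus; f_equal; ring). ring.
Qed.

(** This is where the exponent has to be at most critical. Homogeneity of degree 2q + 1 produces
    x^(k(2q + 1)), the conformal factor of [lapjet_kel] is x^(k + 4) with x = l / r <= 1, and k(2q +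
    1) <= k + 4 says exactly p <= (n + 2) / (n - 2). *)
Lemma nonlin_scale_le k mu beta q x a b : 0 < mu -> 0 < beta -> 0 < x <= 1 -> 0 < a -> 0 < b ->
  INR k * (2 * q + 1) <= INR k + 4 ->
  x ^ k * (x * x * (x * x)) * nonlin mu beta q a b <= nonlin mu beta q (x ^ k * a) (x ^ k * b).
Proof.
  intros Hmu Hbeta Hx Ha Hb Hq. rewrite nonlin_scale; auto; [|apply pow_lt; lra].
  apply Rmult_le_compat_r; [apply Rlt_le; now apply nonlin_pos|].
  replace (x ^ k * (x * x * (x * x))) with (x ^ (k + 4)) by (rewrite pow_add; simpl; ring).
  rewrite <- (Rpower_pow (k + 4)), <- (Rpower_pow k), Rpower_mult, plus_INR by lra.
  replace (INR 4) with 4 by (simpl; lra).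
  unfold Rpower. assert (Hln : ln x <= 0).
  { destruct (proj2 Hx) as [H|H]; [|subst; rewrite ln_1; lra].
    rewrite <- ln_1. apply Rlt_le, ln_increasing; lra. }
  assert (Hle : (INR k + 4) * ln x <= INR k * (2 * q + 1) * ln x) by nra.
  destruct Hle as [H|H]; [apply Rlt_le; now apply exp_increasing | rewrite H; lra].
Qed.

(** A difference written with [+ -1 *], so that [lapjet_plus], [lapjet_scal] and their continuity
    analogues apply directly. *)
Definition kgap (n k : nat) (c : nat -> R) (l : R) (u : (nat -> R) -> R) (y : nat -> R) : R :=
  u y + -1 * kel n k c l u y.

Definition solves (n : nat) (mu beta q : R) (u v : (nat -> R) -> R)
  (D2 : nat -> nat -> (nat -> R) -> R) : Prop :=
  forall x, punct n x -> - rsum n (fun i => D2 i i x) = nonlin mu beta q (u x) (v x).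

Lemma solves_superharmonic n mu beta q u v D1 D2 : 0 < mu -> 0 < beta -> C2data n u D1 D2 ->
  (forall x, punct n x -> 0 < u x) -> solves n mu beta q u v D2 -> superharmonic n u.
Proof.
  intros Hmu Hbeta HC Hu Hs y Py. split; [auto|]. split; [apply cont_punct_at; auto; apply HC|].
  exists (rsum n (fun i => D2 i i y)). split.
  - assert (H := Hs y Py). assert (P := nonlin_pos mu beta q (u y) (v y) Hmu Hbeta). lra.
  - now apply (lapjet_C2 n u D1 D2).
Qed.

(** With f the nonlinearity and U, V the values at the inverse point, the Laplacian of the gap is
    -f(u, v) + x^(k + 4) f(U, V). Scaling bounds this by -f(u, v) + f(x^k U, x^k V), and
    monotonicity in both arguments makes it non-positive. Strict monotonicity in each argument
    couples the components: a positive gap of either one makes the sign strict. *)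
Lemma kgap_superharmonic n k mu beta q u v D1 D2 c l y : INR n = INR k + 2 ->
  INR k * (2 * q + 1) <= INR k + 4 -> 0 < mu -> 0 < beta -> 0 < q ->
  C2data n u D1 D2 -> solves n mu beta q u v D2 -> (forall x, punct n x -> 0 < u x) ->
  (forall x, punct n x -> 0 < v x) -> punct n c -> 0 < l < enorm n c -> punct n y ->
  l <= edist n y c -> kel n k c l u y <= u y -> kel n k c l v y <= v y ->
  exists L, L <= 0 /\ lapjet n (kgap n k c l u) y L /\
    (kel n k c l u y < u y \/ kel n k c l v y < v y -> L < 0).
Proof.
  intros Hnk Hkq Hmu Hbeta Hq HC Hs Hu Hv Hc Hl Py Hy Hku Hkv.
  assert (Hr : 0 < edist n y c) by lra.
  assert (HK : punct n (kpt n c l y)) by (apply punct_kpt; try apply Hc; try apply Py; lra).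
  assert (Hss : 0 < sqsum n (vsub y c)) by (rewrite sqsum_edist; nra).
  assert (J1 := lapjet_C2 n u D1 D2 y HC Py).
  assert (J2 := lapjet_kel n k u D1 D2 c l y Hnk HC (proj1 Hc) (proj1 Py) Hss HK).
  rewrite sqsum_edist in J2. set (r := edist n y c) in *.
  set (x := l / r). set (X := kpt n c l y) in *.
  assert (Hx : 0 < x <= 1).
  { split; [apply Rdiv_lt_0_compat; lra|]. apply Rmult_le_reg_r with r; auto.
    unfold x, Rdiv. rewrite Rmult_assoc, Rinv_l by lra. lra. }
  assert (Hxk : l ^ k * (/ r) ^ k = x ^ k) by (unfold x, Rdiv; now rewrite Rpow_mult_distr).
  assert (Hfac : l ^ k * E k (r * r) * (l * l * (l * l) / (r * r * (r * r))) = x ^ k * (x * x * (x * x))).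
  { rewrite <- Hxk. unfold E. rewrite sqrt_square by lra. unfold x. field. lra. }
  rewrite Hfac in J2.
  rewrite !kel_eq in *. fold r X in Hku, Hkv |- *. rewrite Hxk in *.
  assert (Su := Hs y Py). assert (SX := Hs X HK).
  assert (PuX := Hu X HK). assert (PvX := Hv X HK).
  assert (Hxkp : 0 < x ^ k) by (apply pow_lt; lra).
  assert (Sc := nonlin_scale_le k mu beta q x (u X) (v X) Hmu Hbeta Hx PuX PvX Hkq).
  assert (Ha : 0 < x ^ k * u X) by now apply Rmult_lt_0_compat.
  assert (Hb : 0 < x ^ k * v X) by now apply Rmult_lt_0_compat.
  assert (Mo := nonlin_mono mu beta q _ _ (u y) (v y) Hmu Hbeta Hq (conj Ha Hku) (conj Hb Hkv)).
  eexists. split; [|split; [apply lapjet_plus; [exact J1 | apply lapjet_scal; exact J2]|]].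
  - rewrite <- SX in Sc. lra.
  - intros Hor. rewrite <- SX in Sc.
    assert (St := nonlin_strict_mono mu beta q _ _ (u y) (v y) Hmu Hbeta Hq (conj Ha Hku) (conj Hb Hkv) Hor).
    lra.
Qed.

Definition singular (n : nat) (u : (nat -> R) -> R) : Prop :=
  forall M delta, 0 < delta -> exists x, punct n x /\ enorm n x < delta /\ M < u x.

Lemma singular_exceeds_kel n k c l u : (1 <= k)%nat ->
  (forall x, punct n x -> 0 < u x /\ cont_at n u x) -> punct n c -> 0 < l < enorm n c ->
  singular n u -> exists a, punct n a /\ l < edist n a c /\ kel n k c l u a < u a.
Proof.
  intros Hk Hu Hc Hl Hsing.
  destruct (bounded_on_ball n c l u) as (B & HB & Hb).
  { intros x Hx Hxc. apply Hu, (edist_lt_punct n c); auto. lra. }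
  (* A point this close to the origin lies outside the sphere, and its transform is at most (l /
     r)^k B, hence at most [B]. *)
  destruct (Hsing B (enorm n c - l)) as (a & Pa & Ha & HBa); [lra|].
  assert (Hac : l < edist n a c).
  { assert (Ht := edist_triang n c a origin). rewrite !edist_origin, edist_sym in Ht. lra. }
  exists a. repeat split; try apply Pa; auto. rewrite kel_eq, <- Rpow_mult_distr.
  set (x := l * / edist n a c).
  assert (Hx : 0 <= x <= 1).
  { split; [apply Rle_mult_inv_pos; lra|]. apply Rmult_le_reg_r with (edist n a c); [lra|].
    unfold x. rewrite Rmult_assoc, Rinv_l by lra. lra. }
  assert (Hx1 : x ^ k <= 1) by (rewrite <- (pow1 k); now apply pow_incr).
  assert (Hx0 : 0 <= x ^ k) by (now apply pow_le).
  assert (HK : punct n (kpt n c l a)) by (apply punct_kpt; try apply Hc; try apply Pa; lra).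
  assert (H1 : u (kpt n c l a) <= B).
  { apply Hb; [apply HK|]. apply edist_kpt_le; lra. }
  assert (H2 := proj1 (Hu _ HK)). nra.
Qed.

Lemma right_derivative_nonneg G l d tau : derivable_pt_lim G l d -> G l = 0 -> 0 < tau ->
  (forall t, l < t < l + tau -> 0 <= G t) -> 0 <= d.
Proof.
  intros HG H0 Ht Hpos. apply Rnot_lt_le. intros Hd.
  destruct (HG (- d)) as (e & He); [lra|].
  set (h := Rmin e tau / 2).
  assert (Hm : 0 < Rmin e tau) by (apply Rmin_glb_lt; [apply cond_pos | exact Ht]).
  assert (Hm1 := Rmin_l e tau). assert (Hm2 := Rmin_r e tau).
  assert (Hh : 0 < h) by (unfold h; lra).
  specialize (He h ltac:(lra)). rewrite H0, Rminus_0_r in He.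
  assert (Hq : Rabs (G (l + h) / h - d) < - d) by (apply He; rewrite Rabs_pos_eq; unfold h; lra).
  apply Rabs_def2 in Hq.
  assert (0 <= G (l + h) / h); [|lra].
  apply Rle_mult_inv_pos; auto. apply Hpos. unfold h. lra.
Qed.

(* Hopf's lemma: both sides of the bound vanish on the sphere, so their normal derivatives compare. *)
Lemma radial_growth_pos n k c u D1 D2 l c0 : (1 <= k)%nat -> C2data n u D1 D2 -> punct n c ->
  0 < l < enorm n c -> 0 < c0 ->
  (forall y, punct n y -> l <= edist n y c ->
    c0 * (/ edist n y c) ^ k * (1 - l * l / (edist n y c * edist n y c)) <= kgap n k c l u y) ->
  forall x, pt n x -> edist n x c = l -> 0 < radial_growth n k c u D1 x.
Proof.
  intros Hk HC Hc Hl Hc0 Hw x Hx Hxl.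
  set (w := unit_dir n c x).
  assert (Hp : 0 < edist n x c) by lra.
  assert (Hw1 : enorm n w = 1) by (now apply enorm_unit_dir).
  assert (Hwp : pt n w) by (apply pt_unit_dir; auto; apply Hc).
  assert (Hxr : ray c w l = x) by (rewrite <- Hxl; now apply ray_unit_dir).
  assert (Hray : forall t, 0 <= t < enorm n c -> punct n (ray c w t)).
  { intros t Ht. apply (edist_lt_punct n c); [apply pt_ray; auto; apply Hc|]. rewrite edist_ray; lra. }
  set (U := fun t => u (ray c w t)). set (dU := rsum n (fun i => D1 i x * w i)).
  set (g := fun t => l * l / t).
  assert (Hgl : g l = l) by (unfold g; field; lra).
  assert (DU : derivable_pt_lim U l dU).
  { unfold dU. rewrite <- Hxr. apply (derivable_ray n u D1 D2); auto. apply Hray. lra. }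
  assert (Dg : derivable_pt_lim g l (-1)).
  { replace (-1) with ((0 * l - 1 * (l * l)) / Rsqr l) by (unfold Rsqr; field; lra).
    apply (derivable_pt_lim_div (fun _ => l * l) (fun t => t)).
    - apply derivable_pt_lim_const.
    - apply derivable_pt_lim_id.
    - lra. }
  assert (DUg : derivable_pt_lim (fun t => U (g t)) l (dU * -1)).
  { apply (derivable_pt_lim_comp g U); auto. now rewrite Hgl. }
  (* [G] is t^k times the gap minus its lower bound, along the ray through [x]; [g t] is the radius
     of the inverse point. [G] vanishes at [l] and is non-negative beyond, and its derivative at [l]
     is 2 l^(k - 1) times [radial_growth] at [x], minus 2 c0 / l. *)
  set (G := fun t => t ^ k * U t - l ^ k * U (g t) - c0 * (1 - / (l * l) * (g t * g t))).
  assert (DG : derivable_pt_lim G l ((INR k * l ^ pred k * U l + l ^ k * dU) - l ^ k * (dU * -1) -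
     c0 * (0 - / (l * l) * (-1 * g l + g l * -1)))).
  { apply (derivable_pt_lim_minus (fun t => t ^ k * U t - l ^ k * U (g t))).
    - apply (derivable_pt_lim_minus (fun t => t ^ k * U t)).
      + apply (derivable_pt_lim_mult (fun t => t ^ k)); auto. apply derivable_pt_lim_pow.
      + apply (derivable_pt_lim_scal (fun t => U (g t))); auto.
    - apply (derivable_pt_lim_scal (fun t => 1 - / (l * l) * (g t * g t))).
      apply (derivable_pt_lim_minus (fun _ => 1)); [apply derivable_pt_lim_const|].
      apply (derivable_pt_lim_scal (fun t => g t * g t)). now apply derivable_pt_lim_mult. }
  rewrite Hgl in DG. apply right_derivative_nonneg with (tau := enorm n c - l) in DG.
  - unfold radial_growth.
    assert (Hsum : rsum n (fun i => (x i - c i) * D1 i x) = l * dU).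
    { unfold dU. rewrite <- rsum_scal. apply rsum_ext. intros i _. unfold w, unit_dir, smul.
      rewrite Hxl. unfold vsub. field. lra. }
    rewrite Hsum. replace (u x) with (U l) by (unfold U; now rewrite Hxr).
    replace (l ^ k) with (l * l ^ pred k) in DG by (destruct k; [lia | reflexivity]).
    assert (Hlk : 0 < l ^ pred k) by (apply pow_lt; lra).
    replace (INR k * l ^ pred k * U l + l * l ^ pred k * dU - l * l ^ pred k * (dU * -1) -
      c0 * (0 - / (l * l) * (-1 * l + l * -1))) with
      (2 * l ^ pred k * (INR k / 2 * U l + l * dU) - 2 * c0 / l) in DG by (field; lra).
    assert (0 < 2 * c0 / l) by (apply Rdiv_lt_0_compat; lra).
    apply Rmult_lt_reg_l with (2 * l ^ pred k); [lra|]. lra.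
  - unfold G. rewrite Hgl. field. lra.
  - lra.
  - intros t Ht. assert (Pt := Hray t ltac:(lra)).
    assert (Et : edist n (ray c w t) c = t) by (apply edist_ray; auto; lra).
    specialize (Hw (ray c w t) Pt ltac:(rewrite Et; lra)). unfold kgap in Hw.
    rewrite kel_eq, kpt_ray, Et in Hw by (rewrite Et; lra).
    replace (unit_dir n c (ray c w t)) with w in Hw.
    2:{ extensionality j. unfold unit_dir at 1, smul. rewrite Et. unfold vsub, ray. field. lra. }
    fold (U t) (g t) in Hw. fold (U (g t)) in Hw.
    apply Rmult_le_compat_l with (r := t ^ k) in Hw; [|apply pow_le; lra].
    assert (Htk : t ^ k * (/ t) ^ k = 1) by (rewrite <- Rpow_mult_distr, Rinv_r by lra; apply pow1).
    replace (t ^ k * (c0 * (/ t) ^ k * (1 - l * l / (t * t)))) with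
      ((t ^ k * (/ t) ^ k) * (c0 * (1 - l * l / (t * t)))) in Hw by ring.
    replace (t ^ k * (U t + -1 * (l ^ k * (/ t) ^ k * U (g t)))) with
      (t ^ k * U t - (t ^ k * (/ t) ^ k) * (l ^ k * U (g t))) in Hw by ring.
    rewrite Htk in Hw. unfold G.
    replace (/ (l * l) * (g t * g t)) with (l * l / (t * t)) by (unfold g; field; lra). lra.
Qed.

Lemma kgap_far n k c u l c0 : 0 < l -> 0 < c0 ->
  (forall y, punct n y -> l <= edist n y c ->
    c0 * (/ edist n y c) ^ k * (1 - l * l / (edist n y c * edist n y c)) <= kgap n k c l u y) ->
  forall eta, 0 < eta -> exists c1, 0 < c1 /\ forall y, punct n y -> l + eta <= edist n y c ->
    c1 * (/ edist n y c) ^ k <= u y - kel n k c l u y.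
Proof.
  intros Hl Hc0 Hw eta Heta. set (rho := l + eta).
  exists (c0 * (1 - l * l / (rho * rho))).
  assert (Hrho : 0 < rho) by (unfold rho; lra).
  split.
  - apply Rmult_lt_0_compat; auto. assert (l * l / (rho * rho) < 1); [|lra].
    apply Rmult_lt_reg_r with (rho * rho); [nra|]. unfold Rdiv. rewrite Rmult_assoc, Rinv_l by nra.
    assert (l < rho) by (unfold rho; lra). nra.
  - intros y Py Hy. fold rho in Hy. assert (Hlr : l < rho) by (unfold rho; lra).
    specialize (Hw y Py ltac:(lra)). unfold kgap in Hw.
    set (r := edist n y c) in *. assert (0 < (/ r) ^ k) by (apply inv_pow_pos; lra).
    apply Rle_trans with (c0 * (/ r) ^ k * (1 - l * l / (r * r))); [|lra].
    replace (c0 * (1 - l * l / (rho * rho)) * (/ r) ^ k) with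
      (c0 * (/ r) ^ k * (1 - l * l / (rho * rho))) by ring.
    apply Rmult_le_compat_l; [apply Rlt_le; now apply Rmult_lt_0_compat|].
    assert (l * l / (r * r) <= l * l / (rho * rho)); [|lra].
    apply Rmult_le_compat_l; [nra|]. apply Rinv_le_contravar; nra.
Qed.

(* The radius m = 0 is allowed: there kel = 0, which makes it the trivial starting point. *)
Definition dominates (n k : nat) (c : nat -> R) (u : (nat -> R) -> R) (l : R) : Prop :=
  forall m y, 0 <= m <= l -> punct n y -> m <= edist n y c -> 0 < edist n y c ->
    kel n k c m u y <= u y.

Lemma cont_at_kgap n k c l u y : (forall x, punct n x -> cont_at n u x) -> punct n c ->
  0 < l < enorm n c -> punct n y -> l <= edist n y c -> cont_at n (kgap n k c l u) y.
Proof.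
  intros Hu Hc Hl Py Hy. apply cont_at_plus; auto. apply cont_at_scal.
  apply cont_at_kel; [apply Hc | lra |]. apply Hu, punct_kpt; try apply Hc; try apply Py; lra.
Qed.

(** The bound produced by [exterior_lower_bound]. Its slope on the sphere feeds [radial_growth_pos],
    its decay feeds [kgap_far]. *)
Definition strictly_dominates (n k : nat) (c : nat -> R) (u : (nat -> R) -> R) (l : R) : Prop :=
  exists c0, 0 < c0 /\ forall y, punct n y -> l <= edist n y c ->
    c0 * (/ edist n y c) ^ k * (1 - l * l / (edist n y c * edist n y c)) <= kgap n k c l u y.

(* If the gap of v is positive at a, then the gap of u is strictly superharmonic at a, so a cannot be a
   zero minimum of it: a singularity of one component is felt by both. *)
Lemma dominates_strictly n k mu beta q u v D1 D2 c l a : INR n = INR k + 2 -> (1 <= k)%nat ->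
  INR k * (2 * q + 1) <= INR k + 4 -> 0 < mu -> 0 < beta -> 0 < q ->
  C2data n u D1 D2 -> solves n mu beta q u v D2 -> (forall x, punct n x -> 0 < u x) ->
  (forall x, punct n x -> 0 < v x) -> punct n c -> 0 < l < enorm n c ->
  dominates n k c u l -> dominates n k c v l ->
  punct n a -> l < edist n a c -> kel n k c l u a < u a \/ kel n k c l v a < v a ->
  kel n k c l u a < u a /\ strictly_dominates n k c u l.
Proof.
  intros Hnk Hk Hkq Hmu Hbeta Hq HC Hs Hu Hv Hc Hl Du Dv Pa Ha Hor.
  assert (Hcont : forall x, punct n x -> cont_at n u x) by (intros; apply cont_punct_at; auto; apply HC).
  assert (Hdu : forall y, punct n y -> l <= edist n y c -> kel n k c l u y <= u y)
    by (intros y P Q; apply Du; auto; lra).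
  assert (Hdv : forall y, punct n y -> l <= edist n y c -> kel n k c l v y <= v y)
    by (intros y P Q; apply Dv; auto; lra).
  assert (Hlap : forall y, punct n y -> l <= edist n y c ->
    exists L, L <= 0 /\ lapjet n (kgap n k c l u) y L /\
      (kel n k c l u y < u y \/ kel n k c l v y < v y -> L < 0)).
  { intros y P Q. apply (kgap_superharmonic n k mu beta q u v D1 D2); auto. }
  assert (Hua : kel n k c l u a < u a).
  { destruct (Hdu a Pa ltac:(lra)) as [H|H]; auto. exfalso.
    destruct (Hlap a Pa ltac:(lra)) as (L & _ & HJ & HL). specialize (HL Hor).
    assert (0 <= L); [|lra].
    destruct (punct_nbhd n a Pa) as (d & Hd & Hnb).
    set (d' := Rmin d (edist n a c - l)).
    assert (Hd' : 0 < d') by (apply Rmin_glb_lt; lra).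
    assert (Hn := pos_INR n).
    assert (Hdn : 0 < d' / (INR n + 1)) by (apply Rdiv_lt_0_compat; lra).
    apply (lapjet_min_nonneg n _ a L (d' / (INR n + 1)) HJ Hdn).
    intros i t Hi Ht.
    assert (Hsh : edist n (shift a i t) a < d').
    { eapply Rle_lt_trans; [now apply edist_shift|].
      replace d' with ((INR n + 1) * (d' / (INR n + 1))) by (field; lra).
      assert (0 <= Rabs t) by apply Rabs_pos. nra. }
    assert (Q1 := Rmin_l d (edist n a c - l)). assert (Q2 := Rmin_r d (edist n a c - l)).
    fold d' in Q1, Q2.
    assert (Ps : punct n (shift a i t)) by (apply Hnb; [apply pt_shift; auto; apply Pa | lra]).
    assert (Ht2 := edist_triang n a (shift a i t) c). rewrite (edist_sym n a (shift a i t)) in Ht2.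
    specialize (Hdu (shift a i t) Ps ltac:(lra)). unfold kgap. lra. }
  split; auto.
  (* The solution [u] itself is the strictly superharmonic barrier. *)
  apply (exterior_lower_bound n k c l a (kgap n k c l u) u); auto; try apply Hc; try apply Pa; try lra.
  - unfold kgap. lra.
  - now apply (solves_superharmonic n mu beta q u v D1 D2).
  - intros y P Q. specialize (Hdu y P Q). unfold kgap. lra.
  - intros y P Q. now apply cont_at_kgap.
  - intros y P Q. destruct (Hlap y P ltac:(lra)) as (L & H1 & H2 & _). eauto.
  - apply cont_at_kgap; auto; lra.
Qed.

(** Radius 0 fits the same scheme: the sphere is the point [c], where [radial_growth] equals k / 2
    times [u c], and the gap is [u], whose decay comes from [superharmonic_lower_bound]. *)
Lemma dominates_step n k mu beta q u v D1 D2 c l : INR n = INR k + 2 -> (1 <= k)%nat ->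
  0 < mu -> 0 < beta -> C2data n u D1 D2 -> solves n mu beta q u v D2 ->
  (forall x, punct n x -> 0 < u x) -> punct n c -> 0 <= l < enorm n c ->
  dominates n k c u l -> (0 < l -> strictly_dominates n k c u l) ->
  exists l', l < l' /\ dominates n k c u l'.
Proof.
  intros Hnk Hk Hmu Hbeta HC Hs Hu Hc Hl Du Hst.
  destruct (sphere_step n k c u D1 D2 l) as (l' & Hl' & H); auto.
  - intros x Hx Hxl. destruct (Rle_lt_or_eq_dec 0 l (proj1 Hl)) as [Hl0|Hl0].
    + destruct (Hst Hl0) as (c0 & Hc0 & Hw).
      apply (radial_growth_pos n k c u D1 D2 l c0); auto. lra.
    + rewrite <- Hl0 in Hxl. assert (E : x = c).
      { apply NNPP. intros Hne. assert (P := edist_pos n x c Hx (proj1 Hc) Hne). lra. }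
      subst x. unfold radial_growth. rewrite rsum_zero by (intros; ring).
      assert (P := Hu c Hc). assert (0 < INR k) by (apply lt_0_INR; lia). nra.
  - intros eta Heta. destruct (Rle_lt_or_eq_dec 0 l (proj1 Hl)) as [Hl0|Hl0].
    + destruct (Hst Hl0) as (c0 & Hc0 & Hw). now apply (kgap_far n k c u l c0).
    + rewrite <- Hl0, Rplus_0_l.
      destruct (superharmonic_lower_bound n k c u eta Hnk Hk Hc) as (c0 & Hc0 & Hw); auto.
      * now apply (solves_superharmonic n mu beta q u v D1 D2).
      * exists c0. split; auto. intros y Py Hy. rewrite kel_eq, pow_i by lia.
        specialize (Hw y Py Hy). lra.
  - exists l'. split; auto. intros m y Hm Py Hy Hp.
    destruct (Rle_dec m l); [apply Du; auto; lra | apply H; auto; lra].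
Qed.

(** At a fixed point the transform is continuous in the radius, and smaller radii keep the point
    outside their spheres. *)
Lemma dominates_limit n k c u l : (1 <= k)%nat -> (forall x, punct n x -> 0 < u x /\ cont_at n u x) ->
  punct n c -> 0 <= l < enorm n c -> (forall l', 0 <= l' < l -> dominates n k c u l') ->
  dominates n k c u l.
Proof.
  intros Hk Hu Hc Hl H m y Hm Py Hy Hp.
  destruct (Req_dec m 0) as [->|Hm0].
  { rewrite kel_eq, pow_i, !Rmult_0_l by lia. now apply Rlt_le, Hu. }
  apply Rnot_lt_le. intros Hlt.
  assert (HK : punct n (kpt n c m y)) by (apply punct_kpt; try apply Hc; try apply Py; lra).
  destruct (continuity_kel_radius n k c m u y (proj1 Hc) (proj1 Py) Hp (proj2 (Hu _ HK))
    (kel n k c m u y - u y)) as (d & Hd & Hcd); [lra|].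
  set (m' := Rmax (m / 2) (m - d / 2)).
  assert (Hm' : 0 <= m' < m) by (unfold m', Rmax; destruct Rle_dec; lra).
  assert (Hmd : m - d / 2 <= m') by apply Rmax_r.
  assert (Hk' : kel n k c m' u y <= u y) by (apply (H m'); auto; lra).
  assert (Hc2 : Rabs (kel n k c m' u y - kel n k c m u y) < kel n k c m u y - u y).
  { apply Hcd. split; [split; [exact I | lra]|]. cbn. unfold Rdist. apply Rabs_def1; lra. }
  apply Rabs_def2 in Hc2. lra.
Qed.

(** The continuity method: the good radii form an interval that is closed by [dominates_limit] and
    can be prolonged by [dominates_step]. Both components must move together, since the
    superharmonicity of either gap uses the sign of both. *)
Lemma dominates_all n k mu1 mu2 beta q u v D1 D2 D1' D2' c : INR n = INR k + 2 -> (1 <= k)%nat ->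
  INR k * (2 * q + 1) <= INR k + 4 -> 0 < mu1 -> 0 < mu2 -> 0 < beta -> 0 < q ->
  C2data n u D1 D2 -> C2data n v D1' D2' ->
  solves n mu1 beta q u v D2 -> solves n mu2 beta q v u D2' ->
  (forall x, punct n x -> 0 < u x) -> (forall x, punct n x -> 0 < v x) ->
  singular n u \/ singular n v -> punct n c ->
  forall l, 0 <= l < enorm n c -> dominates n k c u l /\ dominates n k c v l.
Proof.
  intros Hnk Hk Hkq Hmu1 Hmu2 Hbeta Hq HCu HCv Su Sv Hu Hv Hsing Hc l1 Hl1.
  assert (Cu : forall x, punct n x -> 0 < u x /\ cont_at n u x)
    by (intros; split; auto; apply cont_punct_at; auto; apply HCu).
  assert (Cv : forall x, punct n x -> 0 < v x /\ cont_at n v x)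
    by (intros; split; auto; apply cont_punct_at; auto; apply HCv).
  set (good := fun l => dominates n k c u l /\ dominates n k c v l).
  assert (Hmono : forall l l', l' <= l -> good l -> good l').
  { intros l l' Hl [H1 H2]. split; intros m y Hm Py Hy Hp; [apply H1 | apply H2]; auto; lra. }
  assert (Hlim : forall l, 0 <= l < enorm n c -> (forall l', 0 <= l' < l -> good l') -> good l).
  { intros l Hl H. split; apply dominates_limit; auto; intros l' Hl'; now apply H. }
  assert (Hext : forall l, 0 <= l < enorm n c -> good l -> exists l', l < l' /\ good l').
  { intros l Hl [Gu Gv].
    assert (Hst : 0 < l -> strictly_dominates n k c u l /\ strictly_dominates n k c v l).
    { intros Hl0.
      assert (Ha : exists a, punct n a /\ l < edist n a c /\
                (kel n k c l u a < u a \/ kel n k c l v a < v a)).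
      { destruct Hsing as [Hs|Hs];
          [destruct (singular_exceeds_kel n k c l u) as (a & P & Q & T)
          |destruct (singular_exceeds_kel n k c l v) as (a & P & Q & T)];
          auto; try lra; exists a; auto. }
      destruct Ha as (a & Pa & Ha & Hor). split.
      - apply (dominates_strictly n k mu1 beta q u v D1 D2 c l a); auto. lra.
      - apply (dominates_strictly n k mu2 beta q v u D1' D2' c l a); auto; [lra|tauto]. }
    destruct (dominates_step n k mu1 beta q u v D1 D2 c l) as (lu & Hlu & Du); auto; [apply Hst|].
    destruct (dominates_step n k mu2 beta q v u D1' D2' c l) as (lv & Hlv & Dv); auto; [apply Hst|].
    exists (Rmin lu lv). split; [now apply Rmin_glb_lt|].
    assert (Q1 := Rmin_l lu lv). assert (Q2 := Rmin_r lu lv).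
    split; intros m y Hm Py Hy Hp; [apply Du | apply Dv]; auto; lra. }
  fold (good l1).
  destruct (completeness (fun l => 0 <= l <= l1 /\ good l)) as [s [Hub Hlub]].
  { exists l1. intros l [Hl _]. lra. }
  (* Radius 0 is good by the limit property, as there are no smaller radii to check. *)
  { exists 0. split; [lra|]. apply Hlim; [lra | intros; lra]. }
  assert (Hs1 : s <= l1) by (apply Hlub; intros l [Hl _]; lra).
  assert (Hs0 : 0 <= s).
  { apply Hub. split; [lra|]. apply Hlim; [lra | intros; lra]. }
  assert (Gs : good s).
  { apply Hlim; [lra|]. intros l' Hl'. apply NNPP. intros Hn.
    assert (s <= l'); [|lra]. apply Hlub. intros l [Hl Gl]. apply Rnot_lt_le. intros Hlt.
    apply Hn, (Hmono l); auto. lra. }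
  destruct Hs1 as [Hs1|<-]; auto.
  destruct (Hext s ltac:(lra) Gs) as (l' & Hl' & Gl').
  assert (Hle : Rmin l' l1 <= s).
  { apply Hub. assert (Q1 := Rmin_l l' l1). assert (Q2 := Rmin_r l' l1).
    assert (s < Rmin l' l1) by (apply Rmin_glb_lt; auto).
    split; [lra|]. now apply (Hmono l'). }
  assert (s < Rmin l' l1) by (apply Rmin_glb_lt; auto). lra.
Qed.

(** * Symmetry and monotonicity *)

Lemma bernoulli_lower k t : 0 <= t <= 1 -> 1 - INR k * t <= (1 - t) ^ k.
Proof.
  intros Ht. induction k as [|k IH]; [simpl; lra|].
  rewrite S_INR. simpl pow. assert (0 <= INR k) by apply pos_INR.
  destruct (Rle_dec 0 (1 - INR k * t)) as [H1|H1].
  - assert (0 <= INR k * (t * t)) by (apply Rmult_le_pos; nra). nra.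
  - assert (0 <= (1 - t) ^ k) by (apply pow_le; lra). nra.
Qed.

(* Inversion in the sphere with centre c = x + s (y - x) and radius |y - x| sqrt (s (s - 1)) swaps x
   and y; that radius is less than |c| because |x| <= |y|. Then let s tend to infinity. *)
Lemma dominates_antitone n k u x y : (forall z, punct n z -> 0 < u z) ->
  (forall c l, punct n c -> 0 <= l < enorm n c -> dominates n k c u l) ->
  punct n x -> punct n y -> enorm n x <= enorm n y -> u y <= u x.
Proof.
  intros Hu Hdom Px Py Hxy.
  destruct (classic (x = y)) as [->|Hne]; [lra|].
  assert (Hd : 0 < edist n y x) by (apply edist_pos; [apply Py | apply Px | auto]).
  set (d := edist n y x) in *.
  (* The inversion gives the factor (1 - 1/s)^(k/2); the smaller (1 - 1/s)^k also tends to 1 and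
     avoids half-integer powers. *)
  assert (Hs : forall s, 1 < s -> (1 - / s) ^ k * u y <= u x).
  { intros s Hs. set (c := vadd x (smul s (vsub y x))). set (l := sqrt (s * (s - 1)) * d).
    assert (Hss : 0 < s * (s - 1)) by nra.
    assert (Hsq := sqrt_lt_R0 _ Hss). assert (Hsqq := sqrt_sqrt _ (Rlt_le _ _ Hss)).
    set (sq := sqrt (s * (s - 1))) in *.
    assert (Hl : 0 < l) by now apply Rmult_lt_0_compat.
    assert (Hc : pt n c) by (apply pt_vadd; [apply Px | apply pt_smul, pt_vsub; [apply Py | apply Px]]).
    assert (Hlc : l < enorm n c).
    (* The computation yields |c|^2 - l^2 = |x|^2 + s (|y|^2 - |x|^2), which is at least |x|^2 >
       0. *)
    { apply Rsqr_incrst_0; [|lra|apply enorm_nonneg]. unfold Rsqr. rewrite enorm_sq.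
      assert (Hn1 : sqsum n c = sqsum n x + 2 * s * dot n x (vsub y x) + s * s * (d * d)).
      { unfold d. rewrite <- sqsum_edist.
        replace c with (vsub x (smul (- s) (vsub y x)))
          by (extensionality j; unfold c, vadd, smul, vsub; ring).
        rewrite sqsum_vsub_smul. ring. }
      assert (Hn2 : sqsum n y = sqsum n x + 2 * dot n x (vsub y x) + d * d).
      { unfold d. rewrite <- sqsum_edist.
        replace y with (vsub x (smul (-1) (vsub y x))) at 1
          by (extensionality j; unfold smul, vsub; ring).
        rewrite sqsum_vsub_smul. ring. }
      assert (Hx := enorm_sq n x). assert (Hy := enorm_sq n y).
      assert (Hxp := proj2 Px).
      assert (0 < enorm n x * enorm n x) by nra.
      assert (enorm n x * enorm n x <= enorm n y * enorm n y) by nra.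
      rewrite Hn1. unfold l. replace (sq * d * (sq * d)) with (sq * sq * (d * d)) by ring.
      rewrite Hsqq. nra. }
    assert (Pc : punct n c) by (split; auto; lra).
    assert (Hxc : edist n x c = s * d).
    { rewrite edist_sym. unfold edist at 1. replace (vsub c x) with (smul s (vsub y x)).
      - rewrite enorm_smul, Rabs_pos_eq by lra. reflexivity.
      - extensionality j. unfold c, vadd, smul, vsub. ring. }
    assert (Hsqs : sq <= s) by nra.
    assert (Hsqs' : s - 1 <= sq) by nra.
    assert (Hsd : 0 < s * d) by nra.
    assert (HD : kel n k c l u x <= u x).
    { apply (Hdom c l Pc); auto; try lra. rewrite Hxc. unfold l. nra. }
    rewrite kel_eq, Hxc, <- Rpow_mult_distr in HD.
    replace (kpt n c l x) with y in HD.
    2:{ extensionality j. unfold kpt. rewrite sqsum_edist, Hxc. unfold l.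
        replace (sq * d * (sq * d)) with (sq * sq * (d * d)) by ring. rewrite Hsqq.
        unfold c, vadd, smul, vsub. field. lra. }
    eapply Rle_trans; [|exact HD]. apply Rmult_le_compat_r; [now apply Rlt_le, Hu|].
    apply pow_incr. split.
    - assert (/ s <= 1); [|lra]. rewrite <- Rinv_1. apply Rinv_le_contravar; lra.
    - unfold l. replace (sq * d * / (s * d)) with (sq * / s) by (field; lra).
      apply Rmult_le_reg_r with s; [lra|]. rewrite Rmult_assoc, Rmult_minus_distr_r, Rinv_l by lra. lra. }
  apply Rnot_lt_le. intros Hlt.
  assert (Hx := Hu x Px). assert (Hy := Hu y Py).
  set (K := INR k + 1). assert (HK : 1 <= K) by (assert (Hk := pos_INR k); unfold K; lra).
  (* In the role of 1/s, this [t] makes Bernoulli's inequality lose at most half of the supposed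
     difference [u y - u x]. *)
  set (t := (u y - u x) / (2 * K * u y)).
  assert (Ht : 0 < t < 1).
  { split; [apply Rdiv_lt_0_compat; nra|]. apply Rmult_lt_reg_r with (2 * K * u y); [nra|].
    unfold t, Rdiv. rewrite Rmult_assoc, Rinv_l by nra. nra. }
  specialize (Hs (/ t)). rewrite Rinv_inv in Hs.
  assert (H1 : 1 < / t) by (rewrite <- Rinv_1; apply Rinv_lt_contravar; lra).
  specialize (Hs H1). assert (Hb := bernoulli_lower k t ltac:(lra)).
  assert (H2 : (1 - K * t) * u y <= u x).
  { eapply Rle_trans; [|exact Hs]. apply Rmult_le_compat_r; [lra|]. unfold K. nra. }
  replace ((1 - K * t) * u y) with (u y - (u y - u x) / 2) in H2 by (unfold t; field; lra). lra.
Qed.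

(* Equality would make u constant on an annulus, where its Laplacian would vanish. *)
Lemma superharmonic_strict_antitone n u x y : superharmonic n u ->
  (forall x y, punct n x -> punct n y -> enorm n x <= enorm n y -> u y <= u x) ->
  punct n x -> punct n y -> enorm n x < enorm n y -> u y < u x.
Proof.
  intros Hsup Hanti Px Py Hxy.
  destruct (Hanti x y Px Py (Rlt_le _ _ Hxy)) as [H|H]; auto. exfalso.
  set (rx := enorm n x) in *. set (ry := enorm n y) in *.
  assert (Hrx : 0 < rx) by apply Px.
  (* This factor moves [x] to the middle radius of the annulus between |x| and |y|. *)
  set (lam := (rx + ry) / (2 * rx)).
  assert (Hlam : 0 < lam) by (apply Rdiv_lt_0_compat; lra).
  set (z := smul lam x).
  assert (Hz : enorm n z = (rx + ry) / 2).
  { unfold z. rewrite enorm_smul, Rabs_pos_eq by lra. fold rx. unfold lam. field. lra. }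
  assert (Pz : punct n z) by (split; [apply pt_smul, Px | lra]).
  destruct (Hsup z Pz) as (_ & _ & L & HL & HJ).
  assert (0 <= L); [|lra].
  assert (Hn := pos_INR n). set (e := (ry - rx) / 2).
  assert (He : 0 < e / (INR n + 1)) by (apply Rdiv_lt_0_compat; unfold e; lra).
  apply (lapjet_min_nonneg n u z L (e / (INR n + 1)) HJ He).
  intros i t Hi Ht.
  assert (Hsh : edist n (shift z i t) z < e).
  { eapply Rle_lt_trans; [now apply edist_shift|].
    replace e with ((INR n + 1) * (e / (INR n + 1))) by (field; lra).
    assert (0 <= Rabs t) by apply Rabs_pos. nra. }
  assert (Q1 := edist_triang n z (shift z i t) origin).
  assert (Q2 := edist_triang n (shift z i t) z origin).
  rewrite !edist_origin in Q1, Q2. rewrite (edist_sym n z) in Q1. unfold e in Hsh.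
  assert (Ps : punct n (shift z i t)) by (split; [apply pt_shift; auto; apply Pz | lra]).
  assert (u y <= u (shift z i t)) by (apply Hanti; auto; fold ry; lra).
  assert (u z <= u x) by (apply Hanti; auto; fold rx; lra). lra.
Qed.

Theorem theorem2p1 (n : nat) (mu1 mu2 beta q : R)
  (u v : (nat -> R) -> R) :
  (3 <= n)%nat ->
  0 < mu1 -> 0 < mu2 -> 0 < beta ->
  INR n / (INR n - 2) < 2 * q + 1 ->
  2 * q + 1 <= (INR n + 2) / (INR n - 2) ->
  (* (u, v) is a positive solution of (S) on R^n \ {0} *)
  (forall x, punct n x -> 0 < u x /\ 0 < v x) ->
  (exists Lu Lv : (nat -> R) -> R,
     C2_with_laplacian n u Lu /\ C2_with_laplacian n v Lv /\
     (forall x, punct n x ->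
        - Lu x = mu1 * Rpower (u x) (2 * q + 1)
                 + beta * Rpower (u x) q * Rpower (v x) (q + 1)) /\
     (forall x, punct n x ->
        - Lv x = mu2 * Rpower (v x) (2 * q + 1)
                 + beta * Rpower (v x) q * Rpower (u x) (q + 1))) ->
  (* limsup_{|x|->0} u = +oo  or  limsup_{|x|->0} v = +oo *)
  ((forall M delta, 0 < delta -> exists x, punct n x /\ enorm n x < delta /\ M < u x) \/
   (forall M delta, 0 < delta -> exists x, punct n x /\ enorm n x < delta /\ M < v x)) ->
  (* radial symmetry *)
  (forall x y, punct n x -> punct n y -> enorm n x = enorm n y ->
     u x = u y /\ v x = v y) /\
  (* strictly decreasing in r = |x| *)
  (forall x y, punct n x -> punct n y -> enorm n x < enorm n y ->
     u y < u x /\ v y < v x).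
Proof.
  intros Hn Hmu1 Hmu2 Hbeta Hlow Hup Hpos (Lu & Lv & Cu & Cv & Eu & Ev) Hsing.
  destruct Cu as (D1 & D2 & A1 & A2 & A3 & A4 & A5 & A6).
  destruct Cv as (D1' & D2' & B1 & B2 & B3 & B4 & B5 & B6).
  assert (HCu : C2data n u D1 D2) by (repeat split; auto).
  assert (HCv : C2data n v D1' D2') by (repeat split; auto).
  set (k := (n - 2)%nat).
  assert (Hk : (1 <= k)%nat) by (unfold k; lia).
  assert (Hnk : INR n = INR k + 2).
  { replace n with (k + 2)%nat at 1 by (unfold k; lia). rewrite plus_INR. simpl. lra. }
  assert (HkR : 1 <= INR k) by (apply (le_INR 1 k) in Hk; simpl in Hk; lra).
  rewrite Hnk in Hlow, Hup. replace (INR k + 2 - 2) with (INR k) in Hlow, Hup by ring.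
  assert (Hq : 0 < q).
  { assert (1 < (INR k + 2) / INR k); [|lra]. apply Rmult_lt_reg_r with (INR k); [lra|].
    unfold Rdiv. rewrite Rmult_assoc, Rinv_l by lra. lra. }
  assert (Hkq : INR k * (2 * q + 1) <= INR k + 4).
  { apply Rmult_le_compat_l with (r := INR k) in Hup; [|lra].
    replace (INR k * ((INR k + 2 + 2) / INR k)) with (INR k + 4) in Hup by (field; lra). exact Hup. }
  (* [sum_f_R0] includes its upper index while [rsum] excludes it, so [pred n] matches [n] because
     [n] is positive. *)
  assert (Hlap : forall (D : nat -> nat -> (nat -> R) -> R) x,
    sum_f_R0 (fun i => D i i x) (pred n) = rsum n (fun i => D i i x)).
  { intros D x. rewrite rsum_f_R0. now replace (S (pred n)) with n by lia. }
  assert (Su : solves n mu1 beta q u v D2).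
  { intros x Px. rewrite <- Hlap, <- A6 by exact Px. now apply Eu. }
  assert (Sv : solves n mu2 beta q v u D2').
  { intros x Px. rewrite <- Hlap, <- B6 by exact Px. now apply Ev. }
  assert (Hu : forall x, punct n x -> 0 < u x) by (intros; now apply Hpos).
  assert (Hv : forall x, punct n x -> 0 < v x) by (intros; now apply Hpos).
  assert (Hdom : forall c l, punct n c -> 0 <= l < enorm n c ->
    dominates n k c u l /\ dominates n k c v l).
  { intros c l Pc Hl. now apply (dominates_all n k mu1 mu2 beta q u v D1 D2 D1' D2' c). }
  assert (Mu : forall x y, punct n x -> punct n y -> enorm n x <= enorm n y -> u y <= u x).
  { intros x y. apply (dominates_antitone n k u x y Hu). intros c l Pc Hl. now apply Hdom. }
  assert (Mv : forall x y, punct n x -> punct n y -> enorm n x <= enorm n y -> v y <= v x).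
  { intros x y. apply (dominates_antitone n k v x y Hv). intros c l Pc Hl. now apply Hdom. }
  split.
  - intros x y Px Py Hxy. split; apply Rle_antisym; (apply Mu || apply Mv); auto; lra.
  - intros x y Px Py Hxy. split.
    + apply (superharmonic_strict_antitone n u x y); auto.
      now apply (solves_superharmonic n mu1 beta q u v D1 D2).
    + apply (superharmonic_strict_antitone n v x y); auto.
      now apply (solves_superharmonic n mu2 beta q v u D1' D2').
Qed.
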